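(* The decision problem \textsc{Consistent} is $\mathsf{NP}$-complete. Here \textsc{Consistent} is the following problem. Input: a positive integer $K$; an antimonotonic family $\mathcal{F}=\{B_1,\ldots,B_N\}$ of itemsets over the attributes $A=\{a_1,\ldots,a_K\}$, listed explicitly; and a vector $\theta=(\theta_1,\ldots,\theta_N)$ of rational numbers. Question: is there a probability distribution $q$ on $\Omega=\{0,1\}^K$ with $q(B_i=1)=\theta_i$ for all $i=1,\ldots,N$?
   Context: Let $\Omega = \{0,1\}^K$; the $i$-th coordinate is attribute $a_i$. An itemset is a subset of $A$. A family of itemsets is antimonotonic if every subset of every member also belongs to it. For a distribution $q$ on $\Omega$ and an itemset $B=\{a_{i_1},\ldots,a_{i_L}\}$, $q(B=1)$ denotes $q(a_{i_1}=1,\ldots,a_{i_L}=1)$, the frequency of $B$. *)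

(* Defs.v *)
From HB Require Import structures.
From mathcomp Require Import all_boot all_order all_algebra.
From mathcomp Require Import reals.

Set Implicit Arguments.
Unset Strict Implicit.
Unset Printing Implicit Defensive.

Import Order.TTheory GRing.Theory Num.Theory.

(* [None] is the blank, [Some (inl b)] an input/output bit and [Some (inr s)]
   an auxiliary work symbol. *)
Definition cell (S : finType) : Type := option (bool + S).

Inductive move : Type := MoveLeft | Stay | MoveRight.

Record TM : Type := MkTM {
  tm_tapes : nat; (* there are [tm_tapes.+1] tapes, so at least one *)
  tm_sym : finType;
  tm_state : finType;
  tm_start : tm_state;
  tm_halt : pred tm_state;
  tm_accept : pred tm_state;
  tm_trans : tm_state -> {ffun 'I_tm_tapes.+1 -> cell tm_sym} ->
             tm_state * {ffun 'I_tm_tapes.+1 -> cell tm_sym * move}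
}.

(* A two-way infinite tape: the cells strictly left of the head, nearest first,
   and the cells from the head on; all cells not listed are blank. *)
Definition tape (S : finType) : Type := (seq (cell S) * seq (cell S))%type.

Definition tape_read (S : finType) (t : tape S) : cell S := head None t.2.

Definition tape_act (S : finType) (am : cell S * move) (t : tape S) : tape S :=
  let: (a, m) := am in
  let: (l, r) := (t.1, behead t.2) in
  match m with
  | MoveLeft => (behead l, head None l :: a :: r)
  | Stay => (l, a :: r)
  | MoveRight => (a :: l, r)
  end.

Definition config (M : TM) : Type :=
  (tm_state M * {ffun 'I_(tm_tapes M).+1 -> tape (tm_sym M)})%type.

Definition step (M : TM) (c : config M) : config M :=
  if tm_halt c.1 then c else
  let: (q, act) := tm_trans c.1 [ffun i => tape_read (c.2 i)] in
  (q, [ffun i => tape_act (act i) (c.2 i)]).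

(* The [i]-th input word is written on tape [i], with the head on its first
   letter; the tapes without an input word are blank. *)
Definition init (M : TM) (ws : seq (seq bool)) : config M :=
  (tm_start M,
   [ffun i : 'I_(tm_tapes M).+1 =>
      ([::], [seq Some (inl b) | b <- nth [::] ws i])]).

Definition run (M : TM) (ws : seq (seq bool)) (t : nat) : config M :=
  iter t (@step M) (init M ws).

Definition halted (M : TM) (c : config M) : bool := tm_halt c.1.

Definition accepting (M : TM) (c : config M) : bool := tm_accept c.1.

Fixpoint leading_bits (S : finType) (s : seq (cell S)) : seq bool :=
  if s is Some (inl b) :: s' then b :: leading_bits s' else [::].

(* The output is the maximal word of bits starting at the head of tape 0. *)
Definition output (M : TM) (c : config M) : seq bool :=
  leading_bits (c.2 ord0).2.

Definition language : Type := seq bool -> Prop.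

Definition poly_bound (c k n : nat) : nat := c * n ^ k + c.

Definition poly_time_computable (f : seq bool -> seq bool) : Prop :=
  exists (M : TM) (c k : nat), forall x : seq bool,
    let final := run M [:: x] (poly_bound c k (size x)) in
    halted final /\ output final = f x.

Definition poly_time_decidable2 (V : seq bool -> seq bool -> Prop) : Prop :=
  exists (M : TM) (c k : nat), forall x w : seq bool,
    let final := run M [:: x; w] (poly_bound c k (size x + size w)) in
    halted final /\ (accepting final <-> V x w).

Definition in_NP (L : language) : Prop :=
  exists (V : seq bool -> seq bool -> Prop) (c k : nat),
    poly_time_decidable2 V /\
    forall x, L x <-> exists w, size w <= poly_bound c k (size x) /\ V x w.

Definition poly_reducible (L L' : language) : Prop :=
  exists f : seq bool -> seq bool,
    poly_time_computable f /\ forall x, L x <-> L' (f x).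

Definition NP_hard (L : language) : Prop :=
  forall L' : language, in_NP L' -> poly_reducible L' L.

Definition NP_complete (L : language) : Prop := in_NP L /\ NP_hard L.

(* The attributes are indexed from 0: [i : 'I_K] stands for a_(i+1), and an
   itemset is a [B : {set 'I_K}]. *)
Notation Omega K := {ffun 'I_K -> bool}.

Definition antimonotonic (K : nat) (F : seq {set 'I_K}) : Prop :=
  forall B C : {set 'I_K}, B \in F -> C \subset B -> C \in F.

Section Frequency.
Local Open Scope ring_scope.

Definition is_distribution (R : realType) (K : nat) (q : Omega K -> R) : Prop :=
  (forall x, 0 <= q x) /\ \sum_(x : Omega K) q x = 1.

Definition frequency (R : realType) (K : nat) (q : Omega K -> R)
    (B : {set 'I_K}) : R :=
  \sum_(x : Omega K | [forall i in B, x i]) q x.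

End Frequency.

Record instance : Type := Instance {
  nattr : nat;
  nsets : nat;
  itemsets : nsets.-tuple {set 'I_nattr};
  freqs : nsets.-tuple rat
}.

(* [uniq]: a family is a set of itemsets, so its members are listed once. *)
Definition valid_instance (I : instance) : Prop :=
  [/\ 0 < nattr I, uniq (itemsets I) & antimonotonic (itemsets I)].

Definition consistent (R : realType) (I : instance) : Prop :=
  exists q : Omega (nattr I) -> R,
    is_distribution q /\
    forall i : 'I_(nsets I),
      frequency q (tnth (itemsets I) i) = ratr (tnth (freqs I) i).

(* All codes below are prefix codes: in a list each item is announced by the
   bit 1, and the bit 0 closes the list. *)
Definition enc_seq (T : Type) (e : T -> seq bool) (s : seq T) : seq bool :=
  flatten [seq true :: e x | x <- s] ++ [:: false].

(* The binary digits of [n], least significant first and without leading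
   zeros; [up_log 2 n.+1] is their number. *)
Definition binary (n : nat) : seq bool :=
  mkseq (fun i => odd (n %/ 2 ^ i)) (up_log 2 n.+1).

Definition enc_nat (n : nat) : seq bool := enc_seq (fun b => [:: b]) (binary n).

Definition enc_int (z : int) : seq bool := (z < 0)%R :: enc_nat `|z|%N.

(* Rationals are written as fractions in lowest terms. *)
Definition enc_rat (r : rat) : seq bool :=
  enc_int (numq r) ++ enc_nat `|denq r|%N.

Definition enc_itemset (K : nat) (B : {set 'I_K}) : seq bool :=
  enc_seq enc_nat [seq val i | i <- enum B].

Definition enc_instance (I : instance) : seq bool :=
  enc_nat (nattr I) ++
  enc_seq (@enc_itemset (nattr I)) (itemsets I) ++
  enc_seq enc_rat (freqs I).

Definition CONSISTENT (R : realType) : language :=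
  fun x => exists I : instance,
    [/\ x = enc_instance I, valid_instance I & consistent R I].

Definition prefix_code (T : Type) (e : T -> seq bool) : Prop :=
  forall x y u v, e x ++ u = e y ++ v -> x = y /\ u = v.

Lemma enc_seq_prefix (T : Type) (e : T -> seq bool) :
  prefix_code e -> prefix_code (enc_seq e).
Proof.
move=> eP; elim=> [|a s IHs] [|b t] u v; rewrite /enc_seq //=.
  by case.
rewrite -!catA => -[] /eP[-> est].
by have [|-> ->] := IHs t u v; first by rewrite /enc_seq -!catA.
Qed.

Lemma binary_inj : injective binary.
Proof.
have odd0 n i : up_log 2 n.+1 <= i -> odd (n %/ 2 ^ i) = false.
  move=> le_i; rewrite divn_small //.
  by apply: leq_trans (up_logP n.+1 (isT : 1 < 2)) _; rewrite leq_exp2l.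
have nth_bin n i : nth false (binary n) i = odd (n %/ 2 ^ i).
  rewrite /binary; case: (ltnP i (up_log 2 n.+1)) => hi; first by rewrite nth_mkseq.
  by rewrite nth_default ?size_mkseq // odd0.
have key m n : (forall i, odd (m %/ 2 ^ i) = odd (n %/ 2 ^ i)) -> m = n.
  have [k] := ubnP m; elim: k m n => // k IHk m n le_mk h.
  have h0 := h 0; rewrite !expn0 !divn1 in h0.
  have hS i : odd (m./2 %/ 2 ^ i) = odd (n./2 %/ 2 ^ i).
    by rewrite -!divn2 -!divnMA -!expnS.
  case: m le_mk h h0 hS => [|m] le_mk h h0 hS.
    case: (posnP n) => // n_gt0; have := h (trunc_log 2 n).
    rewrite div0n /=; have /andP[lo hi] := trunc_log_bounds (isT : 1 < 2) n_gt0.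
    have -> : n %/ 2 ^ trunc_log 2 n = 1; last by [].
    apply/eqP; rewrite eqn_leq -ltnS ltn_divLR ?expn_gt0 // -expnS hi.
    by rewrite divn_gt0 ?expn_gt0.
  have hm : m.+1./2 = n./2.
    apply: IHk hS; rewrite -ltnS; apply: leq_trans le_mk.
    by rewrite ltnS -divn2 ltn_Pdiv.
  by rewrite -(odd_double_half m.+1) -(odd_double_half n) h0 hm.
by move=> m n e; apply: key => i; rewrite -!nth_bin e.
Qed.

Lemma enc_nat_prefix : prefix_code enc_nat.
Proof.
move=> m n u v /enc_seq_prefix[|/binary_inj-> ->] //.
by move=> a b u' v' [-> ->].
Qed.

Lemma enc_int_prefix : prefix_code enc_int.
Proof.
move=> m n u v [sg /enc_nat_prefix[ab ->]]; split=> //.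
by case: m n sg ab => [m|m] [n|n] //= _; rewrite ?absz_nat ?NegzE ?abszN => ->.
Qed.

Lemma enc_rat_prefix : prefix_code enc_rat.
Proof.
move=> r s u v; rewrite /enc_rat -(catA (enc_int (numq r))) -(catA (enc_int (numq s))) => /enc_int_prefix[en /enc_nat_prefix[ed ->]].
have edz : denq r = denq s by rewrite -(absz_denq r) ed absz_denq.
by split; rewrite // -[r]divq_num_den en edz divq_num_den.
Qed.

Lemma enc_itemset_prefix (K : nat) : prefix_code (@enc_itemset K).
Proof.
move=> B C u v /(enc_seq_prefix enc_nat_prefix)[/(inj_map val_inj) eBC ->].
by split; [apply/setP=> i; rewrite -(mem_enum B) eBC mem_enum | exact: erefl].
Qed.

Lemma enc_instance_inj : injective enc_instance.
Proof.
move=> [K N B r] [K' N' B' r']; rewrite /enc_instance /=.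
move=> /enc_nat_prefix[eK]; subst K'.
move=> /(enc_seq_prefix (@enc_itemset_prefix K))[eB].
rewrite -[LHS]cats0 -[RHS]cats0 => /(enc_seq_prefix enc_rat_prefix)[er _].
have eN : N = N' by rewrite -(size_tuple r) er size_tuple.
by subst N'; rewrite (val_inj eB) (val_inj er).
Qed.

(* Main.v *)
From HB Require Import structures.
From mathcomp Require Import all_boot all_order all_algebra.
From mathcomp Require Import fingroup perm.
From mathcomp Require Import zify ring lra.
Require Import Defs.
From mathcomp Require Import reals.

(* Membership: a consistent instance has a consistent distribution supported on
   at most N + 1 points (Caratheodory), and Cramer's rule bounds the common
   denominator of its weights, so the points and weights form a short certificate.

   Hardness: the computation tableau of a verifier, stored column by column with
   positions relative to the heads, is a binary constraint satisfaction problem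
   over a fixed domain W.  Identify W with a cyclic group and make it invariant
   under shifts: a solution s is shifted by a uniformly random (r1, r2) in W * W,
   and each variable v has two copies, with values (r1 + s v, r2) and
   (r1, r2 + s v), next to a reference with value (r1, r2).  Every single value
   then has frequency 1/|W|^2 whatever s is, every value of s can be read off two
   shifted values, and so the constraints become pairs of attributes of
   frequency 0.

   Both directions need polynomial-time Turing machines: programs over four
   stacks of bits are compiled to four-tape machines, and functions between
   types encoded as binary trees are compiled to such programs. *)

Set Implicit Arguments.
Unset Strict Implicit.
Unset Printing Implicit Defensive.

(** * Multi-stack programs and Turing machines *)

(** The number K of attributes is written in binary, so it may be exponential in the length of the
    input. For membership this means that a point of [Omega] cannot be listed coordinate by
    coordinate: a certificate records only attributes that occur in some itemset. For hardness it is
    a help: attributes are simply named by words of a fixed length.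

    Antimonotonicity is the obstacle to hardness. All subsets of a listed itemset must be given a
    frequency too, and the reduction has to know these numbers without knowing a solution. Hence
    only pairs of frequency 0 are used, whose proper subsets are single values and the empty set.
    One shift would not do: the values [r + s u] and [r + s v] show only the difference of [s u] and
    [s v], and adding the reference as a third attribute would create pairs whose frequencies reveal
    the solution. With two independent shifts, the copy of [u] in one coordinate and the copy of [v]
    in the other show each other's unshifted coordinate, so that a pair determines both [s u] and
    [s v]. *)

Inductive reg : Type := R0 | R1 | R2 | R3.

Inductive stacks : Type := Stacks of seq bool & seq bool & seq bool & seq bool.

Definition get (r : reg) (s : stacks) : seq bool :=
  let: Stacks s0 s1 s2 s3 := s in
  match r with R0 => s0 | R1 => s1 | R2 => s2 | R3 => s3 end.

Definition set (r : reg) (l : seq bool) (s : stacks) : stacks :=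
  let: Stacks s0 s1 s2 s3 := s in
  match r with
  | R0 => Stacks l s1 s2 s3
  | R1 => Stacks s0 l s2 s3
  | R2 => Stacks s0 s1 l s3
  | R3 => Stacks s0 s1 s2 l
  end.

Inductive cmd : Type :=
| Skip
| Push of reg & bool
| Pop of reg
| Seq of cmd & cmd
| If of reg & (option bool -> bool) & cmd & cmd
| While of reg & (option bool -> bool) & cmd.

Notation "c ;; d" := (Seq c d) (at level 55, right associativity).

Definition top (r : reg) (s : stacks) : option bool := ohead (get r s).

(* [exec c s t s'] says that [c] leads from [s] to [s'] in at most [t] steps of
   the Turing machine compiled from [c]. *)
Inductive exec : cmd -> stacks -> nat -> stacks -> Prop :=
| ExSkip s : exec Skip s 1 s
| ExPush r b s : exec (Push r b) s 2 (set r (b :: get r s) s)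
| ExPop r s : exec (Pop r) s 1 (set r (behead (get r s)) s)
| ExSeq c d s t s1 u s2 :
    exec c s t s1 -> exec d s1 u s2 -> exec (c ;; d) s (t + u) s2
| ExIf r (P : option bool -> bool) c d s t s1 :
    exec (if P (top r s) then c else d) s t s1 -> exec (If r P c d) s t.+1 s1
| ExWhileF r (P : option bool -> bool) c s :
    ~~ P (top r s) -> exec (While r P c) s 1 s
| ExWhileT r (P : option bool -> bool) c s t s1 u s2 :
    P (top r s) -> exec c s t s1 -> exec (While r P c) s1 u s2 ->
    exec (While r P c) s (t + u).+1 s2
| ExWeak c s t u s1 : t <= u -> exec c s t s1 -> exec c s u s1.

Definition stacks_size (s : stacks) : nat :=
  let: Stacks s0 s1 s2 s3 := s in size s0 + size s1 + size s2 + size s3.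

(** A run adds at most one bit per step, so a time bound also bounds the size of the result;
    [poly_size] rests on this. *)
Lemma exec_size c s t s1 : exec c s t s1 -> stacks_size s1 <= stacks_size s + t.
Proof.
elim=> {c s t s1} [[s0 s1 s2 s3]|[] b [s0 s1 s2 s3]|[] [s0 s1 s2 s3]|||||] //=;
  rewrite ?size_behead; intros; lia.
Qed.

(** * Compilation of programs to four-tape machines *)

Notation symbol := (cell void).
Notation reads := {ffun 'I_4 -> symbol}.
Notation actions := {ffun 'I_4 -> symbol * move}.
Notation tapes := {ffun 'I_4 -> tape void}.

Definition ord_of (r : reg) : 'I_4 :=
  match r with
  | R0 => @Ordinal 4 0 isT | R1 => @Ordinal 4 1 isT
  | R2 => @Ordinal 4 2 isT | R3 => @Ordinal 4 3 isT
  end.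

Definition bit_of (a : symbol) : option bool :=
  if a is Some (inl b) then Some b else None.

Definition bit_cell (b : bool) : symbol := Some (inl b).

(** The next state [None] is the exit; a composed machine redirects it to the start of the machine
    that follows. *)
Record machine : Type := Machine {
  mstate : finType;
  mstart : mstate;
  mtrans : mstate -> reads -> option mstate * actions
}.

Definition act_stay (rd : reads) : actions := [ffun i => (rd i, Stay)].

Definition act_on (r : reg) (a : symbol * move) (rd : reads) : actions :=
  [ffun i => if i == ord_of r then a else (rd i, Stay)].

Fixpoint compile (c : cmd) : machine :=
  match c with
  | Skip => @Machine unit tt (fun _ rd => (None, act_stay rd))
  | Push r b => @Machine bool true (fun q rd =>
      if q then (Some false, act_on r (rd (ord_of r), MoveLeft) rd)
      else (None, act_on r (bit_cell b, Stay) rd))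
  | Pop r => @Machine unit tt (fun _ rd => (None, act_on r (None, MoveRight) rd))
  | Seq c d =>
      let m := compile c in let m' := compile d in
      @Machine (mstate m + mstate m')%type (inl (mstart m)) (fun q rd =>
        match q with
        | inl q => let: (o, a) := mtrans q rd in
            (Some (if o is Some q' then inl q' else inr (mstart m')), a)
        | inr q => let: (o, a) := mtrans q rd in (omap inr o, a)
        end)
  | If r P c d =>
      let m := compile c in let m' := compile d in
      @Machine (option (mstate m + mstate m')) None (fun q rd =>
        match q with
        | None => (Some (Some (if P (bit_of (rd (ord_of r))) then inl (mstart m)
                               else inr (mstart m'))), act_stay rd)
        | Some (inl q) => let: (o, a) := mtrans q rd in
            (omap (fun q' => Some (inl q')) o, a)
        | Some (inr q) => let: (o, a) := mtrans q rd in
            (omap (fun q' => Some (inr q')) o, a)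
        end)
  | While r P c =>
      let m := compile c in
      @Machine (option (mstate m)) None (fun q rd =>
        match q with
        | None => (if P (bit_of (rd (ord_of r))) then Some (Some (mstart m))
                   else None, act_stay rd)
        | Some q => let: (o, a) := mtrans q rd in (Some o, a)
        end)
  end.

Definition read_all (v : tapes) : reads := [ffun i => tape_read (v i)].

Definition act_all (a : actions) (v : tapes) : tapes :=
  [ffun i => tape_act (a i) (v i)].

Inductive reach (m : machine) : mstate m -> tapes -> nat -> tapes -> Prop :=
| ReachDone q v a :
    mtrans q (read_all v) = (None, a) -> reach q v 1 (act_all a v)
| ReachStep q v q' a t v' :
    mtrans q (read_all v) = (Some q', a) -> reach q' (act_all a v) t v' ->
    reach q v t.+1 v'.

(* What lies to the left of the head is never read again, so it is arbitrary. *)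
Definition represents (v : tapes) (s : stacks) : Prop :=
  forall r, exists k,
    (v (ord_of r)).2 = map bit_cell (get r s) ++ nseq k None.

Lemma ord_of_inj : injective ord_of.
Proof. by move=> [] [] // /(congr1 val). Qed.

Lemma get_set r' r l s :
  get r' (set r l s) = if ord_of r' == ord_of r then l else get r' s.
Proof. by case: s => s0 s1 s2 s3; case: r; case: r'. Qed.

Lemma represents_top v s r :
  represents v s -> bit_of (read_all v (ord_of r)) = top r s.
Proof.
move=> /(_ r)[k e]; rewrite ffunE /tape_read e /top.
by case: (get r s) => //=; case: k {e}.
Qed.

(** Writing back the symbol read turns an empty list of cells into one explicit blank; this is why
    [represents] leaves the number of trailing blanks free. *)
Lemma represents_stay_tape (t : tape void) (s : seq bool) k :
  t.2 = map bit_cell s ++ nseq k None ->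
  exists k', (tape_act (tape_read t, Stay) t).2 = map bit_cell s ++ nseq k' None.
Proof.
case: t => l r /= ->; rewrite /tape_read /=.
case: s => [|b s] /=; last by exists k.
by case: k => [|k]; [exists 1 | exists k.+1].
Qed.

Lemma represents_stay v s :
  represents v s -> represents (act_all (act_stay (read_all v)) v) s.
Proof.
move=> H r; have [k e] := H r; rewrite !ffunE.
exact: represents_stay_tape e.
Qed.

Lemma represents_on v s r a l :
  represents v s ->
  (exists k, (tape_act a (v (ord_of r))).2 = map bit_cell l ++ nseq k None) ->
  represents (act_all (act_on r a (read_all v)) v) (set r l s).
Proof.
move=> H [k e] r'; rewrite !ffunE get_set.
case: eqP => [->|_]; first by exists k.
by have [k' e'] := H r'; apply: represents_stay_tape e'.
Qed.

Lemma reach_seq1 c d q v t v' :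
  @reach (compile c) q v t v' -> forall u w,
  @reach (compile (c ;; d)) (inr (mstart (compile d))) v' u w ->
  @reach (compile (c ;; d)) (inl q) v (t + u) w.
Proof.
elim=> {q v t v'} [q v a e|q v q' a t v' e _ IH] u w H.
  by rewrite add1n; apply: ReachStep H => /=; rewrite e.
by rewrite addSn; apply: ReachStep (IH _ _ H); rewrite /= e.
Qed.

Lemma reach_map m m' (h : mstate m -> mstate m') :
  (forall q rd, mtrans (h q) rd =
     let: (o, a) := mtrans q rd in (omap h o, a)) ->
  forall q v t v', reach q v t v' -> reach (h q) v t v'.
Proof.
move=> H q v t v'; elim=> {q v t v'} [q v a e|q v q' a t v' e _ IH].
  by apply: ReachDone; rewrite H e.
by apply: ReachStep IH; rewrite H e.
Qed.

Lemma reach_while r P c q v t v' :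
  @reach (compile c) q v t v' -> forall u w,
  @reach (compile (While r P c)) None v' u w ->
  @reach (compile (While r P c)) (Some q) v (t + u) w.
Proof.
elim=> {q v t v'} [q v a e|q v q' a t v' e _ IH] u w H.
  by rewrite add1n; apply: ReachStep H => /=; rewrite e.
by rewrite addSn; apply: ReachStep (IH _ _ H); rewrite /= e.
Qed.

Lemma compile_correct c s t s' :
  exec c s t s' -> forall v, represents v s ->
  exists u v', [/\ u <= t, reach (mstart (compile c)) v u v' & represents v' s'].
Proof.
elim=> {c s t s'}
  [s|r b s|r s|c d s t s1 u s2 _ IH1 _ IH2|r P c d s t s1 _ IH|r P c s nP
  |r P c s t s1 u s2 yP _ IH1 _ IH2|c s t u s1 le_tu _ IH] v rv.
- exists 1, (act_all (act_stay (read_all v)) v).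
  by split=> //; [apply: ReachDone | apply: represents_stay].
- pose v1 := act_all (act_on r (read_all v (ord_of r), MoveLeft) (read_all v)) v.
  exists 2, (act_all (act_on r (bit_cell b, Stay) (read_all v1)) v1); split=> //.
    apply: (@ReachStep (compile (Push r b)) _ v false) => //.
    exact: ReachDone.
  (* After the first step of [Push] the head stands on a cell [l] of unknown content, just left of
     the stack; the second step overwrites it. *)
  have r1 r' : exists k l, (v1 (ord_of r')).2 =
      (if ord_of r' == ord_of r then l :: map bit_cell (get r' s)
       else map bit_cell (get r' s)) ++ nseq k None.
    rewrite !ffunE; have [k e] := rv r'.
    case: eqP => [<-|_]; last first.
      by have [k' e'] := represents_stay_tape e; exists k', None.
    rewrite ?ffunE.
    have [k' /= e'] := represents_stay_tape e.
    exists k', (head None (v (ord_of r')).1) => /=.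
    by move: e'; rewrite /tape_act ?ffunE /= => <-.
  move=> r'; have [k [l e]] := r1 r'; move: e; rewrite get_set.
  have -> tp : (act_all tp v1) (ord_of r') = tape_act (tp (ord_of r')) (v1 (ord_of r')).
    by rewrite ffunE.
  rewrite [act_on _ _ _ _]ffunE [read_all v1 _]ffunE.
  clearbody v1; case: (eqVneq (ord_of r') (ord_of r)) => [/ord_of_inj <-|_] e.
    by exists k; rewrite /= e.
  exact: represents_stay_tape e.
- exists 1, (act_all (act_on r (None, MoveRight) (read_all v)) v).
  split=> //; first exact: ReachDone.
  apply: represents_on => //; have [k e] := rv r; rewrite /= e.
  case: (get r s) => [|b l] /=; last by exists k.
  by case: k {e} => [|k]; [exists 0 | exists k].
- have [u1 [v1 [le1 h1 r1]]] := IH1 _ rv; have [u2 [v2 [le2 h2 r2]]] := IH2 _ r1.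
  exists (u1 + u2), v2; split=> //; first exact: leq_add.
  apply: reach_seq1 h1 _ _ _.
  by apply: (reach_map (m' := compile (c ;; d)) (h := inr)) h2.
- have [u1 [v1 [le1 h1 r1]]] := IH _ (represents_stay rv).
  exists u1.+1, v1; split=> //.
  apply: ReachStep => /=; first by rewrite (represents_top r rv).
  case: (P (top r s)) h1 => h1.
    by apply: (reach_map (m' := compile (If r P c d)) (h := fun q => Some (inl q))) h1.
  by apply: (reach_map (m' := compile (If r P c d)) (h := fun q => Some (inr q))) h1.
- exists 1, (act_all (act_stay (read_all v)) v).
  split=> //; last exact: represents_stay rv.
  by apply: ReachDone => /=; rewrite (represents_top r rv) (negPf nP).
- have [u1 [v1 [le1 h1 r1]]] := IH1 _ (represents_stay rv).
  have [u2 [v2 [le2 h2 r2]]] := IH2 _ r1.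
  exists (u1 + u2).+1, v2; split=> //; first by rewrite ltnS leq_add.
  apply: ReachStep => /=; first by rewrite (represents_top r rv) yP.
  exact: reach_while h1 _ _ h2.
- have [u1 [v1 [le1 h1 r1]]] := IH _ rv.
  by exists u1, v1; split=> //; apply: leq_trans le_tu.
Qed.

(** The state [inl None] adds one step after the exit of the program: it turns the top bit of [R0]
    into the verdict, which the halting states [inr b] record. *)
Definition machine_TM (m : machine) : TM :=
  @MkTM 3 void (option (mstate m) + bool)%type (inl (Some (mstart m)))
    (fun q => if q is inr _ then true else false)
    (fun q => if q is inr b then b else false)
    (fun q rd => match q with
       | inl (Some q) => let: (o, a) := mtrans q rd in (inl o, a)
       | inl None => (inr (bit_of (rd ord0) == Some true), act_stay rd)
       | inr b => (inr b, act_stay rd)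
       end).

Lemma run_reach m q v t v' : @reach m q v t v' ->
  iter t (@step (machine_TM m)) (inl (Some q), v) = (inl None, v').
Proof.
elim=> {q v t v'} [q v a e|q v q' a t v' e _ IH].
  by rewrite /= /step /=; move: e; rewrite /read_all => ->.
rewrite iterSr -IH; congr (iter t _ _); rewrite /step /=.
by move: e; rewrite /read_all => ->.
Qed.

Lemma iter_step_halted (M : TM) (c : config M) t :
  halted c -> iter t (@step M) c = c.
Proof.
rewrite /halted => h; elim: t => //= t ->.
by rewrite /step h.
Qed.

(** The strict inequality [t < T] pays for the extra deciding step; from then on the configuration
    does not change. *)
Lemma exec_run c s0 s1 t s' T :
  exec c (Stacks s0 s1 [::] [::]) t s' -> t < T ->
  let M := machine_TM (compile c) in
  forall ws, nth [::] ws 0 = s0 -> nth [::] ws 1 = s1 -> size ws <= 2 ->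
  exists v k, let final := run M ws T in
  [/\ halted final, accepting final = (top R0 s' == Some true) &
      final.2 = v /\ (v ord0).2 = map bit_cell (get R0 s') ++ nseq k None].
Proof.
move=> ex lt_tT M ws e0 e1 sz.
have [|u [v [le_ut /run_reach hr rv]]] := compile_correct ex (v := (init M ws).2).
  move=> r; exists 0; rewrite cats0 ffunE.
  by case: r => /=; rewrite ?e0 ?e1 ?nth_default // ltnW.
have le_uT : u.+1 <= T by apply: leq_ltn_trans lt_tT.
have -> : run M ws T = iter (T - u.+1) (@step M) (iter u.+1 (@step M) (init M ws)).
  by rewrite -iterD subnK.
have -> : init M ws = (inl (Some (mstart (compile c))), (init M ws).2) by [].
rewrite iterS hr /=; set cf := step _.
have hcf : cf = (inr (top R0 s' == Some true), act_all (act_stay (read_all v)) v).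
  by rewrite /cf /step /= -(represents_top R0 rv) /=; congr (inr (bit_of _ == _), _); rewrite !ffunE; congr (tape_read (v _)); apply: val_inj.
rewrite iter_step_halted; last by rewrite hcf.
have [k e] := represents_stay rv R0.
exists cf.2, k; rewrite hcf; split=> //; split=> //.
by rewrite -e; congr (_ _).2; apply: val_inj.
Qed.

(** * Polynomial-time functions on tree-encoded types *)

(** Polynomials are given by their construction, so that monotonicity and closure under composition
    are plain inductions. *)
Inductive is_poly : (nat -> nat) -> Prop :=
| IsPolyId : is_poly id
| IsPolyConst c : is_poly (fun=> c)
| IsPolyAdd p q : is_poly p -> is_poly q -> is_poly (fun n => p n + q n)
| IsPolyMul p q : is_poly p -> is_poly q -> is_poly (fun n => p n * q n).

Lemma is_poly_comp p q : is_poly p -> is_poly q -> is_poly (fun n => p (q n)).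
Proof. by move=> + hq; elim=> *; [apply: hq|constructor..]. Qed.

Lemma is_poly_exp p k : is_poly p -> is_poly (fun n => p n ^ k).
Proof.
move=> hp; case: k => [|k]; first exact: (IsPolyConst 1).
by elim: k => // k IH; apply: IsPolyMul hp IH.
Qed.

Lemma is_poly_mono p : is_poly p -> {homo p : m n / m <= n}.
Proof.
elim=> [//|c|{}p q _ hp _ hq|{}p q _ hp _ hq] m n le_mn //.
  by rewrite leq_add ?hp ?hq.
by rewrite leq_mul ?hp ?hq.
Qed.

Lemma is_poly_bound p : is_poly p -> exists c k, forall n, p n <= poly_bound c k n.
Proof.
move=> hp.
(* The base [n.+1] is positive, so that two exponents can be raised to a common one. *)
have [c [k h]] : exists c k, forall n, p n <= c * n.+1 ^ k.
  elim: hp => [|c|{}p q _ [c [k h]] _ [c' [k' h']]|{}p q _ [c [k h]] _ [c' [k' h']]].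
  - by exists 1, 1 => n; rewrite mul1n.
  - by exists c, 0 => n; rewrite muln1.
  - exists (c + c'), (k + k') => n; rewrite mulnDl; apply: leq_add.
      apply: leq_trans (h n) _; rewrite leq_mul2l; apply/orP; right.
      by apply: leq_pexp2l; rewrite ?leq_addr.
    apply: leq_trans (h' n) _; rewrite leq_mul2l; apply/orP; right.
    by apply: leq_pexp2l; rewrite ?leq_addl.
  - exists (c * c'), (k + k') => n; rewrite expnD mulnACA.
    exact: leq_mul.
(* For positive n, [n.+1] is at most [2 * n]; the additive constant of [poly_bound] covers n = 0. *)
exists (c * 2 ^ k), k => n; apply: leq_trans (h n) _.
rewrite /poly_bound; case: n => [|n].
  by rewrite exp1n muln1 (leq_trans _ (leq_addl _ _)) // leq_pmulr // expn_gt0.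
rewrite (leq_trans _ (leq_addr _ _)) // -mulnA leq_mul2l -expnMn; apply/orP; right.
by case: k {h} => // k; rewrite leq_exp2r //; lia.
Qed.

Lemma is_poly_monomial c k : is_poly (poly_bound c k).
Proof.
apply: IsPolyAdd; last exact: IsPolyConst.
by apply: IsPolyMul; [apply: IsPolyConst | apply: is_poly_exp IsPolyId].
Qed.

Ltac is_poly_tac :=
  lazymatch goal with
  | |- is_poly (fun n => n) => exact IsPolyId
  | |- is_poly (fun _ => ?c) => exact (IsPolyConst c)
  | |- is_poly (fun n => @?p n + @?q n) =>
      refine (@IsPolyAdd p q _ _); is_poly_tac
  | |- is_poly (fun n => @?p n * @?q n) =>
      refine (@IsPolyMul p q _ _); is_poly_tac
  | |- is_poly (fun n => (@?p n).+1) =>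
      refine (@IsPolyAdd (fun=> 1) p _ _); is_poly_tac
  | |- is_poly (fun n => ?p (@?q n)) =>
      refine (@is_poly_comp p q _ _); [assumption | is_poly_tac]
  | |- _ => assumption
  end.

Lemma is_poly_lin a b : is_poly (fun n => a * n + b).
Proof.
is_poly_tac.
Qed.

(** * Binary trees on the stacks *)

Inductive tree : Type := Leaf | Node of tree & tree.

(** Polish notation: the code delimits itself, so a value can lie on top of arbitrary data on the
    same stack. *)
Fixpoint tcode (t : tree) : seq bool :=
  if t is Node a b then true :: tcode a ++ tcode b else [:: false].

Definition tsize (t : tree) : nat := size (tcode t).

Lemma tsizeN a b : tsize (Node a b) = (tsize a + tsize b).+1.
Proof. by rewrite /tsize /= size_cat. Qed.

Definition is_bit1 (o : option bool) : bool := o == Some true.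

(** [R3] counts in unary the subtrees still to be read: each round removes one, and a bit 1, which
    opens a node, adds two. The command [k] is run on every bit of the code. *)
Definition eat_loop (k : bool -> cmd) : cmd :=
  While R3 is_bit1 (Pop R3 ;; If R0 is_bit1
    (Pop R0 ;; k true ;; Push R3 true ;; Push R3 true) (Pop R0 ;; k false)).

Definition eat (k : bool -> cmd) : cmd :=
  Push R3 false ;; Push R3 true ;; eat_loop k ;; Pop R3.

Lemma exec_le c s t u s1 : exec c s t s1 -> t <= u -> exec c s u s1.
Proof. by move=> h le; apply: ExWeak h. Qed.

Section Eat.
Variables (k : bool -> cmd) (F1 F2 : seq bool -> bool -> seq bool) (d : nat).
Hypothesis kP : forall b s0 s1 s2 s3,
  exec (k b) (Stacks s0 s1 s2 s3) d (Stacks s0 (F1 s1 b) (F2 s2 b) s3).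

Lemma eat_loopP t s0 s1 s2 s3 T s' :
  exec (eat_loop k)
    (Stacks s0 (foldl F1 s1 (tcode t)) (foldl F2 s2 (tcode t)) s3) T s' ->
  exec (eat_loop k) (Stacks (tcode t ++ s0) s1 s2 (true :: s3))
    ((d + 8) * tsize t + T) s'.
Proof.
elim: t s0 s1 s2 s3 T s' => [|a IHa b IHb] s0 s1 s2 s3 T s' H.
  apply: exec_le.
    apply: ExWhileT H => //.
    apply: ExSeq; first exact: ExPop.
    apply: ExIf; apply: ExSeq; first exact: ExPop.
    exact: kP.
  rewrite /tsize /=; lia.
have H1 : exec (eat_loop k)
    (Stacks (tcode a ++ tcode b ++ s0) (F1 s1 true) (F2 s2 true) [:: true, true & s3])
    ((d + 8) * tsize a + ((d + 8) * tsize b + T)) s'.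
  by apply: IHa; apply: IHb; rewrite -!foldl_cat.
apply: exec_le.
  apply: ExWhileT; [by []| |exact: H1].
  apply: ExSeq; first exact: ExPop.
  apply: ExIf; apply: ExSeq; first exact: ExPop.
  apply: ExSeq; first exact: kP.
  rewrite /= -catA.
  by apply: ExSeq; apply: ExPush.
rewrite tsizeN; lia.
Qed.

Lemma eatP t s0 s1 s2 s3 :
  exec (eat k) (Stacks (tcode t ++ s0) s1 s2 s3) ((d + 8) * tsize t + 6)
    (Stacks s0 (foldl F1 s1 (tcode t)) (foldl F2 s2 (tcode t)) s3).
Proof.
apply: exec_le.
  apply: ExSeq; first exact: ExPush.
  apply: ExSeq; first exact: ExPush.
  apply: ExSeq; last exact: (ExPop R3 (Stacks _ _ _ (false :: s3))).
  by apply: eat_loopP; apply: ExWhileF.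
by lia.
Qed.

End Eat.

Definition mark1 (u : seq bool) (b : bool) : seq bool := [:: true, b & u].

(* Every bit of [l] is put below a bit 1, and the bit 0 closes the word. *)
Definition mark (l u : seq bool) : seq bool := foldl mark1 (false :: u) l.

(** Moving a tree to another stack reverses its bits, and the reversed code no longer delimits
    itself; the marks do so instead. *)
Definition stash (r : reg) : cmd :=
  Push r false ;; eat (fun b => Push r b ;; Push r true).

Definition unstash (r : reg) : cmd :=
  While r is_bit1
    (Pop r ;; If r is_bit1 (Push R0 true) (Push R0 false) ;; Pop r) ;; Pop r.

Lemma foldl_id (A B : Type) (x : A) (l : seq B) : foldl (fun u _ => u) x l = x.
Proof. by elim: l. Qed.

Lemma stash1P t s0 s1 s2 s3 :
  exec (stash R1) (Stacks (tcode t ++ s0) s1 s2 s3) (12 * tsize t + 8)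
    (Stacks s0 (mark (tcode t) s1) s2 s3).
Proof.
have := @eatP (fun b => Push R1 b ;; Push R1 true) mark1 (fun u _ => u) 4 _ t s0 (false :: s1) s2 s3.
rewrite foldl_id => H; apply: exec_le.
  apply: ExSeq; first exact: ExPush.
  apply: H => b u0 u1 u2 u3.
  by apply: (ExSeq (t := 2) (u := 2)); apply: ExPush.
lia.
Qed.

Lemma stash2P t s0 s1 s2 s3 :
  exec (stash R2) (Stacks (tcode t ++ s0) s1 s2 s3) (12 * tsize t + 8)
    (Stacks s0 s1 (mark (tcode t) s2) s3).
Proof.
have := @eatP (fun b => Push R2 b ;; Push R2 true) (fun u _ => u) mark1 4 _ t s0 s1 (false :: s2) s3.
rewrite foldl_id => H; apply: exec_le.
  apply: ExSeq; first exact: ExPush.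
  apply: H => b u0 u1 u2 u3.
  by apply: (ExSeq (t := 2) (u := 2)); apply: ExPush.
lia.
Qed.

Lemma mark_rcons l b u : mark (rcons l b) u = [:: true, b & mark l u].
Proof. by rewrite /mark -cats1 foldl_cat. Qed.

Lemma unstash1P l s0 s1 s2 s3 :
  exec (unstash R1) (Stacks s0 (mark l s1) s2 s3) (6 * size l + 2)
    (Stacks (l ++ s0) s1 s2 s3).
Proof.
have H : exec (While R1 is_bit1
    (Pop R1 ;; If R1 is_bit1 (Push R0 true) (Push R0 false) ;; Pop R1))
    (Stacks s0 (mark l s1) s2 s3) (6 * size l + 1) (Stacks (l ++ s0) (false :: s1) s2 s3).
  elim/last_ind: l s0 => [|l b IH] s0.
    by apply: exec_le; first exact: ExWhileF.
  rewrite mark_rcons cat_rcons size_rcons; apply: exec_le.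
    apply: ExWhileT (IH (b :: s0)) => //.
    apply: ExSeq; first exact: ExPop.
    apply: ExSeq; last exact: (ExPop R1 (Stacks _ (b :: mark l s1) _ _)).
    by apply: ExIf; case: b; apply: ExPush.
  lia.
by apply: exec_le; [apply: ExSeq H (ExPop _ _) | lia].
Qed.

Lemma unstash2P l s0 s1 s2 s3 :
  exec (unstash R2) (Stacks s0 s1 (mark l s2) s3) (6 * size l + 2)
    (Stacks (l ++ s0) s1 s2 s3).
Proof.
have H : exec (While R2 is_bit1
    (Pop R2 ;; If R2 is_bit1 (Push R0 true) (Push R0 false) ;; Pop R2))
    (Stacks s0 s1 (mark l s2) s3) (6 * size l + 1) (Stacks (l ++ s0) s1 (false :: s2) s3).
  elim/last_ind: l s0 => [|l b IH] s0.
    by apply: exec_le; first exact: ExWhileF.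
  rewrite mark_rcons cat_rcons size_rcons; apply: exec_le.
    apply: ExWhileT (IH (b :: s0)) => //.
    apply: ExSeq; first exact: ExPop.
    apply: ExSeq; last exact: (ExPop R2 (Stacks _ _ (b :: mark l s2) _)).
    by apply: ExIf; case: b; apply: ExPush.
  lia.
by apply: exec_le; [apply: ExSeq H (ExPop _ _) | lia].
Qed.

Definition drop_top : cmd := eat (fun=> Skip).

Definition dup_top : cmd :=
  Push R1 false ;; Push R2 false ;;
  eat (fun b => Push R1 b ;; Push R1 true ;; Push R2 b ;; Push R2 true) ;;
  unstash R1 ;; unstash R2.

Definition swap_top : cmd := stash R1 ;; stash R2 ;; unstash R1 ;; unstash R2.

Lemma drop_topP t s0 s1 s2 s3 :
  exec drop_top (Stacks (tcode t ++ s0) s1 s2 s3) (9 * tsize t + 6)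
    (Stacks s0 s1 s2 s3).
Proof.
have := @eatP (fun=> Skip) (fun u _ => u) (fun u _ => u) 1 _ t s0 s1 s2 s3.
by rewrite !foldl_id; apply=> *; apply: ExSkip.
Qed.

Lemma dup_topP t s0 s1 s2 s3 :
  exec dup_top (Stacks (tcode t ++ s0) s1 s2 s3) (28 * tsize t + 14)
    (Stacks (tcode t ++ tcode t ++ s0) s1 s2 s3).
Proof.
apply: exec_le.
  apply: ExSeq; first exact: ExPush.
  apply: ExSeq; first exact: ExPush.
  apply: ExSeq.
    apply: (@eatP _ mark1 mark1 8) => b u0 u1 u2 u3.
    apply: (ExSeq (t := 2) (u := 6)); first exact: ExPush.
    apply: (ExSeq (t := 2) (u := 4)); first exact: ExPush.
    by apply: (ExSeq (t := 2) (u := 2)); apply: ExPush.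
  apply: ExSeq; first exact: unstash1P.
  exact: unstash2P.
rewrite /tsize; lia.
Qed.

Lemma swap_topP t u s0 s1 s2 s3 :
  exec swap_top (Stacks (tcode t ++ tcode u ++ s0) s1 s2 s3)
    (18 * (tsize t + tsize u) + 20) (Stacks (tcode u ++ tcode t ++ s0) s1 s2 s3).
Proof.
apply: exec_le.
  apply: ExSeq; first exact: stash1P.
  apply: ExSeq; first exact: stash2P.
  apply: ExSeq; first exact: unstash1P.
  exact: unstash2P.
rewrite /tsize; lia.
Qed.

(** * Encodable types and closure properties of polynomial-time functions *)

Class Enc (A : Type) := tr : A -> tree.

Definition esize (A : Type) (e : Enc A) (a : A) : nat := tsize (tr a).
Arguments esize {A e} a.

Instance Enc_unit : Enc unit := fun _ => Leaf.
Instance Enc_bool : Enc bool := fun b => if b then Node Leaf Leaf else Leaf.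
Instance Enc_prod (A B : Type) (eA : Enc A) (eB : Enc B) : Enc (A * B) :=
  fun p => Node (tr p.1) (tr p.2).
Instance Enc_seq (A : Type) (eA : Enc A) : Enc (seq A) :=
  fix trs l := if l is a :: l' then Node (tr a) (trs l') else Leaf.
(** Unary: elements of [nat] serve as lengths and indices, while the large numbers of the problem
    are words of bits. *)
Instance Enc_nat : Enc nat := fun n => tr (nseq n tt).

Lemma tr_pair A B (eA : Enc A) (eB : Enc B) (a : A) (b : B) :
  tr (a, b) = Node (tr a) (tr b).
Proof. by []. Qed.
Lemma tr_cons A (eA : Enc A) (a : A) (l : seq A) : tr (a :: l) = Node (tr a) (tr l).
Proof. by []. Qed.
Lemma tsize_gt0 t : 0 < tsize t. Proof. by case: t. Qed.
Lemma esize_gt0 A (e : Enc A) (a : A) : 0 < esize a. Proof. exact: tsize_gt0. Qed.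
Lemma esize_pair A B (eA : Enc A) (eB : Enc B) (a : A) (b : B) :
  esize (a, b) = (esize a + esize b).+1.
Proof. exact: tsizeN. Qed.
Lemma esize_cons A (eA : Enc A) (a : A) (l : seq A) :
  esize (a :: l) = (esize a + esize l).+1.
Proof. exact: tsizeN. Qed.
Lemma esize_nil A (eA : Enc A) : esize (Nil A) = 1. Proof. by []. Qed.
Lemma esize_bool (b : bool) : esize b <= 3. Proof. by case: b. Qed.

(** Whatever lies below the argument, and the other three stacks, are left intact; this lets such
    programs be nested. *)
Definition computes A B (eA : Enc A) (eB : Enc B) (c : cmd) (p : nat -> nat)
    (f : A -> B) : Prop :=
  forall a s0 s1 s2 s3,
    exec c (Stacks (tcode (tr a) ++ s0) s1 s2 s3) (p (esize a))
      (Stacks (tcode (tr (f a)) ++ s0) s1 s2 s3).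

Definition poly A B (eA : Enc A) (eB : Enc B) (f : A -> B) : Prop :=
  exists c p, is_poly p /\ computes eA eB c p f.
Arguments poly {A B eA eB} f.

Section Closure.
Context {X A B : Type} {eX : Enc X} {eA : Enc A} {eB : Enc B}.

Lemma poly_size (f : X -> A) :
  poly f -> exists p, is_poly p /\ forall x, esize (f x) <= p (esize x).
Proof.
move=> [c [p [hp h]]]; exists (fun n => n + p n); split.
  exact: IsPolyAdd IsPolyId hp.
move=> x; have /exec_size := h x [::] [::] [::] [::].
by rewrite /= !cats0 !addn0.
Qed.

Lemma poly_id : poly (fun x : X => x).
Proof.
exists Skip, (fun=> 1); split; first exact: IsPolyConst.
by move=> *; apply: ExSkip.
Qed.

End Closure.

Section Closure.
Context {X A B : Type} {eX : Enc X} {eA : Enc A} {eB : Enc B}.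

Lemma poly_ext (f g : X -> A) : f =1 g -> poly f -> poly g.
Proof.
move=> e [c [p [hp h]]]; exists c, p; split=> // x s0 s1 s2 s3.
by rewrite -e.
Qed.

Lemma poly_comp (g : A -> B) (f : X -> A) :
  poly g -> poly f -> poly (fun x => g (f x)).
Proof.
move=> [cg [pg [hpg hg]]] hf; have [q [hq sz]] := poly_size hf.
case: hf => [cf [pf [hpf hf]]].
exists (cf ;; cg), (fun n => pf n + pg (q n)); split.
  by apply: IsPolyAdd => //; apply: is_poly_comp.
move=> x s0 s1 s2 s3; apply: ExSeq; first exact: hf.
by apply: exec_le (hg _ _ _ _ _) _; apply: is_poly_mono hpg _ _ _.
Qed.

(* The encodings of the two types may coincide without the types being equal. *)
Lemma poly_cast (f : X -> A) : (forall x, tr (f x) = tr x) -> poly f.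
Proof.
move=> e; exists Skip, (fun=> 1); split; first exact: IsPolyConst.
by move=> *; rewrite e; apply: ExSkip.
Qed.

Lemma push_word (w : seq bool) : exists c, forall s0 s1 s2 s3,
  exec c (Stacks s0 s1 s2 s3) (2 * size w + 1) (Stacks (w ++ s0) s1 s2 s3).
Proof.
elim: w => [|b w [c h]]; first by exists Skip => *; apply: ExSkip.
exists (c ;; Push R0 b) => s0 s1 s2 s3.
apply: exec_le; first by apply: ExSeq (h _ _ _ _) (ExPush _ _ _).
rewrite /=; lia.
Qed.

End Closure.

Section Closure.
Context {X A B : Type} {eX : Enc X} {eA : Enc A} {eB : Enc B}.

Lemma poly_const (a : A) : poly (fun _ : X => a).
Proof.
have [c h] := push_word (tcode (tr a)).
exists (drop_top ;; c), (fun n => (9 * n + 6) + (2 * tsize (tr a) + 1)).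
split.
  by apply: IsPolyAdd; [apply: is_poly_lin | apply: IsPolyConst].
move=> x s0 s1 s2 s3; apply: ExSeq; [exact: drop_topP | exact: h].
Qed.

End Closure.

Section Closure.
Context {X A B : Type} {eX : Enc X} {eA : Enc A} {eB : Enc B}.

Lemma poly_pair (f : X -> A) (g : X -> B) :
  poly f -> poly g -> poly (fun x => (f x, g x)).
Proof.
move=> [cf [pf [hpf hf]]] hg; have [q [hq sz]] := poly_size hg.
case: hg => [cg [pg [hpg hg]]].
exists (dup_top ;; cg ;; swap_top ;; cf ;; Push R0 true),
  (fun n => (28 * n + 14) + (pg n + ((18 * n + (18 * q n + 20)) + (pf n + 2)))).
split; first by is_poly_tac.
move=> x s0 s1 s2 s3.
apply: ExSeq; first exact: dup_topP.
apply: ExSeq; first exact: hg.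
apply: ExSeq.
  apply: exec_le; first exact: swap_topP.
  move: (sz x); rewrite /esize; lia.
apply: ExSeq; first exact: hf.
by rewrite tr_pair /= -catA; apply: ExPush.
Qed.

Lemma poly_fst0 : poly (fun p : A * B => p.1).
Proof.
exists (Pop R0 ;; swap_top ;; drop_top), (fun n => 1 + ((18 * n + 20) + (9 * n + 6))).
split; first by is_poly_tac.
move=> [a b] s0 s1 s2 s3; rewrite /esize tr_pair tsizeN /= -catA.
apply: ExSeq; first exact: ExPop.
apply: ExSeq; first by apply: exec_le; [exact: swap_topP|lia].
by apply: exec_le; [exact: drop_topP | lia].
Qed.

Lemma poly_snd0 : poly (fun p : A * B => p.2).
Proof.
exists (Pop R0 ;; drop_top), (fun n => 1 + (9 * n + 6)).
split; first by is_poly_tac.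
move=> [a b] s0 s1 s2 s3; rewrite /esize tr_pair tsizeN /= -catA.
apply: ExSeq; first exact: ExPop.
by apply: exec_le; [exact: drop_topP | lia].
Qed.

Lemma poly_if (b : X -> bool) (f g : X -> A) :
  poly b -> poly f -> poly g -> poly (fun x => if b x then f x else g x).
Proof.
move=> [cb [pb [hpb hb]]] [cf [pf [hpf hf]]] [cg [pg [hpg hg]]].
(* The code of [true] has three bits and that of [false] one; hence the numbers of pops. *)
exists (dup_top ;; cb ;; If R0 is_bit1 (Pop R0 ;; Pop R0 ;; Pop R0 ;; cf) (Pop R0 ;; cg)),
  (fun n => (28 * n + 14) + (pb n + ((pf n + pg n) + 4))).
split; first by is_poly_tac.
move=> x s0 s1 s2 s3.
apply: ExSeq; first exact: dup_topP.
apply: ExSeq; first exact: hb.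
apply: exec_le (ExIf (t := (pf (esize x) + pg (esize x)) + 3) _) _; last by lia.
rewrite /top /=; case: (b x) => /=.
  apply: exec_le.
    do 3! [apply: ExSeq; first exact: ExPop].
    exact: hf.
  lia.
apply: exec_le.
  apply: ExSeq; first exact: ExPop.
  exact: hg.
lia.
Qed.

(** The code of [a :: s] is that of the pair [(a, s)], so one pushed bit turns [x] and the list
    below it into the argument [(x, (a, s))] of the second branch. *)
Lemma poly_case (l : X -> seq A) (f : X -> B) (g : X -> A -> seq A -> B) :
  poly l -> poly f -> poly (fun y => g y.1 y.2.1 y.2.2) ->
  poly (fun x => if l x is a :: s then g x a s else f x).
Proof.
move=> hl; have [q [hq sz]] := poly_size hl.
case: hl => [cl [pl [hpl hl]]] [cf [pf [hpf hf]]] [cg [pg [hpg hg]]].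
exists (dup_top ;; cl ;; If R0 is_bit1 (swap_top ;; Push R0 true ;; cg) (Pop R0 ;; cf)),
  (fun n => (28 * n + 14) + (pl n + ((pf n + ((18 * n + (18 * q n + 20)) + pg (n + q n + 1)))+ 4))).
split; first by is_poly_tac.
move=> x s0 s1 s2 s3.
apply: ExSeq; first exact: dup_topP.
apply: ExSeq; first exact: hl.
have := sz x; set n := esize x; set m := q n => le_lm.
apply: exec_le (ExIf (t := pf n + ((18 * n + (18 * m + 20)) + pg (n + m + 1))+3) _) _; last by lia.
rewrite /top /=; case e: (l x) => [|a s] /=.
  apply: exec_le.
    apply: ExSeq; first exact: ExPop.
    exact: hf.
  by rewrite -/n; lia.
rewrite e in le_lm.
have hg' := hg (x, (a, s)) s0 s1 s2 s3.
rewrite esize_pair -/n esize_pair -(esize_cons eA a s) in hg'.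
apply: exec_le.
  apply: ExSeq; first exact: (swap_topP (tr (a :: s)) (tr x)).
  apply: ExSeq; first exact: ExPush.
  have := catA (tcode (tr x)) (tcode (tr (a :: s))) s0 => ecat.
  by move: ecat; set u := tcode (tr (a :: s)) => ecat; rewrite /set /get ecat; exact: hg'.
have : pg (n + esize (a :: s)).+1 <= pg (n + m + 1).
  by apply: is_poly_mono hpg _ _ _; lia.
have -> : tsize (tr x) = n by [].
have -> : tsize (tr (a :: s)) = esize (a :: s) by [].
lia.
Qed.

End Closure.

Section Closure.
Context {X A B : Type} {eX : Enc X} {eA : Enc A} {eB : Enc B}.

Lemma poly_cons (f : X -> A) (g : X -> seq A) :
  poly f -> poly g -> poly (fun x => f x :: g x).
Proof.
move=> hf hg; have [c [p [hp h]]] := poly_pair hf hg.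
by exists c, p.
Qed.

End Closure.

Lemma size_le_esize A (eA : Enc A) (l : seq A) : size l < esize l.
Proof. by elim: l => // a l IH; rewrite esize_cons /=; lia. Qed.

(** The list lies above the accumulator. In each round its tail waits on [R1] while the step
    function runs on the pair of its first element and the accumulator. *)
Definition fold_loop (ch : cmd) : cmd :=
  While R0 is_bit1
    (Pop R0 ;; swap_top ;; stash R1 ;; Push R0 true ;; ch ;; unstash R1).

Lemma fold_loopP B S (eB : Enc B) (eS : Enc S) (h : B * S -> S) ch ph :
  is_poly ph -> computes (Enc_prod eB eS) eS ch ph h ->
  forall L M (l : seq B) acc s0 s1 s2 s3, esize l <= L ->
  (forall i, esize (foldl (fun s b => h (b, s)) acc (take i l)) <= M) ->
  exec (fold_loop ch) (Stacks (tcode (tr l) ++ tcode (tr acc) ++ s0) s1 s2 s3)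
    (size l * (36 * L + 40 + ph (L + M)) + 1)
    (Stacks (false :: tcode (tr (foldl (fun s b => h (b, s)) acc l)) ++ s0) s1 s2 s3).
Proof.
move=> hph hh L M; elim=> [|b l IH] acc s0 s1 s2 s3 le_L le_M.
  by rewrite mul0n add0n; apply: ExWhileF.
have le_acc := le_M 0; have sz := le_L; rewrite esize_cons in sz.
have {}IH := IH (h (b, acc)) s0 s1 s2 s3 _ (fun i => le_M i.+1).
have hh' := hh (b, acc) s0 (mark (tcode (tr l)) s1) s2 s3.
rewrite esize_pair in hh'.
rewrite /= in le_acc.
have le_ph : ph (esize b + esize acc).+1 <= ph (L + M).
  by apply: is_poly_mono hph _ _ _; have := esize_gt0 eB b; have := esize_gt0 _ l; lia.
apply: exec_le.
  apply: ExWhileT; [by [] | | apply: IH; lia].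
  apply: ExSeq; first exact: ExPop.
  rewrite tr_cons /= -catA.
  apply: ExSeq; first exact: swap_topP.
  rewrite catA -catA.
  apply: ExSeq; first exact: stash1P.
  apply: ExSeq; first exact: ExPush.
  apply: ExSeq; last exact: unstash1P.
  by move: hh'; rewrite tr_pair /= -catA; apply.
rewrite -/(esize b) -/(esize l) -/(tsize (tr l)) -/(esize l) /=; lia.
Qed.

Section Foldl.
Context {X B S : Type} {eX : Enc X} {eB : Enc B} {eS : Enc S}.

(** Iterating a polynomial-time step need not be polynomial, since the accumulator may double each
    time; hence the bound on all intermediate values. The step also depends on [x], which is
    therefore carried along in the accumulator. *)
Lemma poly_foldl (g : X -> S -> B -> S) (s0 : X -> S) (l : X -> seq B) r :
  poly l -> poly s0 -> poly (fun y => g y.1 y.2.1 y.2.2) -> is_poly r ->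
  (forall x i, esize (foldl (g x) (s0 x) (take i (l x))) <= r (esize x)) ->
  poly (fun x => foldl (g x) (s0 x) (l x)).
Proof.
move=> hl hs hg hr le_r.
pose h (y : B * (X * S)) := (y.2.1, g y.2.1 y.2.2 y.1).
have hh : poly h.
  have h1 : poly (fun y : B * (X * S) => y.2). exact: poly_snd0.
  have h2 : poly (fun y : B * (X * S) => y.2.1). exact: (poly_comp poly_fst0 h1).
  have h3 : poly (fun y : B * (X * S) => y.2.2). exact: (poly_comp poly_snd0 h1).
  apply: (poly_pair h2).
  have h4 : poly (fun y : B * (X * S) => (y.2.1, (y.2.2, y.1))).
    by apply: (poly_pair h2); apply: (poly_pair h3); apply: poly_fst0.
  exact: poly_comp hg h4.
have hfold x s : foldl (fun u b => h (b, u)) (x, s) (l x) = (x, foldl (g x) s (l x)).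
  by elim: (l x) s => //= b l' IH s; rewrite -IH.
have hfoldt i x s : foldl (fun u b => h (b, u)) (x, s) (take i (l x)) =
    (x, foldl (g x) s (take i (l x))).
  by elim: (take i (l x)) s => //= b l' IH s; rewrite -IH.
have [ql [hql szl]] := poly_size hl.
have hinit : poly (fun x => (l x, (x, s0 x))).
  by apply: poly_pair hl _; apply: poly_pair hs; apply: poly_id.
have [ci [pi [hpi hi]]] := hinit.
have [ch [ph [hph hh']]] := hh.
apply: (poly_comp (g := fun p : X * S => p.2)
  (f := fun x => (x, foldl (g x) (s0 x) (l x))) poly_snd0).
exists (ci ;; Pop R0 ;; fold_loop ch ;; Pop R0),
  (fun n => pi n + (1 + ((ql n * (36 * ql n + 40 + ph (ql n + (n + r n + 1))) + 1) + 1))).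
split; first by is_poly_tac.
move=> x u0 u1 u2 u3.
apply: ExSeq; first exact: hi.
rewrite tr_pair /= -catA.
apply: ExSeq; first exact: ExPop.
set n := esize x.
apply: ExSeq.
  2: exact: (ExPop R0 (Stacks (false :: tcode (tr (x, foldl (g x) (s0 x) (l x))) ++ u0) u1 u2 u3)).
rewrite -hfold.
have le_M i : esize (foldl (fun u b => h (b, u)) (x, s0 x) (take i (l x))) <= n + r n + 1.
  by rewrite hfoldt esize_pair; have := le_r x i; rewrite -/n; lia.
apply: (exec_le (fold_loopP hph hh' u0 u1 u2 u3 (szl x) le_M)).
rewrite leq_add2r leq_mul2r; apply/orP; right.
by apply: leq_trans (szl x); apply: ltnW; apply: size_le_esize.
Qed.

(* [mu] is a size measure that grows by a bounded amount at each step. *)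
Lemma poly_foldl_measure (mu : S -> nat) (r q : nat -> nat)
    (g : X -> S -> B -> S) (s0 : X -> S) (l : X -> seq B) :
  poly l -> poly s0 -> poly (fun y => g y.1 y.2.1 y.2.2) -> is_poly r -> is_poly q ->
  (forall s, mu s <= esize s) ->
  (forall s, esize s <= r (mu s)) ->
  (forall x s b, mu (g x s b) <= mu s + q (esize x + esize b)) ->
  poly (fun x => foldl (g x) (s0 x) (l x)).
Proof.
move=> hl hs hg hr hq mu_le le_mu step.
have [ql [hql szl]] := poly_size hl; have [qs [hqs szs]] := poly_size hs.
have := @poly_foldl g s0 l (fun n => r (qs n + ql n * q (n + ql n))) hl hs hg.
apply; first by is_poly_tac.
move=> x i; apply: leq_trans (le_mu _) _; apply: is_poly_mono hr _ _ _.
have : forall t s, esize t <= ql (esize x) -> mu (foldl (g x) s t) <=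
    mu s + size t * q (esize x + ql (esize x)).
  elim=> [|b t IH] s; first by rewrite addn0.
  rewrite esize_cons => le_t /=; apply: leq_trans (IH _ _) _; first by lia.
  rewrite mulSn addnA leq_add2r; apply: leq_trans (step _ _ _) _.
  by rewrite leq_add2l; apply: is_poly_mono hq _ _ _; lia.
have le_take : esize (take i (l x)) <= esize (l x).
  elim: (l x) i => [|b t IH] [|i] //=; rewrite ?take0 ?esize_cons ?esize_nil; try lia.
  by have := IH i; lia.
move=> /(_ (take i (l x)) (s0 x) (leq_trans le_take (szl x))).
move=> /leq_trans; apply; apply: leq_add.
  exact: leq_trans (mu_le _) (szs _).
rewrite leq_mul2r; apply/orP; right; apply: leq_trans (szl x).
by apply: leq_trans (ltnW (size_le_esize _ _)) le_take.
Qed.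

End Foldl.

Definition poly2 A B C {eA : Enc A} {eB : Enc B} {eC : Enc C} (g : A -> B -> C) :=
  poly (fun p : A * B => g p.1 p.2).

Definition poly3 A B C D {eA : Enc A} {eB : Enc B} {eC : Enc C} {eD : Enc D}
  (g : A -> B -> C -> D) := poly (fun p : A * (B * C) => g p.1 p.2.1 p.2.2).

Section Application.
Context {X A B C D : Type}
  {eX : Enc X} {eA : Enc A} {eB : Enc B} {eC : Enc C} {eD : Enc D}.

Lemma poly_fst (f : X -> A * B) : poly f -> poly (fun x => (f x).1).
Proof. exact: (poly_comp poly_fst0). Qed.

Lemma poly_snd (f : X -> A * B) : poly f -> poly (fun x => (f x).2).
Proof. exact: (poly_comp poly_snd0). Qed.

Lemma poly_comp2 (g : A -> B -> C) (f : X -> A) (h : X -> B) :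
  poly2 g -> poly f -> poly h -> poly (fun x => g (f x) (h x)).
Proof. by move=> hg hf hh; apply: (poly_comp hg (poly_pair hf hh)). Qed.

Lemma poly_comp3 (g : A -> B -> C -> D) (f : X -> A) (h : X -> B) (k : X -> C) :
  poly3 g -> poly f -> poly h -> poly k -> poly (fun x => g (f x) (h x) (k x)).
Proof.
by move=> hg hf hh hk; apply: (poly_comp hg (poly_pair hf (poly_pair hh hk))).
Qed.

End Application.

Create HintDb polydb.
Ltac poly_solve := solve [simple eapply poly_id | assumption | eauto with polydb nocore].

(** A hook, redefined when the combinators on lists are available. *)
Ltac poly_higher := fail.

Ltac poly_step := cbv beta; match goal with
  | |- @poly _ _ _ _ (fun x => x) => exact poly_id
  | |- @poly _ _ _ _ (@fst _ _) => exact poly_fst0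
  | |- @poly _ _ _ _ (@snd _ _) => exact poly_snd0
  | |- @poly _ _ _ _ (fun _ => ?c) => exact (poly_const c)
  | |- @poly _ _ _ _ (fun x => (@?f x, @?g x)) => refine (@poly_pair _ _ _ _ _ _ f g _ _)
  | |- @poly _ _ _ _ (fun x => fst (@?f x)) => refine (@poly_fst _ _ _ _ _ _ f _)
  | |- @poly _ _ _ _ (fun x => snd (@?f x)) => refine (@poly_snd _ _ _ _ _ _ f _)
  | |- @poly _ _ _ _ (fun x => cons (@?f x) (@?g x)) => refine (@poly_cons _ _ _ _ f g _ _)
  | |- @poly _ _ _ _ (fun x => if _ then _ else _) =>
      refine (poly_if _ _ _)
  | |- _ => poly_higher
  | |- @poly _ _ _ _ (fun x => ?g (@?f x) (@?h x) (@?k x)) =>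
      refine (@poly_comp3 _ _ _ _ _ _ _ _ _ _ g f h k _ _ _ _); [poly_solve | | |]
  | |- @poly _ _ _ _ (fun x => ?g (@?f x) (@?h x)) =>
      refine (@poly_comp2 _ _ _ _ _ _ _ _ g f h _ _ _); [poly_solve | |]
  | |- @poly _ _ _ _ (fun x => ?g (@?f x)) =>
      refine (@poly_comp _ _ _ _ _ _ g f _ _); [poly_solve |]
  | |- _ => poly_solve
  end.

Ltac poly_tac := try unfold poly2; try unfold poly3; repeat poly_step.

Ltac poly_from e := refine (poly_ext e _).

(** * Booleans, lists and unary numbers *)

Lemma poly_negb : poly negb.
Proof.
refine (poly_ext (f := fun b : bool => if b then false else true) _ _); first by case.
poly_tac.
Qed.
Lemma poly_andb : poly2 andb.
Proof.
refine (poly_ext (f := fun p : bool * bool => if p.1 then p.2 else false) _ _); first by case=> [[] []].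
poly_tac.
Qed.
Lemma poly_orb : poly2 orb.
Proof.
refine (poly_ext (f := fun p : bool * bool => if p.1 then true else p.2) _ _); first by case=> [[] []].
poly_tac.
Qed.
Lemma poly_addb : poly2 addb.
Proof.
refine (poly_ext (f := fun p : bool * bool => if p.1 then (if p.2 then false else true) else p.2) _ _); first by case=> [[] []].
poly_tac.
Qed.
Lemma poly_implb : poly2 implb.
Proof.
refine (poly_ext (f := fun p : bool * bool => if p.1 then p.2 else true) _ _); first by case=> [[] []].
poly_tac.
Qed.
Lemma poly_eqbool : poly2 (@eq_op bool).
Proof.
refine (poly_ext (f := fun p : bool * bool => if p.1 then p.2 else (if p.2 then false else true)) _ _); first by case=> [[] []].
poly_tac.
Qed.

#[export] Hint Resolve poly_negb poly_andb poly_orb poly_addb poly_implb poly_eqbool : polydb.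

Section Lists.
Context {X A B : Type} {eX : Enc X} {eA : Enc A} {eB : Enc B}.

Lemma poly_behead : poly (@behead A).
Proof.
refine (poly_ext (f := fun l : seq A => if l is a :: s then s else [::]) _ _).
  by case.
apply: (@poly_case _ _ _ _ _ _ (fun l => l) (fun=> [::]) (fun _ _ s => s)); poly_tac.
Qed.

Lemma poly_head (d : A) : poly (head d).
Proof.
refine (poly_ext (f := fun l : seq A => if l is a :: s then a else d) _ _).
  by case.
apply: (@poly_case _ _ _ _ _ _ (fun l => l) (fun=> d) (fun _ a _ => a)); poly_tac.
Qed.

Lemma poly_nilp : poly (@nilp A).
Proof.
refine (poly_ext (f := fun l : seq A => if l is a :: s then false else true) _ _).
  by case.
apply: (@poly_case _ _ _ _ _ _ (fun l => l) (fun=> true) (fun _ _ _ => false)); poly_tac.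
Qed.

Lemma esize_cat (s t : seq A) : esize (s ++ t) < esize s + esize t.
Proof. by elim: s => [|a s IH] /=; rewrite ?esize_nil ?esize_cons; lia. Qed.

Lemma poly_catrev : poly2 (@catrev A).
Proof.
refine (poly_ext (f := fun p => foldl (fun s a => a :: s) p.2 p.1) _ _).
  move=> [s t] /=; elim: s t => //= a s IH t; exact: IH.
apply: (@poly_foldl_measure _ _ _ _ _ _ esize id (fun n => n.+1) (fun _ s a => a :: s)
  (fun p => p.2) (fun p => p.1)); try poly_tac; try is_poly_tac; try by [].
by move=> x s b; rewrite esize_cons; lia.
Qed.

Lemma poly_rev : poly (@rev A).
Proof.
refine (poly_ext (f := fun p => catrev p [::]) _ _) => //.
by apply: (poly_comp2 poly_catrev); poly_tac.
Qed.

Lemma poly_cat : poly2 (@cat A).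
Proof.
refine (poly_ext (f := fun p => catrev (rev p.1) p.2) _ _).
  by move=> [s t]; rewrite catrevE revK.
apply: (poly_comp2 poly_catrev); last by poly_tac.
by apply: (poly_comp poly_rev); poly_tac.
Qed.

Lemma poly_foldl_bool (g : X -> bool -> A -> bool) (b : X -> bool) (l : X -> seq A) :
  poly (fun y => g y.1 y.2.1 y.2.2) -> poly b -> poly l ->
  poly (fun x => foldl (g x) (b x) (l x)).
Proof.
move=> hg hb hl.
apply: (@poly_foldl _ _ _ _ _ _ g b l (fun=> 3)) => //; first exact: IsPolyConst.
by move=> x i; apply: esize_bool.
Qed.

Lemma poly_all (p : X -> A -> bool) (l : X -> seq A) :
  poly (fun y => p y.1 y.2) -> poly l -> poly (fun x => all (p x) (l x)).
Proof.
move=> hp hl; refine (poly_ext (f := fun x => foldl (fun s a => s && p x a) true (l x)) _ _).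
  move=> x; rewrite -[RHS]/(true && _); elim: (l x) true => [|a s IH] b /=.
    by rewrite andbT.
  by rewrite IH andbA.
apply: (@poly_foldl_bool (fun x s a => s && p x a) (fun=> true) l); poly_tac.
Qed.

End Lists.

#[export] Hint Resolve poly_behead poly_head poly_nilp poly_rev poly_cat poly_catrev : polydb.

Section MoreLists.
Context {X A B : Type} {eX : Enc X} {eA : Enc A} {eB : Enc B}.

Lemma poly_has (p : X -> A -> bool) (l : X -> seq A) :
  poly (fun y => p y.1 y.2) -> poly l -> poly (fun x => has (p x) (l x)).
Proof.
move=> hp hl.
refine (poly_ext (f := fun x => ~~ all (fun a => ~~ p x a) (l x)) _ _).
  move=> x; rewrite -has_predC; apply: eq_has => a /=; exact: negbK.
apply: (poly_comp poly_negb).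
by apply: (@poly_all _ _ _ _ (fun x a => ~~ p x a) l) => //; poly_tac.
Qed.

Lemma poly_map (g : X -> A -> B) (l : X -> seq A) :
  poly (fun y => g y.1 y.2) -> poly l -> poly (fun x => map (g x) (l x)).
Proof.
move=> hg hl.
refine (poly_ext (f := fun x => rev (foldl (fun s a => g x a :: s) [::] (l x))) _ _).
  move=> x; have H t : foldl (fun s a => g x a :: s) t (l x) = catrev (map (g x) (l x)) t.
    by elim: (l x) t => //= a s IH t; rewrite IH.
  by rewrite H -/(rev _) revK.
apply: (poly_comp poly_rev).
have [q [hq szq]] := poly_size hg.
apply: (@poly_foldl_measure _ _ _ _ _ _ esize id (fun n => (q n.+1).+1)
  (fun x s a => g x a :: s) (fun=> [::]) l); try is_poly_tac => //; try by poly_tac.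
by move=> x s b; rewrite esize_cons; have := szq (x, b); rewrite esize_pair /=; lia.
Qed.

Lemma poly_flatten : poly (@flatten A).
Proof.
refine (poly_ext (f := foldl (@cat A) [::]) _ _).
  move=> l; rewrite -[RHS]/([::] ++ _); elim: l [::] => [|a l IH] t /=.
    by rewrite cats0.
  by rewrite IH catA.
apply: (@poly_foldl_measure _ _ _ _ _ _ esize id id (fun _ => @cat A) (fun=> [::]) id);
  try poly_tac => //; try is_poly_tac; try by [].
move=> x s b; exact: leq_trans (ltnW (esize_cat s b)) (leq_add _ (leq_addl _ _)).
Qed.

End MoreLists.

#[export] Hint Resolve poly_flatten : polydb.

Ltac poly_higher ::= match goal with
  | |- @poly _ _ _ _ (fun x => all (@?p x) (@?l x)) =>
      refine (@poly_all _ _ _ _ p l _ _)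
  | |- @poly _ _ _ _ (fun x => has (@?p x) (@?l x)) =>
      refine (@poly_has _ _ _ _ p l _ _)
  | |- @poly _ _ _ _ (fun x => map (@?g x) (@?l x)) =>
      refine (@poly_map _ _ _ _ _ _ g l _ _)
  end.

Section Filter.
Context {X A B : Type} {eX : Enc X} {eA : Enc A} {eB : Enc B}.

Lemma poly_filter (p : X -> A -> bool) (l : X -> seq A) :
  poly (fun y => p y.1 y.2) -> poly l -> poly (fun x => filter (p x) (l x)).
Proof.
move=> hp hl.
refine (poly_ext (f := fun x => flatten (map (fun a => if p x a then [:: a] else [::]) (l x))) _ _).
  by move=> x; elim: (l x) => //= a s ->; case: (p x a).
poly_tac => //.
Qed.

Definition unary (n : nat) : seq unit := nseq n tt.

Lemma size_unary n : size (unary n) = n. Proof. exact: size_nseq. Qed.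

Lemma poly_unary : poly unary.
Proof. exact: poly_cast. Qed.

Lemma esize_nat (n : nat) : esize n = n.*2.+1.
Proof.
have -> : esize n = esize (nseq n tt) by [].
by elim: n => //= n IH; rewrite esize_cons IH.
Qed.

Lemma poly_succ : poly S.
Proof.
pose f (n : nat) := (tt, n).
have hf : poly f by rewrite /f; poly_tac.
have [c [p [hp h]]] := hf.
by exists c, p.
Qed.

Lemma poly_size_seq : poly (@size A).
Proof.
refine (poly_ext (f := foldl (fun n _ => n.+1) 0) _ _).
  move=> l; rewrite -[RHS]addn0; elim: l 0 => //= a l IH n.
  by rewrite IH addnS.
apply: (@poly_foldl_measure _ _ _ _ _ _ id (fun n => 2 * n + 1) (fun=> 1)
  (fun _ n _ => n.+1) (fun=> 0) id); try poly_tac => //; try is_poly_tac; try by [].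
- by apply: (poly_comp poly_succ (f := fun y => y.2.1)); poly_tac.
- by move=> s; rewrite esize_nat; lia.
- by move=> s; rewrite esize_nat; lia.
- by move=> x s b /=; lia.
Qed.

End Filter.

#[export] Hint Resolve poly_size_seq poly_succ poly_unary : polydb.

Ltac poly_higher ::= match goal with
  | |- @poly _ _ _ _ (fun x => all (@?p x) (@?l x)) =>
      refine (@poly_all _ _ _ _ p l _ _)
  | |- @poly _ _ _ _ (fun x => has (@?p x) (@?l x)) =>
      refine (@poly_has _ _ _ _ p l _ _)
  | |- @poly _ _ _ _ (fun x => map (@?g x) (@?l x)) =>
      refine (@poly_map _ _ _ _ _ _ g l _ _)
  | |- @poly _ _ _ _ (fun x => filter (@?g x) (@?l x)) =>
      refine (@poly_filter _ _ _ _ g l _ _)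
  end.

Lemma poly_predn : poly predn.
Proof.
refine (poly_ext (f := fun n => size (behead (unary n))) _ _).
  by case=> //= n; rewrite size_unary.
poly_tac.
Qed.
#[export] Hint Resolve poly_predn : polydb.

Lemma foldl_nseq T (f : T -> T) n x : foldl (fun s (_ : unit) => f s) x (unary n) = iter n f x.
Proof. by elim: n x => //= n IH x; rewrite IH -iterSr. Qed.

Lemma poly_addn : poly2 addn.
Proof.
refine (poly_ext (f := fun p => size (unary p.1 ++ unary p.2)) _ _).
  by case=> m n; rewrite size_cat !size_unary.
poly_tac.
Qed.
#[export] Hint Resolve poly_addn : polydb.

Lemma poly_muln : poly2 muln.
Proof.
refine (poly_ext (f := fun p => size (flatten (map (fun _ => unary p.2) (unary p.1)))) _ _).
  by case=> m n; rewrite /=; elim: m => //= m IH; rewrite size_cat IH size_unary mulSn.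
poly_tac.
Qed.
#[export] Hint Resolve poly_muln : polydb.

Lemma poly_drop A (eA : Enc A) : poly2 (@drop A).
Proof.
refine (poly_ext (f := fun p => foldl (fun s _ => behead s) p.2 (unary p.1)) _ _).
  case=> n l /=; elim: n l => [|n IH] [|a l] //=; rewrite IH ?drop0 //.
apply: (@poly_foldl_measure _ _ _ _ _ _ esize id (fun=> 0)
  (fun _ s _ => behead s) (fun p => p.2) (fun p => unary p.1));
  try poly_tac; try is_poly_tac; try by [].
by move=> x [|a s] b; rewrite ?esize_cons /=; lia.
Qed.
#[export] Hint Resolve poly_drop : polydb.

Lemma poly_leq : poly2 leq.
Proof.
refine (poly_ext (f := fun p => nilp (drop p.2 (unary p.1))) _ _).
  by case=> m n; rewrite /nilp size_drop size_unary.
poly_tac.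
Qed.
#[export] Hint Resolve poly_leq : polydb.

Lemma poly_eqnat : poly2 (@eq_op nat).
Proof.
refine (poly_ext (f := fun p => (p.1 <= p.2) && (p.2 <= p.1)) _ _).
  by case=> m n; rewrite eqn_leq.
poly_tac.
Qed.

Lemma poly_iota : poly (iota 0).
Proof.
have iotaS n : iota 0 n.+1 = rcons (iota 0 n) n.
  by rewrite -addn1 iotaD cats1.
(* The next number to list is the length of the list built so far, so the fold needs no separate
   counter. *)
pose F n : seq nat := foldl (fun (s : seq nat) (_ : unit) => size s :: s) [::] (unary n).
have eF n : F n = rev (iota 0 n).
  rewrite /F (foldl_nseq (fun s : seq nat => size s :: s)); elim: n => // n IH.
  by rewrite iterS IH iotaS rev_rcons size_rev size_iota.
refine (poly_ext (f := fun n => rev (F n)) _ _).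
  by move=> n; rewrite eF revK.
apply: (poly_comp poly_rev).
apply: (@poly_foldl _ _ _ _ _ _ (fun _ (s : seq nat) (_ : unit) => size s :: s) (fun=> [::])
  unary (fun n => n * (2 * n + 2) + 1)); try poly_tac; try is_poly_tac; try by [].
move=> n i; have -> : take i (unary n) = unary (minn i n).
  by elim: i n => [|i IH] [|n] //=; rewrite /unary /= -/(unary n) IH minnSS.
rewrite -/(F _) eF.
have H m : esize (rev (iota 0 m)) <= m * (2 * m + 2) + 1.
  elim: m => // m IH; rewrite iotaS rev_rcons esize_cons esize_nat; lia.
apply: leq_trans (H _) _; rewrite esize_nat.
have : minn i n <= n.*2.+1 by lia.
by move: (minn i n) => k le_k; rewrite leq_add2r leq_mul // leq_add2r leq_mul2l.
Qed.

Lemma poly_zip A B (eA : Enc A) (eB : Enc B) : poly2 (@zip A B).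
Proof.
pose G (st : seq (A * B) * seq B) (a : A) :=
  if st.2 is b :: t then ((a, b) :: st.1, t) else (st.1, [::]).
refine (poly_ext (f := fun p => rev (foldl G ([::], p.2) p.1).1) _ _).
  move=> [s t] /=; rewrite -[RHS]/([::] ++ _) -{2}[[::]]/(rev [::]).
  elim: s t [::] => [|a s IH] [|b t] u /=; rewrite ?cats0 ?IH ?rev_cons ?cat_rcons //=.
  by case: s {IH} => /=; rewrite cats0.
apply: (poly_comp poly_rev); apply: poly_fst.
apply: (@poly_foldl_measure _ _ _ _ _ _ esize id (fun n => n.+1)
  (fun _ => G) (fun p => ([::], p.2)) (fun p => p.1)); try poly_tac; try is_poly_tac; try by [].
  apply: (@poly_case _ _ _ _ _ _ (fun y : seq A * seq B * (seq (A * B) * seq B * A) => y.2.1.2)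
    (fun y => (y.2.1.1, [::])) (fun y b t => ((y.2.2, b) :: y.2.1.1, t))); poly_tac.
by move=> x [u [|b t]] a; rewrite /G /= !esize_pair ?esize_cons ?esize_pair ?esize_nil; lia.
Qed.
#[export] Hint Resolve poly_eqnat poly_iota poly_zip : polydb.

Lemma poly_eqseq (A : eqType) (eA : Enc A) :
  poly2 (@eq_op A) -> poly2 (@eq_op (seq A)).
Proof.
move=> h.
refine (poly_ext (f := fun p : seq A * seq A => (size p.1 == size p.2) &&
  all (fun ab => ab.1 == ab.2) (zip p.1 p.2)) _ _).
  case=> s t /=; rewrite eqseq_all; elim: s t => [|a s IH] [|b t] //=.
  by rewrite eqSS andbCA IH.
poly_tac.
Qed.
#[export] Hint Resolve poly_eqseq : polydb.

Lemma poly_mem (A : eqType) (eA : Enc A) :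
  poly2 (@eq_op A) -> poly2 (fun (a : A) (s : seq A) => a \in s).
Proof.
move=> h.
refine (poly_ext (f := fun p : A * seq A => has (fun b => b == p.1) p.2) _ _).
  by move=> [a s]; rewrite -has_pred1; apply: eq_has => b.
poly_tac.
Qed.

Lemma poly_undup (A : eqType) (eA : Enc A) :
  poly2 (@eq_op A) -> poly (@undup A).
Proof.
move=> h.
refine (poly_ext (f := fun l : seq A => foldl (fun s a => if has (fun b => b == a) s then s else a :: s) [::] (rev l)) _ _).
  move=> l; rewrite foldl_rev; elim: l => //= a l ->.
  by rewrite -[a \in l]mem_undup -has_pred1.
apply: (@poly_foldl_measure _ _ _ _ _ _ esize id (fun n => n.+1)
  (fun _ (s : seq A) a => if has (fun b => b == a) s then s else a :: s) (fun=> [::]) (@rev A));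
  try poly_tac; try is_poly_tac; try by [].
by move=> x s b; case: ifP; rewrite ?esize_cons; lia.
Qed.

#[export] Hint Resolve poly_mem poly_undup : polydb.

(** * Conversion between words on the tapes and tree codes *)

Definition lift_word (r r' : reg) : cmd :=
  Push r' false ;; While r isSome
    (If r is_bit1 (Pop r ;; Push r' true) (Pop r ;; Push r' false) ;; Push r' true).

Lemma lift_word02 x u s1 s3 :
  exec (lift_word R0 R2) (Stacks x s1 u s3) (7 * size x + 3)
    (Stacks [::] s1 (mark x u) s3).
Proof.
apply: (@exec_le _ _ (2 + (7 * size x + 1))); last by lia.
apply: ExSeq; first exact: ExPush.
rewrite /= /mark; elim: x (false :: u) => [|b x IH] v; first exact: ExWhileF.
apply: (@exec_le _ _ (6 + (7 * size x + 1)).+1); last by rewrite /=; lia.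
apply: ExWhileT (IH _) => //.
apply: (@ExSeq _ _ _ 4 _ 2); last exact: (ExPush R2 true (Stacks x s1 (b :: v) s3)).
by apply: ExIf; case: b; apply: (@ExSeq _ _ _ 1 _ 2); (apply: ExPop || apply: ExPush).
Qed.

Lemma lift_word13 x u s0 s2 :
  exec (lift_word R1 R3) (Stacks s0 x s2 u) (7 * size x + 3)
    (Stacks s0 [::] s2 (mark x u)).
Proof.
apply: (@exec_le _ _ (2 + (7 * size x + 1))); last by lia.
apply: ExSeq; first exact: ExPush.
rewrite /= /mark; elim: x (false :: u) => [|b x IH] v; first exact: ExWhileF.
apply: (@exec_le _ _ (6 + (7 * size x + 1)).+1); last by rewrite /=; lia.
apply: ExWhileT (IH _) => //.
apply: (@ExSeq _ _ _ 4 _ 2); last exact: (ExPush R3 true (Stacks s0 x s2 (b :: v))).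
by apply: ExIf; case: b; apply: (@ExSeq _ _ _ 1 _ 2); (apply: ExPop || apply: ExPush).
Qed.

(** A marked word gives back its last bit first, which is the order in which a list is built from
    its end. The three pushes of the first branch are, together, the code of the bit 1; the last
    push opens the node of the list. *)
Definition build_word (r : reg) : cmd :=
  Push R0 false ;; While r is_bit1
    (Pop r ;; If r is_bit1
       (Pop r ;; Push R0 false ;; Push R0 false ;; Push R0 true)
       (Pop r ;; Push R0 false) ;; Push R0 true) ;; Pop r.

Lemma build_word2 (l : seq bool) s0 s1 s2 s3 :
  exec (build_word R2) (Stacks s0 s1 (mark l s2) s3) (12 * size l + 4)
    (Stacks (tcode (tr l) ++ s0) s1 s2 s3).
Proof.
apply: (@exec_le _ _ (2 + ((12 * size l + 1) + 1))); last by lia.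
apply: ExSeq; first exact: ExPush.
apply: ExSeq; last exact: (ExPop R2 (Stacks _ s1 (false :: s2) s3)).
enough (H : forall t, exec (While R2 is_bit1
    (Pop R2 ;; If R2 is_bit1
       (Pop R2 ;; Push R0 false ;; Push R0 false ;; Push R0 true)
       (Pop R2 ;; Push R0 false) ;; Push R0 true))
    (Stacks (tcode (tr t) ++ s0) s1 (mark l s2) s3) (12 * size l + 1)
    (Stacks (tcode (tr (l ++ t)) ++ s0) s1 (false :: s2) s3)).
  by have := H [::]; rewrite cats0.
elim/last_ind: l => [|l b IH] t; first exact: ExWhileF.
rewrite mark_rcons cat_rcons size_rcons.
apply: (@exec_le _ _ (11 + (12 * size l + 1)).+1); last by lia.
apply: ExWhileT (IH (b :: t)) => //.
apply: (@ExSeq _ _ _ 1 _ 10); first exact: ExPop.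
apply: (@ExSeq _ _ _ 8 _ 2); last first.
  exact: (ExPush R0 true (Stacks ((tcode (tr b) ++ tcode (tr t)) ++ s0) s1 (mark l s2) s3)).
apply: ExIf; case: b => /=.
  apply: (@ExSeq _ _ _ 1 _ 6); first exact: ExPop.
  apply: (@ExSeq _ _ _ 2 _ 4); first exact: ExPush.
  by apply: (@ExSeq _ _ _ 2 _ 2); apply: ExPush.
apply: (@exec_le _ _ 3) => //.
by apply: (@ExSeq _ _ _ 1 _ 2); [apply: ExPop | apply: ExPush].
Qed.

Lemma build_word3 (l : seq bool) s0 s1 s2 s3 :
  exec (build_word R3) (Stacks s0 s1 s2 (mark l s3)) (12 * size l + 4)
    (Stacks (tcode (tr l) ++ s0) s1 s2 s3).
Proof.
apply: (@exec_le _ _ (2 + ((12 * size l + 1) + 1))); last by lia.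
apply: ExSeq; first exact: ExPush.
apply: ExSeq; last exact: (ExPop R3 (Stacks _ s1 s2 (false :: s3))).
enough (H : forall t, exec (While R3 is_bit1
    (Pop R3 ;; If R3 is_bit1
       (Pop R3 ;; Push R0 false ;; Push R0 false ;; Push R0 true)
       (Pop R3 ;; Push R0 false) ;; Push R0 true))
    (Stacks (tcode (tr t) ++ s0) s1 s2 (mark l s3)) (12 * size l + 1)
    (Stacks (tcode (tr (l ++ t)) ++ s0) s1 s2 (false :: s3))).
  by have := H [::]; rewrite cats0.
elim/last_ind: l => [|l b IH] t; first exact: ExWhileF.
rewrite mark_rcons cat_rcons size_rcons.
apply: (@exec_le _ _ (11 + (12 * size l + 1)).+1); last by lia.
apply: ExWhileT (IH (b :: t)) => //.
apply: (@ExSeq _ _ _ 1 _ 10); first exact: ExPop.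
apply: (@ExSeq _ _ _ 8 _ 2); last first.
  exact: (ExPush R0 true (Stacks ((tcode (tr b) ++ tcode (tr t)) ++ s0) s1 s2 (mark l s3))).
apply: ExIf; case: b => /=.
  apply: (@ExSeq _ _ _ 1 _ 6); first exact: ExPop.
  apply: (@ExSeq _ _ _ 2 _ 4); first exact: ExPush.
  by apply: (@ExSeq _ _ _ 2 _ 2); apply: ExPush.
apply: (@exec_le _ _ 3) => //.
by apply: (@ExSeq _ _ _ 1 _ 2); [apply: ExPop | apply: ExPush].
Qed.

Definition load : cmd :=
  lift_word R0 R2 ;; lift_word R1 R3 ;; build_word R3 ;; build_word R2 ;; Push R0 true.

Lemma loadP (x w : seq bool) :
  exec load (Stacks x w [::] [::]) (19 * (size x + size w) + 20)
    (Stacks (tcode (tr (x, w)) ++ [::]) [::] [::] [::]).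
Proof.
apply: exec_le.
  apply: ExSeq; first exact: lift_word02.
  apply: ExSeq; first exact: lift_word13.
  apply: ExSeq; first exact: build_word3.
  apply: ExSeq; first exact: build_word2.
  rewrite tr_pair /= -catA; exact: ExPush.
lia.
Qed.

Definition unload : cmd :=
  Push R1 false ;; While R0 is_bit1
    (Pop R0 ;; If R0 is_bit1
       (Pop R0 ;; Pop R0 ;; Pop R0 ;; Push R1 true) (Pop R0 ;; Push R1 false) ;;
     Push R1 true) ;; Pop R0 ;; unstash R1.

Lemma unloadP (l : seq bool) :
  exec unload (Stacks (tcode (tr l) ++ [::]) [::] [::] [::]) (16 * size l + 6)
    (Stacks (l ++ [::]) [::] [::] [::]).
Proof.
apply: (@exec_le _ _ (2 + ((10 * size l + 1) + (1 + (6 * size l + 2))))); last by lia.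
apply: ExSeq; first exact: ExPush.
apply: ExSeq; last first.
  apply: ExSeq; last exact: (unstash1P l [::] [::] [::] [::]).
  exact: (ExPop R0 (Stacks [:: false] (mark l [::]) [::] [::])).
rewrite /= /mark; elim: l {1 3}[:: false] => [|b l IH] v; first exact: ExWhileF.
apply: (@exec_le _ _ (9 + (10 * size l + 1)).+1); last by rewrite /=; lia.
apply: ExWhileT (IH _) => //.
apply: (@ExSeq _ _ _ 1 _ 8); first exact: ExPop.
apply: (@ExSeq _ _ _ 6 _ 2); last first.
  exact: (ExPush R1 true (Stacks (tcode (tr l) ++ [::]) (b :: v) [::] [::])).
apply: ExIf; case: b => /=.
  do 3! [apply: (@ExSeq _ _ _ 1); first exact: ExPop].
  exact: ExPush.
apply: (@exec_le _ _ 3) => //.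
by apply: (@ExSeq _ _ _ 1 _ 2); [apply: ExPop | apply: ExPush].
Qed.

Lemma esize_word (l : seq bool) : esize l <= 4 * size l + 1.
Proof.
by elim: l => // b l IH; rewrite esize_cons /=; have := esize_bool b; lia.
Qed.

Lemma size_le_tcode (x : seq bool) : size x <= tsize (tr x).
Proof. exact: ltnW (size_le_esize _ x). Qed.

Lemma leading_bits_cells (l : seq bool) k :
  leading_bits (map bit_cell l ++ nseq k None) = l.
Proof. by elim: l => [|b l IH] /=; [case: k | rewrite IH]. Qed.

Lemma poly_computable (f : seq bool -> seq bool) : poly f -> poly_time_computable f.
Proof.
move=> hf.
(* [load] always builds a pair; here its second component is the empty word of the blank tape 1. *)
have hg : poly (fun p : seq bool * seq bool => f p.1) by exact: (poly_comp hf poly_fst0).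
have [q [hq szq]] := poly_size hg.
have [c [p [hp h]]] := hg.
pose b n := 4 * n + 3.
pose t n := (19 * n + 20) + (p (b n) + (16 * q (b n) + 6)) + 1.
have ht : is_poly t by rewrite /t /b; is_poly_tac.
have [c' [k le_t]] := is_poly_bound ht.
exists (machine_TM (compile (load ;; c ;; unload))), c', k => x final.
have sz : esize (x, Nil bool) <= b (size x).
  by rewrite esize_pair esize_nil /b; have := esize_word x; lia.
have ex : exec (load ;; c ;; unload) (Stacks x [::] [::] [::])
    ((19 * size x + 20) + (p (b (size x)) + (16 * q (b (size x)) + 6)))
    (Stacks (f x ++ [::]) [::] [::] [::]).
  apply: ExSeq; first by apply: exec_le; [exact: loadP | rewrite addn0].
  apply: ExSeq; first by apply: exec_le; [exact: h | apply: is_poly_mono hp _ _ sz].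
  apply: exec_le; first exact: (unloadP (f x)).
  rewrite leq_add2r leq_mul2l; apply: leq_trans (size_le_tcode _) _.
  apply: leq_trans (szq (x, [::])) _; exact: is_poly_mono hq _ _ sz.
have lt : (19 * size x + 20) + (p (b (size x)) + (16 * q (b (size x)) + 6)) <
    poly_bound c' k (size x) by apply: leq_trans (le_t _); rewrite /t; lia.
have [v [m [h1 _ [ev e]]]] := exec_run ex lt (ws := [:: x]) erefl erefl isT.
split; first exact: h1.
by rewrite /output ev e /= cats0 leading_bits_cells.
Qed.

Lemma poly_decidable (g : seq bool -> seq bool -> bool) :
  poly2 g -> poly_time_decidable2 (fun x w => g x w).
Proof.
move=> hg; have [c [p [hp h]]] := hg.
pose b n := 4 * n + 3.
pose t n := (19 * n + 20) + p (b n) + 1.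
have ht : is_poly t by rewrite /t /b; is_poly_tac.
have [c' [k le_t]] := is_poly_bound ht.
exists (machine_TM (compile (load ;; c))), c', k => x w final.
set n := size x + size w.
have sz : esize (x, w) <= b n.
  by rewrite esize_pair /b /n; have := esize_word x; have := esize_word w; lia.
have ex : exec (load ;; c) (Stacks x w [::] [::]) ((19 * n + 20) + p (b n))
    (Stacks (tcode (tr (g x w)) ++ [::]) [::] [::] [::]).
  apply: ExSeq; first exact: loadP.
  by apply: exec_le; [exact: h | apply: is_poly_mono hp _ _ sz].
have lt : (19 * n + 20) + p (b n) < poly_bound c' k n.
  by apply: leq_trans (le_t _); rewrite /t; lia.
have [v [m [h1 h2 _]]] := exec_run ex lt (ws := [:: x; w]) erefl erefl isT.
split; first exact: h1.
by rewrite /final h2 /top /=; case: (g x w).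
Qed.

(** * Binary arithmetic *)

Notation bits := (seq bool).

Fixpoint bval (s : bits) : nat := if s is b :: t then b + (bval t).*2 else 0.

(** The most significant bit comes last; the default makes the empty word, which denotes 0,
    canonical. *)
Definition canon (s : bits) : bool := last true s.

Lemma bval_cat s t : bval (s ++ t) = bval s + 2 ^ size s * bval t.
Proof. by elim: s => [|b s IH] /=; rewrite ?mul1n // IH expnS; lia. Qed.

Lemma bval_lt s : bval s < 2 ^ size s.
Proof. by elim: s => //= b s; rewrite expnS; case: b; lia. Qed.

Lemma bval_zeros n : bval (nseq n false) = 0.
Proof. by elim: n => //= n ->. Qed.

Lemma binaryK : cancel binary bval.
Proof.
have H n L : bval (mkseq (fun i => odd (n %/ 2 ^ i)) L) = n %% 2 ^ L.
  elim: L n => [|L IH] n; first by rewrite modn1.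
  rewrite /mkseq /= -[1]addn0 iotaDl -map_comp.
  have -> : [seq odd (n %/ 2 ^ (1 + i)) | i <- iota 0 L] =
      mkseq (fun i => odd (n./2 %/ 2 ^ i)) L.
    by apply: eq_map => i; rewrite expnS divnMA divn2.
  rewrite IH divn1 expnS; have e := odd_double_half n.
  move: (2 ^ L) (expn_gt0 2 L) => P /= P0.
  have d := divn_eq n./2 P; have lt := ltn_pmod n./2 P0.
  have en : n = n./2 %/ P * (2 * P) + (odd n + 2 * (n./2 %% P)) by lia.
  rewrite [in RHS]en modnMDl; move: (n./2 %% P) lt {d en} => r lt.
  by rewrite modn_small; case: (odd n) => /=; lia.
move=> n; rewrite /binary H modn_small //.
exact: leq_trans (up_logP n.+1 (isT : 1 < 2)).
Qed.

Lemma canon_binary n : canon (binary n).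
Proof.
case: n => // n; rewrite /binary.
have /andP[lo hi] := up_log_bounds (isT : 1 < 2) (isT : 1 < n.+2).
case: (up_log 2 n.+2) lo hi => [//|L] lo hi.
rewrite /canon -nth_last size_mkseq nth_mkseq //.
rewrite /= in lo *; have -> : n.+1 %/ 2 ^ L = 1 => //.
apply/eqP; rewrite eqn_leq -ltnS ltn_divLR ?expn_gt0 // -expnS hi.
by rewrite leq_divRL ?expn_gt0 // mul1n -ltnS.
Qed.

Lemma canon_inj s t : canon s -> canon t -> bval s = bval t -> s = t.
Proof.
have canonS b u : canon (b :: u) -> canon u by case: u.
have canon0 u : canon u -> 0 = bval u -> u = [::].
  elim: u => //= b u IH cu e; have {}IH := IH (canonS _ _ cu).
  case: b e cu => /= e cu; first by lia.
  by rewrite IH in cu; last lia.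
elim: s t => [|a s IH] [|b t] cs ct e //; first by rewrite (canon0 _ ct e).
  by rewrite (canon0 _ cs (esym e)).
have eab : a = b by move: e => /=; case: a b {cs ct} => [] []; lia.
rewrite eab (IH t (canonS _ _ cs) (canonS _ _ ct)) //.
by move: e => /=; rewrite eab; lia.
Qed.

Lemma bvalK s : canon s -> binary (bval s) = s.
Proof. by move=> cs; apply: canon_inj cs _; rewrite ?canon_binary ?binaryK. Qed.

Lemma leq_size_binary m n : m <= n -> size (binary m) <= size (binary n).
Proof. by move=> le; rewrite !size_mkseq leq_up_log. Qed.

Lemma size_binary_exp n k : n < 2 ^ k -> size (binary n) <= k.
Proof. by move=> lt; rewrite size_mkseq up_log_min. Qed.

Definition zeros (s : bits) : bits := map (fun=> false) s.

Lemma bval_zeros_map s : bval (zeros s) = 0.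
Proof. by elim: s => //= _ s ->. Qed.

(** The state consists of the carry, the bits of the second summand still to be read, and the digits
    of the sum found so far, in reverse. *)
Definition add_step (st : (bool * bits) * bits) (a : bool) : (bool * bits) * bits :=
  ((if a then st.1.1 || head false st.1.2 else st.1.1 && head false st.1.2,
    behead st.1.2), (a (+) head false st.1.2) (+) st.1.1 :: st.2).

(** The padding [zeros b] lets the fold outlast [b]. Leading zeros are not removed, so results are
    to be compared by [beq]. *)
Definition badd (a b : bits) : bits :=
  (fun st : (bool * bits) * bits => rev st.2 ++ [:: st.1.1])
    (foldl add_step ((false, b), [::]) (a ++ zeros b)).

Lemma bval_badd a b : bval (badd a b) = bval a + bval b.
Proof.
have H l c rest acc : size rest <= size l ->
    bval ((fun st : (bool * bits) * bits => rev st.2 ++ [:: st.1.1])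
      (foldl add_step ((c, rest), acc) l)) =
    bval (rev acc) + 2 ^ size acc * (c + bval rest + bval l).
  elim: l c rest acc => [|x l IH] c rest acc.
    rewrite leqn0 size_eq0 => /eqP -> /=.
    by rewrite bval_cat size_rev /=; lia.
  move=> sz; rewrite [foldl _ _ _]/= IH; last by rewrite size_behead -ltnS; case: (rest) sz.
  rewrite /= rev_cons -cats1 bval_cat size_rev expnS /=.
  case: rest sz => [|y rest] _ /=; case: x; case: c; try case: y; rewrite /=; lia.
rewrite /badd H ?size_cat ?size_map ?leq_addl //=.
by rewrite bval_cat bval_zeros_map; lia.
Qed.

(** The accumulator grows by an amount that depends only on the other summand, as
    [poly_foldl_measure] requires for [bmul] and [bsum]. *)
Lemma size_badd a b : size (badd a b) = (size a + size b).+1.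
Proof.
have H l st : size (foldl add_step st l).2 = size st.2 + size l.
  by elim: l st => [|x l IH] st /=; rewrite ?addn0 // IH addnS.
by rewrite /badd size_cat size_rev H /= size_cat size_map addn1.
Qed.

Definition bmul (a b : bits) : bits :=
  foldl (fun acc (x : bool) => if x then badd (false :: acc) b else false :: acc) [::] (rev a).

Lemma bval_bmul a b : bval (bmul a b) = bval a * bval b.
Proof.
rewrite /bmul foldl_rev; elim: a => //= x a IH.
by case: x; rewrite ?bval_badd /= IH; lia.
Qed.

Definition bsum (l : seq bits) : bits := foldl badd [::] l.

Lemma bval_bsum l : bval (bsum l) = \sum_(a <- l) bval a.
Proof.
rewrite /bsum -[RHS]/(bval [::] + _); elim: l [::] => [|a l IH] s /=.
  by rewrite big_nil addn0.
by rewrite IH bval_badd big_cons addnA.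
Qed.

Definition trim (s : bits) : bits :=
  foldl (fun t (b : bool) => if b then b :: t else if nilp t then t else b :: t) [::] (rev s).

Lemma trimP s : canon (trim s) /\ bval (trim s) = bval s.
Proof.
rewrite /trim foldl_rev; elim: s => //= b s [].
set t := foldr _ _ _ => ct et; rewrite -et.
by case: b => //=; case: t ct {et} => //= [[]].
Qed.

Definition beq (a b : bits) : bool := trim a == trim b.

Lemma beqP a b : beq a b = (bval a == bval b).
Proof.
have [ca ea] := trimP a; have [cb eb] := trimP b; rewrite /beq.
apply/eqP/eqP => [e|e]; first by rewrite -ea -eb e.
by apply: canon_inj; rewrite ?ea ?eb.
Qed.

(** The words are read from the least significant bit on, so the last position where they differ
    decides. *)
Definition blt (a b : bits) : bool :=
  foldl (fun r (xy : bool * bool) => if xy.1 == xy.2 then r else xy.2) false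
    (zip (a ++ zeros b) (b ++ zeros a)).

Lemma bltP a b : blt a b = (bval a < bval b).
Proof.
have H s t r : size s = size t ->
   foldl (fun r (xy : bool * bool) => if xy.1 == xy.2 then r else xy.2) r (zip s t) =
   (bval s < bval t) || r && (bval s == bval t).
  elim: s t r => [|x s IH] [|y t] r //=; first by rewrite andbT.
  by case=> /IH ->; case: x; case: y; case: r; rewrite /= ?andbF ?orbF; lia.
rewrite /blt H ?size_cat ?size_map 1?addnC //.
by rewrite !bval_cat !bval_zeros_map !muln0 !addn0 orbF.
Qed.

Lemma poly_zeros : poly zeros.
Proof. by rewrite /zeros; poly_tac. Qed.
#[export] Hint Resolve poly_zeros : polydb.

Lemma poly_add_step : poly2 add_step.
Proof. by rewrite /add_step; poly_tac. Qed.
#[export] Hint Resolve poly_add_step : polydb.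

Lemma poly_add_fold : poly2 (fun a b : bits => foldl add_step ((false, b), [::]) (a ++ zeros b)).
Proof.
apply: (@poly_foldl_measure _ _ _ _ _ _ esize id (fun=> 9)
  (fun _ => add_step) (fun p : bits * bits => ((false, p.2), [::]))
  (fun p : bits * bits => p.1 ++ zeros p.2)); try poly_tac; try is_poly_tac; try by [].
move=> x [[c rest] acc] a; rewrite /add_step /= !esize_pair !esize_cons.
have h1 (b1 b2 : bool) : esize b1 <= esize b2 + 2 by case: b1; case: b2.
have h2 (b1 : bool) : esize b1 <= 3 by exact: esize_bool.
have h3 (r : bits) : esize (behead r) <= esize r.
  by case: r => // b r; rewrite [leqRHS]esize_cons /=; lia.
move: (h3 rest); move: (h1 (if a then c || head false rest else c && head false rest) c).
move: (h2 ((a (+) head false rest) (+) c)); lia.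
Qed.

Lemma poly_badd : poly2 badd.
Proof.
apply: (poly_comp (g := fun st : (bool * bits) * bits => rev st.2 ++ [:: st.1.1])).
  by poly_tac.
exact: poly_add_fold.
Qed.
#[export] Hint Resolve poly_badd : polydb.

Lemma esize_word_lower (s : bits) : size s <= esize s.
Proof. exact: ltnW (size_le_esize _ s). Qed.

Lemma poly_bmul : poly2 bmul.
Proof.
apply: (@poly_foldl_measure _ _ _ _ _ _ size (fun n => 4 * n + 1) (fun n => n + 2)
  (fun (p : bits * bits) acc (x : bool) => if x then badd (false :: acc) p.2 else false :: acc)
  (fun=> [::]) (fun p : bits * bits => rev p.1)); try poly_tac; try is_poly_tac.
- exact: esize_word_lower.
- exact: esize_word.
- move=> [a b] s []; rewrite ?size_badd esize_pair /=; have := esize_word_lower b; lia.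
Qed.

Lemma poly_bsum : poly bsum.
Proof.
apply: (@poly_foldl_measure _ _ _ _ _ _ size (fun n => 4 * n + 1) (fun n => n + 2)
  (fun (_ : seq bits) => badd) (fun=> [::]) id); try poly_tac; try is_poly_tac.
- exact: esize_word_lower.
- exact: esize_word.
- move=> a s b; rewrite size_badd; have := esize_word_lower b; lia.
Qed.

Lemma poly_trim : poly trim.
Proof.
apply: (@poly_foldl_measure _ _ _ _ _ _ esize id (fun n => n + 3)
  (fun (_ : bits) t (b : bool) => if b then b :: t else if nilp t then t else b :: t)
  (fun=> [::]) rev); try poly_tac; try is_poly_tac; try by [].
by move=> a s []; try case: ifP; rewrite ?esize_cons; lia.
Qed.
#[export] Hint Resolve poly_bmul poly_bsum poly_trim : polydb.

Lemma poly_beq : poly2 beq.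
Proof. by rewrite /beq; poly_tac. Qed.

Lemma poly_blt : poly2 blt.
Proof.
apply: (@poly_foldl_bool _ _ _ _
  (fun (_ : bits * bits) r (xy : bool * bool) => if xy.1 == xy.2 then r else xy.2) (fun=> false)
  (fun p : bits * bits => zip (p.1 ++ zeros p.2) (p.2 ++ zeros p.1))); poly_tac.
Qed.

Lemma poly_last_bit : poly canon.
Proof.
refine (poly_ext (f := fun s : bits => head true (rev s)) _ _).
  by move=> s; rewrite /canon; case/lastP: s => // s b; rewrite rev_rcons last_rcons.
poly_tac.
Qed.
#[export] Hint Resolve poly_beq poly_blt poly_last_bit : polydb.

(** * The verifier *)

Import Order.TTheory GRing.Theory Num.Theory.

(** The verifier does not parse its input: it encodes the data found in the certificate again and
    compares the result with the input. The functions named [raw_] are the encoders acting on words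
    of digits. *)
Definition raw_nat (b : bits) : bits := enc_seq (fun c => [:: c]) b.
Definition raw_itemset (B : seq bits) : bits := enc_seq raw_nat B.
(** The sign bit is constant because the frequencies of a consistent instance are nonnegative. *)
Definition raw_rat (q : bits * bits) : bits := (false :: raw_nat q.1) ++ raw_nat q.2.
Definition raw_instance (K : bits) (F : seq (seq bits)) (Q : seq (bits * bits)) : bits :=
  raw_nat K ++ enc_seq raw_itemset F ++ enc_seq raw_rat Q.

Lemma poly_enc_seq A (eA : Enc A) (e : A -> bits) : poly e -> poly (enc_seq e).
Proof. by move=> he; rewrite /enc_seq; poly_tac. Qed.
#[export] Hint Resolve poly_enc_seq : polydb.

Lemma poly_raw_nat : poly raw_nat.
Proof. by apply: poly_enc_seq; poly_tac. Qed.
#[export] Hint Resolve poly_raw_nat : polydb.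
Lemma poly_raw_itemset : poly raw_itemset.
Proof. by apply: poly_enc_seq; poly_tac. Qed.
Lemma poly_raw_rat : poly raw_rat.
Proof. by rewrite /raw_rat; poly_tac. Qed.
#[export] Hint Resolve poly_raw_itemset poly_raw_rat : polydb.
Lemma poly_raw_instance : poly3 raw_instance.
Proof. by rewrite /raw_instance; poly_tac. Qed.
#[export] Hint Resolve poly_raw_instance : polydb.

Lemma enc_natE n : enc_nat n = raw_nat (binary n). Proof. by []. Qed.

Definition nest (ws : seq bits) : bits := flatten (map raw_nat ws).

(** The state tells whether the next bit has been announced by a bit 1, and holds the current word,
    reversed, and the finished words. *)
Definition unnest_step (st : (bool * bits) * seq bits) (b : bool) : (bool * bits) * seq bits :=
  if st.1.1 then ((false, b :: st.1.2), st.2) else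
  if b then ((true, st.1.2), st.2) else ((false, [::]), rev st.1.2 :: st.2).

Definition unnest (s : bits) : seq bits :=
  rev (foldl unnest_step ((false, [::]), [::]) s).2.

Lemma nestK : cancel nest unnest.
Proof.
have H w u acc s : foldl unnest_step ((false, u), acc) (raw_nat w ++ s) =
    foldl unnest_step ((false, [::]), rev (catrev w u) :: acc) s.
  by elim: w u => //= b w IH u; rewrite -[RHS]IH.
move=> ws; rewrite /unnest /nest.
suff H2 acc : (foldl unnest_step ((false, [::]), acc) (flatten (map raw_nat ws))).2 = catrev ws acc.
  by rewrite H2 -/(rev ws) revK.
elim: ws acc => //= w ws IH acc.
by rewrite H IH -/(rev w) revK.
Qed.

Lemma poly_unnest : poly unnest.
Proof.
apply: (poly_comp poly_rev); apply: poly_snd.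
apply: (@poly_foldl_measure _ _ _ _ _ _ esize id (fun=> 9)
  (fun (_ : bits) => unnest_step) (fun=> ((false, [::]), [::])) id);
  try poly_tac; try is_poly_tac; try by [].
  by rewrite /unnest_step; poly_tac.
move=> x [[m cur] acc] b; rewrite /unnest_step /=.
have h2 (b1 : bool) : 1 <= esize b1 <= 3 by case: b1.
have erev (l : bits) : esize (rev l) = esize l.
  have H t : esize (catrev l t) + 1 = esize l + esize t.
    by elim: l t => [|c l IH] t /=; rewrite ?IH ?esize_cons ?esize_nil; lia.
  by have := H [::]; rewrite /rev esize_nil; lia.
move: (h2 m) (h2 b) (h2 false) (h2 true) (erev cur).
by case: m; [|case: b]; rewrite !esize_pair ?esize_cons ?esize_nil; lia.
Qed.
#[export] Hint Resolve poly_unnest : polydb.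

Lemma poly_nth A (eA : Enc A) (d : A) : poly2 (@nth A d).
Proof.
refine (poly_ext (f := fun p : seq A * nat => head d (drop p.2 p.1)) _ _).
  by case=> l k /=; rewrite -nth0 nth_drop addn0.
poly_tac.
Qed.
#[export] Hint Resolve poly_nth : polydb.

Definition word (l : seq bits) (k : nat) : bits := nth [::] l k.

Lemma poly_word : poly2 word.
Proof. exact: poly_nth. Qed.
#[export] Hint Resolve poly_word : polydb.

(** The attributes must increase because [enc_itemset] lists a set in the order of [enum]. *)
Definition check_itemset (K : bits) (B : seq bits) : bool :=
  all (fun a => canon a && blt a K) B && all (fun ab => blt ab.1 ab.2) (zip B (behead B)).

(** An itemset has exponentially many subsets; by [antimonotonic_step] it is enough to remove one
    attribute at a time. *)
Definition check_closed (F : seq (seq bits)) (B : seq bits) : bool :=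
  all (fun a => has (fun C => C == filter (fun b => b != a) B) F) B.

(* A fraction is listed with Bezout coefficients proving it to be irreducible. *)
Definition check_fraction (q : seq bits) : bool :=
  [&& canon (word q 0), canon (word q 1), ~~ nilp (word q 1)
    & beq (bmul (word q 3) (word q 1)) (badd (bmul (word q 2) (word q 0)) [:: true])].

Definition check_family (x K : bits) (F Q : seq (seq bits)) : bool :=
  [&& canon K && ~~ nilp K, all (check_itemset K) F, size (undup F) == size F,
      all (check_closed F) F, size F == size Q, all check_fraction Q
    & x == raw_instance K F (map (fun q => (word q 0, word q 1)) Q)].

(* Each point of [P] lists the numerator of its weight, whose denominator is
   [D], and then the attributes that are 1 at this point. *)
Definition check_weights (D : bits) (F Q P : seq (seq bits)) : bool :=
  [&& ~~ nilp (trim D), beq (bsum (map (head [::]) P)) D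
    & all (fun Bq => beq
        (bmul (word Bq.2 1) (bsum (map (head [::])
          (filter (fun p => all (fun a => has (fun b => b == a) (behead p)) Bq.1) P))))
        (bmul (word Bq.2 0) D)) (zip F Q)].

Definition blocks (w : bits) (k : nat) : seq (seq bits) := map unnest (unnest (word (unnest w) k)).

(** The certificate packs, in this order, the number of attributes, the common denominator of the
    weights, the itemsets, the fractions and the points. *)
Definition check (x w : bits) : bool :=
  check_family x (word (unnest w) 0) (blocks w 2) (blocks w 3) &&
  check_weights (word (unnest w) 1) (blocks w 2) (blocks w 3) (blocks w 4).

Lemma poly_blocks : poly2 blocks.
Proof. by rewrite /blocks; poly_tac. Qed.
Lemma poly_check_itemset : poly2 check_itemset.
Proof. by rewrite /check_itemset; poly_tac. Qed.
Lemma poly_check_closed : poly2 check_closed.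
Proof. by rewrite /check_closed; poly_tac. Qed.
Lemma poly_check_fraction : poly check_fraction.
Proof. by rewrite /check_fraction; poly_tac. Qed.
#[export] Hint Resolve poly_blocks poly_check_itemset poly_check_closed poly_check_fraction : polydb.
Lemma poly_check : poly2 check.
Proof. by rewrite /check /check_family /check_weights; poly_tac. Qed.

(** * Soundness of the verifier *)

Definition set_of_bits (K : nat) (B : seq bits) : {set 'I_K} :=
  [set i : 'I_K | binary i \in B].

Definition good_itemset (K : nat) (B : seq bits) : bool :=
  all (fun a => canon a && (bval a < K)) B && sorted ltn (map bval B).

Lemma check_itemsetP K B : check_itemset K B = good_itemset (bval K) B.
Proof.
rewrite /check_itemset /good_itemset; congr (_ && _).
  by apply: eq_all => a; rewrite bltP.
rewrite sorted_map; case: B => //= a B.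
by elim: B a => //= b B IH a; rewrite bltP IH.
Qed.

(** Both lists are strictly increasing and have the same members. *)
Lemma good_itemset_enum K B : good_itemset K B ->
  [seq val i | i <- enum (set_of_bits K B)] = map bval B.
Proof.
case/andP=> /allP hB sB.
have le_sub : subseq [seq val i | i <- enum (set_of_bits K B)] (iota 0 K).
  by rewrite -val_enum_ord map_subseq // (enumT (ordinal K)); apply: filter_subseq.
apply: (irr_sorted_eq ltn_trans ltnn _ sB).
  exact: subseq_sorted ltn_trans _ _ le_sub (iota_ltn_sorted 0 K).
move=> n; apply/mapP/mapP => [[i]|[a aB ->]].
  rewrite mem_enum inE => iB ->; exists (binary i) => //; by rewrite binaryK.
have /andP[ca lt] := hB a aB.
by exists (Ordinal lt) => //; rewrite mem_enum inE /= bvalK.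
Qed.

Lemma enc_itemset_raw K B : good_itemset K B ->
  enc_itemset (set_of_bits K B) = raw_itemset B.
Proof.
move=> gB; rewrite /enc_itemset good_itemset_enum // /raw_itemset /enc_seq -map_comp.
congr (flatten _ ++ _); apply/eq_in_map => a aB /=.
by case/andP: gB => /allP/(_ a aB)/andP[ca _] _; rewrite enc_natE bvalK.
Qed.

Lemma set_of_bits_inj K : {in good_itemset K &, injective (set_of_bits K)}.
Proof.
move=> B C gB gC e.
have e' : map bval B = map bval C by rewrite -(good_itemset_enum gB) -(good_itemset_enum gC) e.
have H D : good_itemset K D -> D = map binary (map bval D).
  case/andP=> /allP hD _; rewrite -map_comp -[LHS]map_id; apply/eq_in_map => a aD /=.
  by have /andP[ca _] := hD a aD; rewrite bvalK.
by rewrite (H B gB) (H C gC) e'.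
Qed.

Section Fraction.
Local Open Scope ring_scope.
Definition frac_of (q : seq bits) : rat :=
  (bval (word q 0))%:Z%:~R / (bval (word q 1))%:Z%:~R.

Lemma check_fraction_enc q : check_fraction q ->
  enc_rat (frac_of q) = raw_rat (word q 0, word q 1) /\ (0 < bval (word q 1))%N.
Proof.
rewrite /check_fraction /frac_of.
move: (word q 0) (word q 1) (word q 2) (word q 3) => n d u v.
case/and4P=> cn cd nd; rewrite beqP bval_bmul bval_badd bval_bmul /= addn0 => /eqP bez.
have d0 : (0 < bval d)%N.
  rewrite lt0n; apply/eqP => d0; have := bvalK cd; rewrite d0 => e.
  by rewrite -e in nd.
have co : coprime (bval n) (bval d).
  rewrite coprime_sym; apply/coprimeP => //.
  by exists (bval v, bval u); rewrite /= bez addnC addnK.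
split=> //; rewrite /enc_rat /raw_rat /enc_int.
rewrite coprimeq_num // coprimeq_den // gtr0_sg ?ltz_nat // mul1r.
by rewrite eqz_nat eqn0Ngt d0 /= !enc_natE !bvalK.
Qed.
End Fraction.

Lemma set_of_bits_filter K B i : good_itemset K B ->
  set_of_bits K [seq b <- B | b != binary (val i)] = set_of_bits K B :\ i.
Proof.
move=> gB; apply/setP => j; rewrite !inE mem_filter; congr (_ && _).
by rewrite (inj_eq binary_inj).
Qed.

Lemma antimonotonic_step K (F : seq {set 'I_K}) :
  (forall B i, B \in F -> i \in B -> B :\ i \in F) -> antimonotonic F.
Proof.
move=> h B C; move: {2}#|B :\: C| (leqnn #|B :\: C|) => n.
elim: n B => [|n IH] B le_n BF CB.
  have -> : C = B => //; apply/eqP; rewrite eqEsubset CB.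
  by rewrite -setD_eq0 -cards_eq0 -leqn0.
have [e|[i]] := set_0Vmem (B :\: C); first by apply: (IH B) => //; rewrite e cards0.
rewrite inE => /andP[iC iB]; apply: (IH (B :\ i)).
- have sub : (B :\ i) :\: C \subset (B :\: C) :\ i.
    by apply/subsetP => j; rewrite !inE => /andP[-> /andP[-> ->]].
  apply: leq_trans (subset_leq_card sub) _.
  by rewrite -ltnS; apply: leq_trans le_n; rewrite (cardsD1 i (B :\: C)) inE iC iB.
- exact: h.
- apply/subsetP => j jC; rewrite !inE (subsetP CB _ jC) andbT.
  by apply: contraNneq iC => <-.
Qed.

(** The bridge from words of digits to instances. It serves twice: for the data of an accepted
    certificate and for the output of the reduction. *)
Lemma raw_instanceP (K : bits) (F : seq (seq bits)) (Q : seq (bits * bits)) (rs : seq rat) :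
  canon K -> 0 < bval K -> all (good_itemset (bval K)) F -> uniq F ->
  (forall B a, B \in F -> a \in B -> [seq b <- B | b != a] \in F) ->
  size rs = size F -> map enc_rat rs = map raw_rat Q ->
  exists I : instance, [/\ enc_instance I = raw_instance K F Q, valid_instance I
    & forall R : realType, consistent R I <->
      exists q : Omega (bval K) -> R, is_distribution q /\
        forall j, j < size F ->
          frequency q (set_of_bits (bval K) (nth [::] F j)) = ratr (nth 0%R rs j)].
Proof.
move=> cK K0 gF uF clF sz eQ; pose k := bval K.
have s1 : size (map (set_of_bits k) F) == size F by rewrite size_map.
have s2 : size rs == size F by rewrite sz.
have gF' B : B \in F -> good_itemset k B by move/(allP gF).
exists (Instance (Tuple s1) (Tuple s2)); split.
- rewrite /enc_instance /= enc_natE bvalK //; congr (_ ++ (_ ++ _)).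
    rewrite /enc_seq -map_comp; congr (flatten _ ++ _); apply/eq_in_map => B BF /=.
    by rewrite enc_itemset_raw // gF'.
  rewrite /enc_seq; congr (flatten _ ++ _).
  by rewrite (map_comp (cons true) enc_rat) eQ -map_comp.
- split=> //=.
    rewrite map_inj_in_uniq // => B C BF CF; apply: set_of_bits_inj; exact: gF'.
  apply: antimonotonic_step => _ i /mapP[B BF ->] iB.
  rewrite -set_of_bits_filter ?gF' //; apply: map_f; apply: clF => //.
  by move: iB; rewrite inE.
move=> R; have tnthE (j : 'I_(size F)) : tnth (Tuple s1) j = set_of_bits k (nth [::] F j) /\
    tnth (Tuple s2) j = nth 0%R rs j.
  split; first by rewrite (tnth_nth set0) /= (nth_map [::]).
  by rewrite (tnth_nth 0%R).
split=> -[q [dq hq]]; exists q; split=> //.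
  move=> j lt; have := hq (Ordinal lt); rewrite /=.
  by have [-> ->] := tnthE (Ordinal lt).
move=> j; rewrite /= in j *; have [-> ->] := tnthE j; exact: hq.
Qed.

(** By injectivity of the encoding, no other instance can be the reason why the word belongs to the
    language. *)
Lemma CONSISTENT_enc (R : realType) (I : instance) :
  valid_instance I -> CONSISTENT R (enc_instance I) <-> consistent R I.
Proof.
move=> vI; split=> [[J [/enc_instance_inj <- _ //]]|cI].
by exists I.
Qed.

Section Sound.
Local Open Scope ring_scope.
Variables (R : realType) (k : nat) (D : nat) (P : seq (seq bits)).
Hypothesis D0 : (0 < D)%N.

Let wt (p : seq bits) : R := (bval (head [::] p))%:R / D%:R.
Let pt (p : seq bits) : Omega k := [ffun i : 'I_k => binary i \in behead p].
Let q (x : Omega k) : R := \sum_(p <- P | pt p == x) wt p.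

(** Several entries of [P] may describe the same point, whose weights then add up; exchanging the
    sums turns a sum over points into one over entries. *)
Lemma sum_listed (C : pred (Omega k)) :
  \sum_(x | C x) q x = (\sum_(p <- P | C (pt p)) bval (head [::] p))%N%:R / D%:R.
Proof.
rewrite /q (exchange_big_dep predT) //= (bigID (fun p => C (pt p))) /=.
rewrite [X in _ + X]big1 ?addr0; last first.
  move=> p nC; rewrite big_pred0 // => x; apply/negbTE/negP => /andP[Cx /eqP e].
  by rewrite e Cx in nC.
rewrite natr_sum mulr_suml; apply: eq_bigr => p Cp.
rewrite (big_pred1 (pt p)) // => x /=; rewrite eq_sym.
by case: eqP => [->|]; rewrite ?Cp ?andbF.
Qed.

Lemma listed_distribution : (\sum_(p <- P) bval (head [::] p))%N = D -> is_distribution q.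
Proof.
move=> sD; split.
  by move=> x; apply: sumr_ge0 => p _; rewrite /wt divr_ge0 ?ler0n.
by rewrite sum_listed sD divff // pnatr_eq0 -lt0n.
Qed.

Lemma listed_frequency (B : seq bits) : good_itemset k B ->
  frequency q (set_of_bits k B) =
  (\sum_(p <- P | all (mem (behead p)) B) bval (head [::] p))%N%:R / D%:R.
Proof.
move=> /andP[/allP gB _]; rewrite /frequency sum_listed; congr (_%:R / _).
apply: eq_bigl => p; apply/forall_inP/allP => [h a aB|h i].
  have /andP[ca lt] := gB a aB.
  have := h (Ordinal lt); rewrite inE ffunE /= bvalK //; exact.
by rewrite inE ffunE => /h.
Qed.
End Sound.

Lemma check_sound (R : realType) x w : check x w -> CONSISTENT R x.
Proof.
rewrite /check; move: (word _ 0) (word _ 1) (blocks w 2) (blocks w 3) (blocks w 4).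
move=> K D F Q P /andP[].
case/and5P=> /andP[cK nK] gF uF clF /andP[/eqP sz /andP[fQ /eqP ->]].
case/and3P=> nD; rewrite beqP bval_bsum big_map => /eqP sD /allP wts.
have D0 : 0 < bval D.
  have [ct <-] := trimP D; rewrite lt0n; apply/eqP => e; move: (bvalK ct).
  by rewrite e => e'; rewrite -e' in nD.
have K0 : 0 < bval K.
  by rewrite lt0n; apply/eqP => e; move: (bvalK cK); rewrite e => e'; rewrite -e' in nK.
have gF' : all (good_itemset (bval K)) F.
  by rewrite -(eq_all (check_itemsetP K)).
have uF' : uniq F by move: uF; apply: contraTT; rewrite -ltn_size_undup ltn_neqAle => /andP[].
have clF' B a : B \in F -> a \in B -> [seq b <- B | b != a] \in F.
  by move=> /(allP clF)/allP h /h /hasP[C CF /eqP <-].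
have szr : size (map frac_of Q) = size F by rewrite size_map.
have eQ : map enc_rat (map frac_of Q) = map raw_rat (map (fun q => (word q 0, word q 1)) Q).
  by rewrite -!map_comp; apply/eq_in_map => q /(allP fQ)/check_fraction_enc[].
have [I [<- vI cI]] := raw_instanceP cK K0 gF' uF' clF' szr eQ.
apply/(CONSISTENT_enc _ vI)/cI.
pose q := fun x : Omega (bval K) => (\sum_(p <- P | [ffun i : 'I_(bval K) => binary i \in behead p] == x)
   (bval (head [::] p))%:R / (bval D)%:R : R)%R.
exists q; split; first exact: listed_distribution.
move=> j lt; rewrite (nth_map [::]) -?sz //.
rewrite listed_frequency //; last by apply: (allP gF'); apply: mem_nth.
have inz : (nth [::] F j, nth [::] Q j) \in zip F Q.
  by rewrite -nth_zip //; apply: mem_nth; rewrite size_zip -sz minnn.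
have := wts _ inz; rewrite [(_, _).1]/(nth [::] F j) [(_, _).2]/(nth [::] Q j) beqP !bval_bmul bval_bsum big_map big_filter.
set S := (\sum_(_ <- _ | _) _) => /eqP e.
have -> : (\sum_(p <- P | all (mem (behead p)) (nth [::] F j)) bval (head [::] p)) = S.
  by apply: eq_bigl => p; apply: eq_all => a; exact: (esym (has_pred1 a (behead p))).
have [|_ d0] := @check_fraction_enc (nth [::] Q j).
  by apply: (allP fQ); apply: mem_nth; rewrite -sz.
rewrite /frac_of; move: (word (nth [::] Q j) 0) (word (nth [::] Q j) 1) e d0 => n d e d0.
rewrite fmorph_div /= !ratr_int -!pmulrn.
apply/eqP; rewrite eqr_div ?pnatr_eq0 -?lt0n //.
by rewrite -!natrM mulnC e.
Qed.

(** * Small basic solutions *)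

Section Basic.
Local Open Scope ring_scope.

(** As long as the vectors are linearly dependent, a multiple of a dependence can be subtracted
    until a first coefficient vanishes, and the corresponding vector is dropped. *)
Lemma caratheodory (R : realFieldType) (T : Type) n (a : T -> 'rV[R]_n) (b : 'rV[R]_n) m
    (s : 'I_m -> T) (y : 'I_m -> R) :
  (forall i, 0 <= y i) -> \sum_i y i *: a (s i) = b ->
  exists m' (s' : 'I_m' -> T) (y' : 'I_m' -> R),
    [/\ forall i, 0 <= y' i, \sum_i y' i *: a (s' i) = b
      & row_free (\matrix_i a (s' i))].
Proof.
elim: m s y => [|m IH] s y y0 yb.
  exists 0, s, y; split=> //; rewrite /row_free eqn_leq rank_leq_row; by case: (\rank _).
case fr : (row_free (\matrix_i a (s i))); first by exists m.+1, s, y.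
(* A dependence may be negated, so one of its coefficients can be assumed positive. *)
have [u [ub [j uj]]] : exists u : 'rV[R]_m.+1,
    \sum_i u 0 i *: a (s i) = 0 /\ exists j, 0 < u 0 j.
  have /rowV0Pn[u /sub_kermxP uB /rV0Pn[j uj]] : kermx (\matrix_i a (s i)) != 0.
    by rewrite kermx_eq0 fr.
  have ub : \sum_i u 0 i *: a (s i) = 0.
    by rewrite -[RHS]uB mulmx_sum_row; apply: eq_bigr => i _; rewrite rowK.
  case: (ltrgt0P (u 0 j)) uj => // uj _; first by exists u; split=> //; exists j.
  exists (- u); split; last by exists j; rewrite mxE oppr_gt0.
  by under eq_bigr do rewrite mxE scaleNr; rewrite sumrN ub oppr0.
(* The ratio test of the simplex method: the least quotient over the positive [u 0 i] is the largest
   step that keeps all coefficients nonnegative. *)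
have [k uk kmin] := @Order.TotalTheory.arg_minP _ R _ j (fun i => 0 < u 0 i) (fun i => y i / u 0 i) uj.
pose t := y k / u 0 k.
have t0 : 0 <= t by rewrite divr_ge0 // ltW.
pose y' i := y i - t * u 0 i.
have y'0 i : 0 <= y' i.
  rewrite subr_ge0; case: (ltrP 0 (u 0 i)) => ui; last first.
    by apply: le_trans (y0 i); rewrite mulr_ge0_le0.
  by rewrite -ler_pdivlMr //; apply: kmin.
have y'k : y' k = 0 by rewrite /y' /t divfK ?subrr // gt_eqF.
have y'b : \sum_i y' i *: a (s i) = b.
  under eq_bigr do rewrite scalerBl -scalerA.
  by rewrite sumrB yb -scaler_sumr ub scaler0 subr0.
apply: (IH (fun i => s (lift k i)) (fun i => y' (lift k i))) => //.
by rewrite -y'b (bigD1_ord k) //= y'k scale0r add0r.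
Qed.

(** The Leibniz formula has [m!] terms, each of absolute value at most 1. *)
Lemma det_bool_bound m (C : 'M[int]_m) :
  (forall i j, `|C i j| <= 1) -> (`|\det C|%N <= m`!)%N.
Proof.
move=> hC; rewrite -lez_nat abszE.
apply: le_trans (ler_norm_sum _ _ _) _.
apply: (@le_trans _ _ (\sum_(s : 'S_m) 1)).
  apply: ler_sum => s _; rewrite normrM normr_sign mul1r normr_prod.
  by apply: prodr_ile1 => i _; rewrite normr_ge0 hC.
by rewrite sumr_const card_Sn natz.
Qed.

(** Choose as many independent columns of [B] as it has rows. By Cramer's rule the determinant of
    this square 0/1 matrix, times the denominators of the right-hand side, is a common denominator
    of [y]. *)
Lemma basic_solution_denominator (R : realFieldType) m n (B : 'M[R]_(m, n))
    (c : 'I_m -> 'I_n -> bool) (y : 'rV[R]_m) (r : 'I_n -> rat) :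
  row_free B -> (forall i j, B i j = (c i j)%:R) ->
  y *m B = \row_j ratr (r j) -> (forall j, 0 <= y 0 j) ->
  exists D : nat, (0 < D)%N /\ (D <= m`! * \prod_j `|denq (r j)|)%N /\
    forall j, exists k : nat, y 0 j * D%:R = k%:R.
Proof.
move=> fr eB yB y0.
have fT : row_full B^T by rewrite /row_full mxrank_tr.
pose f := fullrankfun fT.
pose C := colsub f B.
(* The same 0/1 matrix over the integers: its determinant and its adjugate are integral. *)
pose Cz : 'M[int]_m := \matrix_(i, j) (c i (f j))%:Z.
have eC : C = map_mx intr Cz by apply/matrixP => i j; rewrite !mxE eB; case: (c _ _).
have uC : C \in unitmx.
  have := fullrowsub_unit fT; rewrite -unitmx_tr.
  by congr (_ \in unitmx); apply/matrixP => i j; rewrite !mxE.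
have dC : \det C = (\det Cz)%:~R by rewrite eC det_map_mx.
have dn0 : \det Cz != 0.
  by move: uC; rewrite unitmxE unitfE dC intr_eq0.
pose P := (\prod_j `|denq (r j)|)%N.
have P0 : (0 < P)%N by apply: prodn_gt0 => j; rewrite absz_gt0 denq_neq0.
have rP j : exists z : int, ratr (r j) * P%:R = z%:~R :> R.
  exists (numq (r j) * (\prod_(i | i != j) `|denq (r i)|)%N%:Z).
  rewrite /P (bigD1 j) //= natrM mulrA rmorphM /=; congr (_ * _).
  have := congr1 (@ratr R) (numqE (r j)); rewrite rmorphM /= !ratr_int => ->.
  by rewrite natr_absz ger0_norm ?denq_ge0.
have yC : y *m C = \row_j ratr (r (f j)).
  apply/rowP => j; move/rowP/(_ (f j)): yB; rewrite !mxE => <-.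
  by apply: eq_bigr => i _; rewrite !mxE.
exists (`|\det Cz| * P)%N; split; first by rewrite muln_gt0 P0 absz_gt0 dn0.
split.
  rewrite leq_mul2r det_bool_bound ?orbT // => i j.
  by rewrite mxE; case: (c _ _).
move=> j.
have [z ez] : exists z : int, y 0 j * (\det C * P%:R) = z%:~R.
  have e : y 0 j * \det C = \sum_k ratr (r (f k)) * (\adj Cz k j)%:~R.
    have := congr1 (fun v => (v *m \adj C) 0 j) yC.
    rewrite -mulmxA mul_mx_adj mul_mx_scalar !mxE mulrC => ->.
    by apply: eq_bigr => k _; rewrite eC -map_mx_adj !mxE.
  rewrite mulrA e mulr_suml.
  elim/big_ind: _ => [|u v [z ->] [w ->]|k _]; first by exists 0.
    by exists (z + w); rewrite intrD.
  have [z ez] := rP (f k); exists (z * \adj Cz k j).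
  by rewrite intrM -ez mulrAC.
exists `|z|%N; rewrite natr_absz intr_norm -ez dC natrM natr_absz intr_norm.
by rewrite !normrM (ger0_norm (y0 j)) normr_nat.
Qed.
End Basic.

(** * Certificates of consistent instances *)

Definition bits_of_set K (B : {set 'I_K}) : seq bits := [seq binary (val i) | i <- enum B].

Lemma bits_of_setK K : cancel (@bits_of_set K) (set_of_bits K).
Proof.
move=> B; apply/setP => i; rewrite inE /bits_of_set (mem_map (f := fun j : 'I_K => binary (val j))) ?mem_enum //.
by move=> j k /binary_inj /val_inj.
Qed.

Lemma good_bits_of_set K (B : {set 'I_K}) : good_itemset K (bits_of_set B).
Proof.
apply/andP; split.
  by apply/allP => _ /mapP[i _ ->]; rewrite canon_binary binaryK ltn_ord.
rewrite /bits_of_set -map_comp (eq_map (g := val)); last by move=> i; rewrite /= binaryK.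
apply: subseq_sorted ltn_trans _ _ _ (iota_ltn_sorted 0 K).
by rewrite -val_enum_ord map_subseq // (enumT (ordinal K)); apply: filter_subseq.
Qed.

Lemma bits_of_setD1 K (B : {set 'I_K}) i :
  bits_of_set (B :\ i) = [seq b <- bits_of_set B | b != binary (val i)].
Proof.
rewrite /bits_of_set filter_map /enum_mem -filter_predI; congr map.
by apply: eq_filter => j; rewrite /= !inE (inj_eq binary_inj).
Qed.

Definition bezout_bits (r : rat) : seq bits :=
  let n := `|numq r| in let d := `|denq r| in
  [:: binary n; binary d; binary (egcdn d n).2; binary (egcdn d n).1].

Lemma denq_abs_gt0 (r : rat) : 0 < `|denq r|.
Proof. by rewrite absz_gt0 denq_neq0. Qed.

Lemma binary_nil n : 0 < n -> ~~ nilp (binary n).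
Proof. by move=> n0; case e: (binary n) => //; have := binaryK n; rewrite e /=; lia. Qed.

(** The extended Euclidean algorithm returns coefficients no longer, up to one bit, than the
    numerator and the denominator; so the certificate stays short. *)
Lemma bezout_bounds r : let n := `|numq r| in let d := `|denq r| in
  [/\ (egcdn d n).1 * d = (egcdn d n).2 * n + 1, (egcdn d n).2 < d & (egcdn d n).1 <= n + 1].
Proof.
move=> n d; have d0 : 0 < d := denq_abs_gt0 r.
have co : gcdn d n = 1 by rewrite gcdnC; apply/eqP; exact: coprime_num_den.
case: egcdnP => // km kn; rewrite co muln1 => e lt; split=> //=.
by rewrite -(leq_pmul2r d0) e; nia.
Qed.

Lemma check_bezout_bits r : check_fraction (bezout_bits r).
Proof.
have [e _ _] := bezout_bounds r.
rewrite /check_fraction /= !canon_binary binary_nil ?denq_abs_gt0 //=.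
by rewrite beqP bval_bmul bval_badd bval_bmul !binaryK e.
Qed.

Lemma size_raw_nat b : size (raw_nat b) = (2 * size b).+1.
Proof. by elim: b => //= c b IH; rewrite -/(enc_seq _ b) -/(raw_nat b) IH; lia. Qed.

Lemma size_nest ws : size (nest ws) = \sum_(w <- ws) (2 * size w).+1.
Proof.
rewrite /nest size_flatten /shape -map_comp sumnE big_map.
by apply: eq_bigr => w _; rewrite /= size_raw_nat.
Qed.

Lemma size_enc_seq T (e : T -> bits) s : size (enc_seq e s) = (\sum_(a <- s) (size (e a)).+1).+1.
Proof.
rewrite /enc_seq size_cat addn1 size_flatten /shape -map_comp sumnE big_map.
by congr _.+1.
Qed.

Lemma size_bezout_bits r : size (nest (bezout_bits r)) <= 2 * size (enc_rat r).
Proof.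
have [_ u v] := bezout_bounds r.
rewrite size_nest /bezout_bits !big_cons big_nil /enc_rat /enc_int size_cat /= !enc_natE !size_raw_nat.
have := leq_size_binary (ltnW u).
have : size (binary (egcdn `|denq r| `|numq r|).1) <= (size (binary `|numq r|)).+1.
  apply: leq_trans (leq_size_binary v) _; apply: size_binary_exp.
  have := bval_lt (binary `|numq r|); rewrite binaryK expnS.
  by move: (expn_gt0 2 (size (binary `|numq r|))) => /=; lia.
lia.
Qed.

Lemma nest_filter (p : pred bits) ws : size (nest (filter p ws)) <= size (nest ws).
Proof.
rewrite !size_nest big_filter [leqRHS](bigID p) /=; exact: leq_addr.
Qed.

Lemma leq_expl a b e : a <= b -> a ^ e <= b ^ e.
Proof. by case: e => // e le; rewrite leq_exp2r. Qed.

Lemma fact_le_exp m : m`! <= m ^ m.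
Proof.
elim: m => // m IH; rewrite factS expnS leq_mul2l /=.
by apply: leq_trans IH _; case: m => // m; rewrite leq_exp2r.
Qed.


Section Complete.
Variables (R : realType) (I : instance).
Hypothesis vI : valid_instance I.
Let K := nattr I.
Let N := nsets I.
Let its : seq {set 'I_K} := itemsets I.
Let F := map (@bits_of_set K) its.
Let Q := map bezout_bits (freqs I).

Lemma certificate : consistent R I ->
  (forall j : 'I_N, (0 <= tnth (freqs I) j)%R) /\
  exists (D m : nat) (s : 'I_m -> Omega K) (k : 'I_m -> nat),
  [/\ 0 < D, m <= N.+1, D <= m`! * \prod_(j < N) `|denq (tnth (freqs I) j)|,
      \sum_i k i = D
    & forall j : 'I_N, `|denq (tnth (freqs I) j)| *
        (\sum_(i | [forall l in tnth (itemsets I) j, s i l]) k i) =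
        `|numq (tnth (freqs I) j)| * D].
Proof.
Local Open Scope ring_scope.
move=> [q [[q0 q1] hq]].
have th0 j : 0 <= tnth (freqs I) j.
  by rewrite -(ler0q R) -hq; apply: sumr_ge0.
split=> //.
(* Index 0 is the equation that the weights sum to 1, the others are the itemsets; this is where the
   bound N + 1 on the number of points comes from. *)
pose c (z : Omega K) (j : 'I_N.+1) : bool :=
  if unlift ord0 j is Some j' then [forall i in tnth (itemsets I) j', z i] else true.
pose rr (j : 'I_N.+1) : rat := if unlift ord0 j is Some j' then tnth (freqs I) j' else 1.
pose a (z : Omega K) : 'rV[R]_N.+1 := \row_j (c z j)%:R.
have sumq : \sum_(z : Omega K) q z *: a z = \row_j ratr (rr j).
  apply/rowP => j; rewrite summxE !mxE; under eq_bigr do rewrite !mxE.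
  rewrite /rr /c; case: unliftP => [j' _|_].
    rewrite -hq /frequency [RHS]big_mkcond /=; apply: eq_bigr => z _.
    by case: ifP; rewrite ?mulr1 ?mulr0.
  by under eq_bigr do rewrite mulr1; rewrite q1 (ratr_nat R 1).
have [||m [s [y [y0 yb fr]]]] := @caratheodory R _ _ a (\row_j ratr (rr j)) _
    (@enum_val _ (predT : {pred Omega K})) (fun i => q (enum_val i)).
- by move=> i; apply: q0.
- rewrite -sumq -(big_enum_val (A := predT : {pred Omega K}) (fun z => q z *: a z)).
  exact: eq_bigl.
have [|||D [D0 [leD hk]]] := @basic_solution_denominator R m N.+1 _
    (fun i j => c (s i) j) (\row_i y i) rr fr.
- by move=> i j; rewrite !mxE.
- rewrite -yb mulmx_sum_row; apply: eq_bigr => i _; by rewrite rowK mxE.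
- by move=> j; rewrite mxE.
have [k ek] := fin_all_exists hk.
have eqj j : (\sum_(i | c (s i) j) k i)%N%:R = ratr (rr j) * D%:R :> R.
  have /rowP/(_ j) := yb; rewrite summxE mxE => <-.
  rewrite natr_sum mulr_suml [LHS]big_mkcond /=; apply: eq_bigr => i _.
  by rewrite !mxE -ek !mxE; case: (c _ _); rewrite ?mulr1 ?mulr0 ?mul0r.
exists D, m, s, k; split=> //.
- by have := fr; rewrite -row_leq_rank => /leq_trans; apply; apply: rank_leq_col.
- move: leD; rewrite big_ord_recl {1}/rr unlift_none /= mul1n.
  congr (_ <= _ * _)%N; apply: eq_bigr => j _; by rewrite /rr liftK.
- apply/eqP; rewrite -(eqr_nat R); have := eqj ord0.
  rewrite /rr /c unlift_none rmorph1 mul1r => <-; apply/eqP; congr (_%:R).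
move=> j; apply/eqP; rewrite -(eqr_nat R) !natrM; have := eqj (lift ord0 j).
rewrite /rr /c liftK => ->.
have := congr1 (@ratr R) (numqE (tnth (freqs I) j)); rewrite rmorphM /= !ratr_int => e.
rewrite !natr_absz !ger0_norm ?denq_ge0 ?numq_ge0 // e.
by rewrite mulrA [_ * ratr _]mulrC.
Qed.

Local Close Scope ring_scope.

Lemma encE : (forall j : 'I_N, (0 <= tnth (freqs I) j)%R) ->
  enc_instance I = raw_instance (binary K) F (map (fun q => (word q 0, word q 1)) Q).
Proof.
move=> th0.
rewrite /enc_instance enc_natE /raw_instance; congr (_ ++ (_ ++ _)).
  rewrite /enc_seq /F -map_comp; congr (flatten _ ++ _); apply: eq_map => B /=.
  by rewrite -{1}[B]bits_of_setK enc_itemset_raw ?good_bits_of_set.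
rewrite /enc_seq /Q -!map_comp; congr (flatten _ ++ _); apply/eq_in_map => r /tnthP[j ->] /=.
by rewrite /enc_rat /enc_int ltNge numq_ge0 th0.
Qed.

Lemma check_complete : consistent R I -> exists w,
  size w <= (fun n => 20 * n + 20 + 2 * ((n + 1) * (2 * (2 * ((n + 1) * (n + 1) + n + 1) + 1 + n) + 1)) +
             2 * ((n + 1) * (n + 1) + n + 1)) (size (enc_instance I))
  /\ check (enc_instance I) w.
Proof.
move=> /certificate[th0 [D [m [s [k [D0 le_m leD sumk hk]]]]]].
(* A point records only those of its attributes that occur in some itemset: the frequencies do not
   see the others, of which there may be exponentially many. *)
pose occ := flatten F.
pose attrs (z : Omega K) := [seq a <- occ | [exists i : 'I_K, (binary (val i) == a) && z i]].
pose P := [seq binary (k i) :: attrs (s i) | i <- enum 'I_m].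
pose w := nest [:: binary K; binary D; nest (map nest F); nest (map nest Q); nest (map nest P)].
have attrsE z B : B \in its ->
    all (fun a => has (fun b => b == a) (attrs z)) (bits_of_set B) = [forall i in B, z i].
  move=> BI; apply/allP/forall_inP => [h i iB|h a /mapP[i]].
    have /h : binary (val i) \in bits_of_set B by rewrite /bits_of_set (map_f (fun i : 'I_K => binary (val i))) ?mem_enum.
    case/hasP => b; rewrite mem_filter => /andP[/existsP[i' /andP[/eqP <- zi']] _].
    by move=> /eqP/binary_inj/val_inj <-.
  rewrite mem_enum => iB ea; apply/hasP; exists a => //; rewrite mem_filter ea; apply/andP; split.
    by apply/existsP; exists i; rewrite eqxx h.
  apply/flattenP; exists (bits_of_set B); first exact: map_f.
  by rewrite /bits_of_set (map_f (fun i : 'I_K => binary (val i))) ?mem_enum.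
exists w; split; last first.
  rewrite /check /blocks /w nestK /= !nestK.
  have cK X : map unnest (map nest X) = X by rewrite -map_comp -[RHS]map_id; apply: eq_map => ?; rewrite /= nestK.
  rewrite !cK; have [K0 uI aI] := vI.
  have szI : size its = N by rewrite /its size_tuple.
  apply/andP; split.
    rewrite /check_family canon_binary binary_nil //= -encE // eqxx andbT.
    apply/and5P; split.
    - apply/allP => _ /mapP[B _ ->]; by rewrite check_itemsetP binaryK good_bits_of_set.
    - rewrite undup_id // map_inj_uniq //; exact: can_inj (@bits_of_setK K).
    - apply/allP => _ /mapP[B BI ->]; apply/allP => _ /mapP[i _ ->]; apply/hasP.
      exists (bits_of_set (B :\ i)); last by rewrite bits_of_setD1.
      by apply: map_f; apply: aI BI _; apply: subD1set.
    - by rewrite /F /Q !size_map szI size_tuple.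
    - by apply/allP => _ /mapP[r _ ->]; apply: check_bezout_bits.
  have sumP C : \sum_(p <- P | C p) bval (head [::] p) = \sum_(i | C (binary (k i) :: attrs (s i))) k i.
    by rewrite /P big_map big_enum_cond /=; apply: eq_big => i //; rewrite binaryK.
  apply/and3P; split.
  - have [ct et] := trimP (binary D); case e: (trim (binary D)) et => //=.
    by rewrite binaryK => e'; rewrite -e' in D0.
  - by rewrite beqP bval_bsum big_map binaryK sumP sumk.
  apply/(all_nthP ([::], [::])) => j; rewrite size_zip /F /Q !size_map szI size_tuple minnn => lt.
  rewrite nth_zip ?size_map ?szI ?size_tuple // beqP.
  have eB : nth [::] (map (@bits_of_set K) its) j = bits_of_set (tnth (itemsets I) (Ordinal lt)).
    by rewrite (nth_map set0) ?szI // (tnth_nth set0).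
  have eQ : nth [::] (map bezout_bits (freqs I)) j = bezout_bits (tnth (freqs I) (Ordinal lt)).
    by rewrite (nth_map 0%R) ?size_tuple // (tnth_nth 0%R).
  rewrite eB eQ [(_, _).1]/(bits_of_set _) [(_, _).2]/(bezout_bits _).
  rewrite /word /= !bval_bmul !binaryK bval_bsum big_map big_filter sumP -hk.
  apply/eqP; congr (_ * _); apply: eq_bigl => i; apply: attrsE; exact: mem_tnth.
set n := size (enc_instance I).
have en : n = size (raw_instance (binary K) F (map (fun q => (word q 0, word q 1)) Q)).
  by rewrite /n encE.
rewrite /raw_instance size_cat size_raw_nat size_cat !size_enc_seq /F /Q -map_comp !big_map /= in en.
set sF := \sum_(B <- its) _ in en; set sQ := \sum_(r <- freqs I) _ in en.
have leN : N <= n.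
  have : \sum_(B <- its) 1 <= sF by apply: leq_sum.
  by rewrite sum1_size size_tuple -/N; lia.
have leF B : size (nest (bits_of_set B)) <= size (raw_itemset (@bits_of_set K B)).
  rewrite size_nest size_enc_seq; apply: ltnW; rewrite ltnS; apply: leq_sum => b _.
  by rewrite size_raw_nat.
have szF : size (nest (map nest F)) <= 2 * sF.
  rewrite size_nest /F -map_comp big_map /sF big_distrr /=; apply: leq_sum => B _.
  by have := leF B; lia.
have szQ : size (nest (map nest Q)) <= 4 * sQ.
  rewrite size_nest /Q -map_comp big_map /sQ big_distrr /= big_seq [leqRHS]big_seq; apply: leq_sum => r /tnthP[j ->].
  have := size_bezout_bits (tnth (freqs I) j).
  have -> : size (enc_rat (tnth (freqs I) j)) = size (raw_rat
      (word (bezout_bits (tnth (freqs I) j)) 0, word (bezout_bits (tnth (freqs I) j)) 1)).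
    by rewrite /enc_rat /enc_int ltNge numq_ge0 th0.
  have aux a b : a <= 2 * b -> (2 * a).+1 <= 4 * b.+1 by lia.
  exact: aux.
have szocc z : size (nest (attrs z)) <= sF.
  apply: leq_trans (nest_filter _ _) _; rewrite size_nest /occ big_flatten /F big_map /=.
  apply: leq_sum => B _; rewrite -size_nest; exact: leq_trans (leF B) _.
(* [m!] is at most [m ^ m] with m at most n + 1, and the denominators multiply to at most [2 ^ n]
   since their digits are part of the input. So D has polynomially many digits. *)
have ltD : D < 2 ^ ((n + 1) * (n + 1) + n + 1).
  have h1 : m`! <= 2 ^ ((n + 1) * (n + 1)).
    apply: leq_trans (fact_le_exp _) _; rewrite expnM.
    apply: (@leq_trans ((2 ^ (n + 1)) ^ m)).
      apply: leq_expl; apply: ltnW; apply: leq_ltn_trans (ltn_expl _ (isT : 1 < 2)); lia.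
    by apply: leq_pexp2l; rewrite ?expn_gt0 //; lia.
  have h2 : \prod_(j < N) `|denq (tnth (freqs I) j)| <= 2 ^ n.
    have : \prod_(j < N) `|denq (tnth (freqs I) j)| <= 2 ^ sQ.
      rewrite /sQ big_tuple expn_sum; apply: leq_prod => j _.
      have := bval_lt (binary `|denq (tnth (freqs I) j)|); rewrite binaryK => /ltnW/leq_trans; apply.
      rewrite leq_exp2l // /raw_rat /word /= size_cat !size_raw_nat; lia.
    by move=> /leq_trans; apply; rewrite leq_exp2l //; lia.
  apply: leq_ltn_trans leD _; apply: leq_ltn_trans (leq_mul h1 h2) _.
  by rewrite -expnD -addnA ltn_exp2l //; lia.
have szD := size_binary_exp ltD.
have szP : size (nest (map nest P)) <= (n + 1) * (2 * (2 * ((n + 1) * (n + 1) + n + 1) + 1 + n) + 1).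
  rewrite size_nest /P -map_comp big_map big_enum /=.
  apply: (@leq_trans (\sum_(i < m) (2 * (2 * ((n + 1) * (n + 1) + n + 1) + 1 + n) + 1))).
    apply: leq_sum => i _.
    have lek : k i <= D by rewrite -sumk (bigD1 i) //= leq_addr.
    have h := leq_trans (leq_size_binary lek) szD.
    rewrite size_nest big_cons -size_nest; have := szocc (s i); lia.
  rewrite sum_nat_const card_ord leq_mul2r; apply/orP; right; lia.
rewrite /w size_nest !big_cons big_nil; lia.
Qed.
End Complete.

Lemma CONSISTENT_in_NP (R : realType) : in_NP (CONSISTENT R).
Proof.
have [c [k le]] : exists c k, forall n, (fun n => 20 * n + 20 + 2 * ((n + 1) * (2 * (2 * ((n + 1) * (n + 1) + n + 1) + 1 + n) + 1)) +
             2 * ((n + 1) * (n + 1) + n + 1)) n <= poly_bound c k n.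
  by apply: is_poly_bound; is_poly_tac.
exists (fun x w => check x w), c, k; split; first exact: poly_decidable poly_check.
move=> x; split=> [[I [-> vI cI]]|[w [_ ck]]]; last exact: check_sound ck.
have [w [sz ck]] := check_complete vI cI.
by exists w; split=> //; apply: leq_trans sz (le _).
Qed.

(** * Binary constraint satisfaction as consistency *)

Section Gadget.
Variable p : nat.
Local Notation W := 'I_p.+1.
Local Notation G := (W * W)%type.
(** A tag is a class together with a value: class 0 is the first copy of a variable, class 1 the
    second copy, class 2 the reference. An attribute asserts that the copy has this value. *)
Definition tag : finType := ('I_3 * (W * W))%type.

Definition tag_rank (t : tag) : nat := t.1 * #|{: G}| + enum_rank t.2.
Definition tag_bound : nat := 3 * #|{: G}|.

(** Unary with padding to a fixed length, so that as numbers these words increase with the rank. The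
    closing 1 is the most significant bit of the attribute and makes it canonical. *)
Definition tag_bits (t : tag) : bits :=
  nseq (tag_rank t) true ++ nseq (tag_bound - tag_rank t) false ++ [:: true].

Definition attribute (v : bits) (t : tag) : bits := v ++ tag_bits t.

Lemma tag_rank_lt t : tag_rank t < tag_bound.
Proof.
case: t => c g; rewrite /tag_rank /tag_bound /=.
have := ltn_ord (enum_rank g); have := ltn_ord c.
rewrite -[#|_|]/#|{: G}|; move: (nat_of_ord c) (nat_of_ord _) => a b; nia.
Qed.

Lemma tag_rank_inj : injective tag_rank.
Proof.
move=> [c g] [c' g']; rewrite /tag_rank /=.
have := ltn_ord (enum_rank g); have := ltn_ord (enum_rank g').
rewrite -[#|_|]/#|{: G}| => h' h e.
have ec : nat_of_ord c = c'.
  by move: (nat_of_ord c) (nat_of_ord c') (nat_of_ord _) (nat_of_ord _) e h h' => a b x y; nia.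
have eg : enum_rank g = enum_rank g' by apply: val_inj => /=; move: e; rewrite ec => /addnI.
by rewrite (enum_rank_inj eg) (val_inj ec).
Qed.

Lemma tag_rank_le t u : tag_rank t < tag_rank u -> val t.1 <= val u.1.
Proof.
move=> lt.
rewrite leqNgt; apply/negP => h''; move: lt; rewrite /tag_rank.
have := ltn_ord (enum_rank u.2); rewrite -[#|_|]/#|{: G}|; move: h'' => /=.
move: (nat_of_ord t.1) (nat_of_ord u.1) (nat_of_ord (enum_rank t.2)) (nat_of_ord (enum_rank u.2)) => a b x y.
by nia.
Qed.

Lemma size_tag_bits t : size (tag_bits t) = tag_bound.+1.
Proof. by rewrite !size_cat !size_nseq /= addn1 addnS subnKC // ltnW // tag_rank_lt. Qed.

Lemma bval_ones n : bval (nseq n true) = 2 ^ n - 1.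
Proof. by elim: n => //= n ->; rewrite expnS; have := expn_gt0 2 n; lia. Qed.

Lemma bval_tag_bits t : bval (tag_bits t) = 2 ^ tag_rank t - 1 + 2 ^ tag_bound.
Proof.
rewrite /tag_bits !bval_cat bval_ones bval_zeros !size_nseq /= muln1 add0n -expnD.
by rewrite subnKC // ltnW // tag_rank_lt.
Qed.

Lemma tag_bits_inj : injective tag_bits.
Proof.
move=> t u /(congr1 bval); rewrite !bval_tag_bits => /addIn e.
apply: tag_rank_inj; apply/eqP; rewrite -(eqn_exp2l _ _ (isT : 1 < 2)).
by have := expn_gt0 2 (tag_rank t); have := expn_gt0 2 (tag_rank u); rewrite /= => h h'; apply/eqP; lia.
Qed.

Variables (L : nat) (Vs : seq bits) (E : W -> W -> seq (bits * bits)).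
(** A variable may have this name as well; the class in the tag keeps them apart. *)
Definition ref : bits := nseq L false.

Definition single_names (t : tag) : seq bits := if val t.1 == 2 then [:: ref] else Vs.

(** The pairs that must not hold together. Within a class: two values of the same name. Against the
    reference: the first copy must share its second coordinate, the second copy its first. Between
    the copies, the tags of values [(r1 + d, r2)] and [(r1, r2 + d')] give back d and d' as the two
    differences, and [E] says which variables may not take them. *)
Definition pair_names (t u : tag) : seq (bits * bits) :=
  if tag_rank u <= tag_rank t then [::] else
  if t.1 == u.1 then [seq (v, v) | v <- single_names t] else
  if val u.1 == 2 then
    if (if val t.1 == 0 then t.2.2 != u.2.2 else t.2.1 != u.2.1)
    then [seq (v, ref) | v <- Vs] else [::]
  else E (t.2.1 - u.2.1)%R (u.2.2 - t.2.2)%R.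

Definition gadget_itemsets : seq (seq bits) :=
  [::] :: flatten [seq [seq [:: attribute v t] | v <- single_names t] | t <- enum tag] ++
  flatten [seq flatten [seq [seq [:: attribute uv.1 t; attribute uv.2 u] | uv <- pair_names t u]
                       | u <- enum tag] | t <- enum tag].

Definition gadget_freq (B : seq bits) : bits * bits :=
  if nilp B then ([:: true], [:: true])
  else if nilp (behead B) then ([:: true], binary #|{: G}|) else ([::], [:: true]).

(** This number, a power of 2, exceeds all attributes. It is exponential, but its binary expansion
    is short. *)
Definition gadget_top : bits := nseq (L + tag_bound.+1) false ++ [:: true].

Definition gadget : bits :=
  raw_instance gadget_top (undup gadget_itemsets) (map gadget_freq (undup gadget_itemsets)).

Hypothesis sizeV : forall v, v \in Vs -> size v = L.
Hypothesis E_sub : forall d d' u v, (u, v) \in E d d' -> u \in Vs /\ v \in Vs.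
(** These nogoods hold for every assignment [s]; in the instance they force the two copies of a
    variable to agree. *)
Hypothesis E_eq : forall d d' v, v \in Vs -> d != d' -> (v, v) \in E d d'.

Let k := bval gadget_top.

Lemma gadget_topE : k = 2 ^ (L + tag_bound.+1).
Proof. by rewrite /k bval_cat bval_zeros size_nseq /= muln1. Qed.

Lemma single_size t v : v \in single_names t -> size v = L.
Proof.
rewrite /single_names; case: ifP => _; last exact: sizeV.
by rewrite inE => /eqP ->; rewrite size_nseq.
Qed.

Lemma pair_single t u v w : (v, w) \in pair_names t u ->
  [/\ v \in single_names t, w \in single_names u & tag_rank t < tag_rank u].
Proof.
rewrite /pair_names ltnNge; case: leqP => // lt.
have le_tag := tag_rank_le lt.
case: eqP => [e|ne]; first by case/mapP => x xs [-> ->]; rewrite /single_names -e.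
have t2 : val t.1 == 2 = false.
  apply/negP => /eqP e; apply: ne; apply: val_inj; apply/eqP; rewrite eqn_leq le_tag /=.
  by rewrite [X in _ <= X]e -ltnS ltn_ord.
rewrite /single_names t2; case: (val u.1 == 2).
  case: ifP => // _ /mapP[x xs [-> ->]]; by rewrite inE eqxx.
by move=> /E_sub[-> ->].
Qed.

Lemma attribute_lt v t : size v = L -> bval (attribute v t) < k.
Proof.
move=> sv; apply: leq_trans (bval_lt _) _.
by rewrite gadget_topE leq_exp2l // size_cat size_tag_bits sv.
Qed.

Lemma attribute_canon v t : canon (attribute v t).
Proof. by rewrite /canon /attribute /tag_bits !last_cat. Qed.

Lemma attribute_inj v w t u : size v = L -> size w = L ->
  attribute v t = attribute w u -> v = w /\ t = u.
Proof.
move=> sv sw /eqP; rewrite eqseq_cat ?sv ?sw // => /andP[/eqP -> /eqP /tag_bits_inj ->].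
by [].
Qed.

(** The tag occupies the most significant digits, so it decides the comparison whatever the names
    are. *)
Lemma attribute_order v w t u : size v = L -> size w = L -> tag_rank t < tag_rank u ->
  bval (attribute v t) < bval (attribute w u).
Proof.
move=> sv sw lt; rewrite /attribute bval_cat sv bval_cat sw.
have := bval_lt v; rewrite sv => h.
apply: (@leq_trans (2 ^ L * (bval (tag_bits t)).+1)); first by rewrite mulnS; lia.
rewrite (leq_trans _ (leq_addl _ _)) // leq_mul2l; apply/orP; right.
rewrite !bval_tag_bits; have : 2 ^ tag_rank t < 2 ^ tag_rank u by rewrite ltn_exp2l.
by have := expn_gt0 2 (tag_rank t); rewrite /=; lia.
Qed.

Variant gadget_spec : seq bits -> Type :=
| GadgetEmpty : gadget_spec [::]
| GadgetSingle v t : v \in single_names t -> gadget_spec [:: attribute v t]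
| GadgetPair v w t u : (v, w) \in pair_names t u ->
    gadget_spec [:: attribute v t; attribute w u].

Lemma gadgetP B : B \in gadget_itemsets ->
  [\/ B = [::], exists v t, v \in single_names t /\ B = [:: attribute v t]
   | exists v w t u, (v, w) \in pair_names t u /\ B = [:: attribute v t; attribute w u]].
Proof.
rewrite inE mem_cat => /orP[/eqP ->|/orP[|]]; first by constructor 1.
  by case/flattenP => _ /mapP[t _ ->] /mapP[v vt ->]; constructor 2; exists v, t.
case/flattenP => _ /mapP[t _ ->] /flattenP[_ /mapP[u _ ->] /mapP[[v w] vw ->]].
by constructor 3; exists v, w, t, u.
Qed.

Lemma gadget_single v t : v \in single_names t -> [:: attribute v t] \in gadget_itemsets.
Proof.
move=> vt; rewrite inE mem_cat; apply/orP; right; apply/orP; left.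
apply/flattenP; exists [seq [:: attribute v t] | v <- single_names t].
  by apply/mapP; exists t; rewrite ?mem_enum.
by apply/mapP; exists v.
Qed.

Lemma gadget_pair v w t u : (v, w) \in pair_names t u ->
  [:: attribute v t; attribute w u] \in gadget_itemsets.
Proof.
move=> vw; rewrite inE mem_cat; apply/orP; right; apply/orP; right.
apply/flattenP; eexists; first by apply/mapP; exists t; rewrite ?mem_enum.
apply/flattenP; eexists; first by apply/mapP; exists u; rewrite ?mem_enum.
by apply/mapP; exists (v, w).
Qed.

Lemma gadget_good : all (good_itemset k) (undup gadget_itemsets).
Proof.
apply/allP => B; rewrite mem_undup => /gadgetP[->//|[v [t [vt ->]]]|[v [w [t [u [vw ->]]]]]].
  have sv := single_size vt.
  by rewrite /good_itemset /= attribute_canon attribute_lt.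
have [/single_size sv /single_size sw lt] := pair_single vw.
rewrite /good_itemset /= !attribute_canon !attribute_lt //= !andbT.
exact: attribute_order.
Qed.

Lemma gadget_closed B a : B \in undup gadget_itemsets -> a \in B ->
  [seq b <- B | b != a] \in undup gadget_itemsets.
Proof.
have nilG : [::] \in gadget_itemsets by rewrite inE eqxx.
rewrite !mem_undup => /gadgetP[->//|[v [t [vt ->]]]|[v [w [t [u [vw ->]]]]]].
  by rewrite inE => /eqP ->; rewrite /= eqxx.
have [vt wu lt] := pair_single vw.
have ne : attribute v t != attribute w u.
  apply/negP => /eqP /(attribute_inj (single_size vt) (single_size wu))[_ e].
  by rewrite e ltnn in lt.
rewrite !inE => /orP[] /eqP -> /=; rewrite eqxx.
  by rewrite [attribute w u == _]eq_sym ne /=; apply: gadget_single.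
by rewrite ne /=; apply: gadget_single.
Qed.

Local Open Scope ring_scope.

Definition gadget_rat (B : seq bits) : rat :=
  if nilp B then 1 else if nilp (behead B) then (#|{: G}|%:R)^-1 else 0.

Lemma gadget_rat_enc B : enc_rat (gadget_rat B) = raw_rat (gadget_freq B).
Proof.
rewrite /gadget_rat /gadget_freq; case: nilp; first by [].
case: nilp; last by [].
have g0 : (0 < #|{: G}|)%N by apply/card_gt0P; exists (0, 0).
rewrite -[#|_|%:R]/(#|{: G}|%:Z%:~R) -[_^-1]mul1r -[1]/(1%:Z%:~R).
rewrite /enc_rat /enc_int coprimeq_num ?coprime1n // coprimeq_den ?coprime1n //.
rewrite gtr0_sg ?ltz_nat // mul1r eqz_nat eqn0Ngt g0 /=.
by rewrite /raw_rat /= !enc_natE.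
Qed.

Definition satisfied (s : bits -> W) : Prop :=
  forall d d' u v, (u, v) \in E d d' -> ~~ ((s u == d) && (s v == d')).

Variable R : realType.

Let hold (x : Omega k) (b : bits) : bool := [exists i : 'I_k, (binary i == b) && x i].

Lemma hold_itemset (x : Omega k) B : good_itemset k B -> [forall i in set_of_bits k B, x i] = all (hold x) B.
Proof.
move=> /andP[/allP gB _]; apply/forall_inP/allP => [h a aB|h i].
  have /andP[ca lt] := gB a aB; apply/existsP; exists (Ordinal lt).
  by rewrite bvalK // eqxx h // inE bvalK.
rewrite inE => /h /existsP[j /andP[/eqP e xj]].
by rewrite -(val_inj (binary_inj e)).
Qed.

Lemma gadget_frequency (q : Omega k -> R) B : good_itemset k B ->
  frequency q (set_of_bits k B) = \sum_(x | all (hold x) B) q x.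
Proof. by move=> gB; apply: eq_bigl => x; apply: hold_itemset. Qed.

Lemma gadget_card_gt0 : (0 < #|{: G}|)%N.
Proof. by apply/card_gt0P; exists (0, 0). Qed.

Lemma gadget_rat_single v t : gadget_rat [:: attribute v t] = (#|{: G}|%:R)^-1.
Proof. by []. Qed.

Let freq_eq (q : Omega k -> R) : Prop := forall B, B \in gadget_itemsets ->
  \sum_(x | all (hold x) B) q x = ratr (gadget_rat B).

(* The three values read off any point of positive weight differ from the
   solution by a common shift [g], which is the value of the reference. *)
Lemma gadget_sound (q : Omega k -> R) : is_distribution q -> freq_eq q ->
  exists s, satisfied s.
Proof.
move=> [q0 q1] hq.
have [z qz] : exists z, 0 < q z.
  apply/existsP; apply: contraT; rewrite negb_exists => /forallP h.
  suff : (0 : R) = 1 by move/eqP; rewrite eq_sym oner_eq0.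
  rewrite -[RHS]q1 big1 // => x _; apply/eqP; rewrite eq_le q0 andbT.
  by have := h x; rewrite -leNgt.
have excl x v w t u : (v, w) \in pair_names t u -> 0 < q x ->
    ~~ (hold x (attribute v t) && hold x (attribute w u)).
  move=> vw qx; apply/negP => hx; have := hq _ (gadget_pair vw).
  rewrite [gadget_rat _]/(0) rmorph0 => /eqP; rewrite psumr_eq0 //.
  move=> /allP /(_ x (mem_index_enum _)) /implyP; rewrite /= andbT => /(_ hx) /eqP e.
  by rewrite e ltxx in qx.
(* At a point of positive weight at most one of the values of [v] holds, by [excl]; but the expected
   number of them is [#|G|] times [1 / #|G|], that is 1. So one holds at every such point, in
   particular at [z]. *)
have ex (c : 'I_3) v : v \in single_names (c, (0, 0)) ->
    exists g, hold z (attribute v (c, g)).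
  move=> vc; have vc' g : v \in single_names (c, g) by [].
  apply/existsP; apply: contraT; rewrite negb_exists => /forallP h.
  pose cnt x := (\sum_(g : G) (hold x (attribute v (c, g)) : nat))%N.
  have cnt1 x : 0 < q x -> (cnt x <= 1)%N.
    move=> qx; rewrite /cnt.
    have [g hg|no] := pickP (fun g : G => hold x (attribute v (c, g))); last first.
      by rewrite big1 // => g _; rewrite no.
    rewrite (bigD1 g) //= hg big1 // => g' ne; apply/eqP; rewrite eqb0; apply/negP => hg'.
    have : (v, v) \in pair_names (c, g) (c, g') \/ (v, v) \in pair_names (c, g') (c, g).
      rewrite /pair_names /= !eqxx.
      have [lt|lt|e] := ltngtP (tag_rank (c, g)) (tag_rank (c, g')).
      - by left; apply/mapP; exists v.
      - by right; apply/mapP; exists v.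
      by have [e'] := tag_rank_inj e; rewrite e' eqxx in ne.
    by case=> /excl /(_ qx); rewrite hg hg'.
  have sum1 : \sum_x q x * (cnt x)%:R = 1.
    under eq_bigr do rewrite natr_sum mulr_sumr.
    rewrite exchange_big /= (eq_bigr (fun=> (#|{: G}|%:R)^-1)).
      by rewrite sumr_const -[LHS]mulr_natr mulVf // pnatr_eq0 -lt0n gadget_card_gt0.
    move=> g _; have := hq _ (gadget_single (vc' g)).
    rewrite gadget_rat_single fmorphV rmorph_nat => <-; rewrite [RHS]big_mkcond /=.
    by apply: eq_bigr => x _; rewrite andbT; case: ifP; rewrite ?mulr1 ?mulr0.
  have : \sum_x q x * (cnt x)%:R <= \sum_(x | x != z) q x.
    rewrite (bigD1 z) //= [X in X + _](_ : _ = 0) ?add0r; last first.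
      by rewrite /cnt big1 ?mulr0 // => g _; rewrite (negPf (h g)).
    apply: ler_sum => x _; have := q0 x; rewrite le_eqVlt => /orP[/eqP <-|qx].
      by rewrite mul0r.
    by rewrite ler_piMr ?q0 // lern1 cnt1.
  have := q1; rewrite (bigD1 z) //= sum1 => <- h'.
  by exfalso; move: h' qz; lra.
have c0 : (0 < 3)%N by []. have c1 : (1 < 3)%N by []. have c2 : (2 < 3)%N by [].
have [g hg] := ex (Ordinal c2) ref (mem_head _ _).
pose t0 (a : G) : tag := (Ordinal c0, a); pose t1 (a : G) : tag := (Ordinal c1, a).
have lt01 a b : (tag_rank (t0 a) < tag_rank (t1 b))%N.
  rewrite /tag_rank /=; have := ltn_ord (enum_rank a).
  rewrite -[#|_|]/#|{: G}| mul0n mul1n add0n => /leq_trans; apply; exact: leq_addr.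
have lt02 a b : (tag_rank (t0 a) < tag_rank (Ordinal c2, b))%N.
  rewrite /tag_rank /=; have := ltn_ord (enum_rank a).
  rewrite -[#|_|]/#|{: G}| mul0n add0n => /leq_trans; apply; rewrite mulSn -addnA; exact: leq_addr.
have lt12 a b : (tag_rank (t1 a) < tag_rank (Ordinal c2, b))%N.
  rewrite /tag_rank /=; have := ltn_ord (enum_rank a).
  rewrite -[#|_|]/#|{: G}| mul1n mulSn mul1n => h; rewrite -addnA ltn_add2l.
  exact: leq_trans h (leq_addr _ _).
(* The pairs with the reference exclude every second coordinate other than that of [g]; so the value
   is [g] shifted in its first coordinate only. *)
have A0 v : v \in Vs -> exists d, hold z (attribute v (t0 (g.1 + d, g.2))).
  move=> vV; have [a ha] := ex (Ordinal c0) v vV; exists (a.1 - g.1).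
  rewrite addrC subrK; suff e2 : a.2 = g.2 by rewrite -e2 -surjective_pairing.
  apply/eqP; apply: contraT => ne.
  have : (v, ref) \in pair_names (t0 a) (Ordinal c2, g).
    by rewrite /pair_names leqNgt lt02 /= ne; apply/mapP; exists v.
  by move=> /excl /(_ qz); rewrite ha hg.
have A1 v : v \in Vs -> exists d, hold z (attribute v (t1 (g.1, g.2 + d))).
  move=> vV; have [a ha] := ex (Ordinal c1) v vV; exists (a.2 - g.2).
  rewrite addrC subrK; suff e2 : a.1 = g.1 by rewrite -e2 -surjective_pairing.
  apply/eqP; apply: contraT => ne.
  have : (v, ref) \in pair_names (t1 a) (Ordinal c2, g).
    by rewrite /pair_names leqNgt lt12 /= ne; apply/mapP; exists v.
  by move=> /excl /(_ qz); rewrite ha hg.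
have AE d d' u v : (u, v) \in E d d' -> hold z (attribute u (t0 (g.1 + d, g.2))) ->
    hold z (attribute v (t1 (g.1, g.2 + d'))) -> False.
  move=> uv hu hv; have : (u, v) \in pair_names (t0 (g.1 + d, g.2)) (t1 (g.1, g.2 + d')).
    rewrite /pair_names leqNgt lt01 /=.
    by rewrite [g.1 + d]addrC addrK [g.2 + d']addrC addrK.
  by move=> /excl /(_ qz); rewrite hu hv.
(* The solution is read off the first copies; [E_eq] then yields that the second copies carry the
   same values. *)
pose s (v : bits) : W := odflt 0 [pick d | hold z (attribute v (t0 (g.1 + d, g.2)))].
have s0 v : v \in Vs -> hold z (attribute v (t0 (g.1 + s v, g.2))).
  by move=> /A0[d hd]; rewrite /s; case: pickP => [//|/(_ d)]; rewrite hd.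
exists s => d d' u v uv; apply/negP => /andP[/eqP eu /eqP ev].
have [uV vV] := E_sub uv.
have [d'' hd''] := A1 v vV.
have e'' : d'' = s v.
  apply/eqP; apply: contraT; rewrite eq_sym => ne.
  by case: (AE _ _ v v (E_eq vV ne) (s0 v vV) hd'').
apply: (AE d d' u v uv); first by rewrite -eu; apply: s0.
by rewrite -ev -e''.
Qed.

Let tag_true (s : bits -> W) (g : G) (v : bits) (t : tag) : bool :=
  if val t.1 == 0%N then t.2 == (g.1 + s v, g.2) else
  if val t.1 == 1%N then t.2 == (g.1, g.2 + s v) else t.2 == g.

(** Names have length [L], so [take L] recovers the name from an attribute. Numbers that are not
    attributes of the gadget in this sense are set to 0. *)
Let shifted (s : bits -> W) (g : G) : Omega k := [ffun i : 'I_k =>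
  [exists t : tag, (binary i == attribute (take L (binary i)) t)
     && tag_true s g (take L (binary i)) t]].

Lemma hold_shifted s g v t : size v = L ->
  hold (shifted s g) (attribute v t) = tag_true s g v t.
Proof.
move=> sv; have tk : take L (attribute v t) = v by rewrite /attribute take_size_cat.
apply/existsP/idP => [[i /andP[/eqP e]]|h].
  rewrite ffunE e tk => /existsP[u /andP[/eqP eu]].
  by have [_ <-] := attribute_inj sv sv eu.
exists (Ordinal (attribute_lt t sv)); rewrite ffunE /= bvalK ?attribute_canon // eqxx /=.
by apply/existsP; exists t; rewrite tk eqxx.
Qed.

Lemma gadget_complete s : satisfied s ->
  exists q : Omega k -> R, is_distribution q /\ freq_eq q.
Proof.
move=> hs; pose q (x : Omega k) : R := \sum_(g | shifted s g == x) (#|{: G}|%:R)^-1.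
have sumq (C : pred (Omega k)) : \sum_(x | C x) q x =
    (#|[set g | C (shifted s g)]|)%:R * (#|{: G}|%:R)^-1.
  rewrite /q (exchange_big_dep (fun g => C (shifted s g))) /=; last first.
    by move=> x g Cx /eqP ->.
  rewrite (eq_bigr (fun=> (#|{: G}|%:R)^-1)); last first.
    move=> g Cg; rewrite (big_pred1 (shifted s g)) // => x /=.
    by rewrite eq_sym; case: eqP => [->|]; rewrite ?Cg ?andbF.
  by rewrite sumr_const mulr_natl cardsE.
have G0 : (#|{: G}|%:R : R) != 0 by rewrite pnatr_eq0 -lt0n gadget_card_gt0.
exists q; split.
  split=> [x|]; first by apply: sumr_ge0 => g _; rewrite invr_ge0 ler0n.
  rewrite (sumq predT); have -> : [set g : G | predT (shifted s g)] = setT by apply/setP => g; rewrite !inE.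
  by rewrite cardsT divff.
move=> B /gadgetP[->|[v [t [vt ->]]]|[v [w [t [u [vw ->]]]]]].
- rewrite [gadget_rat _]/(1) rmorph1 (sumq predT).
  have -> : [set g : G | predT (shifted s g)] = setT by apply/setP => g; rewrite !inE.
  by rewrite cardsT divff.
- rewrite gadget_rat_single fmorphV rmorph_nat sumq.
  (* Translation is a bijection of the group: exactly one shift gives a copy the prescribed value,
     whatever [s] is. *)
  have [a ha] : exists a, [set g | all (hold (shifted s g)) [:: attribute v t]] = [set a].
    exists (if val t.1 == 0%N then (t.2.1 - s v, t.2.2) else
            if val t.1 == 1%N then (t.2.1, t.2.2 - s v) else t.2).
    apply/setP => -[g1 g2]; rewrite !inE /= andbT hold_shifted ?(single_size vt) // /tag_true.
    case: t {vt} => c [b1 b2] /=; do 2? case: ifP => _; apply/eqP/eqP => [] [-> ->];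
      by rewrite ?addrK ?subrK.
  by rewrite ha cards1 mul1r.
rewrite [gadget_rat _]/(0) rmorph0 sumq.
have [/single_size sv /single_size sw lt] := pair_single vw.
suff -> : [set g | all (hold (shifted s g)) [:: attribute v t; attribute w u]] = set0.
  by rewrite cards0 mul0r.
apply/setP => g; rewrite !inE /= andbT !hold_shifted //; apply/negP => /andP[ht hu].
move: vw (tag_rank_le lt) ht hu; rewrite /pair_names leqNgt lt /= /tag_true.
case: t u lt => [c a] [c' b] /= lt; case: eqP => [ec|nc].
  case/mapP => v' _ [-> ->] _; rewrite -ec => ha hb.
  suff ab : a = b by rewrite ec ab ltnn in lt.
  by move: ha hb; do 2? case: ifP => _; move=> /eqP -> /eqP ->.
have nc' : val c != val c' by apply: contra_notN nc => /eqP /val_inj.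
case: ifP => [/eqP c'2|c'2].
  have ec' : c' = @Ordinal 3 2 isT by apply: val_inj.
  subst c'; case: ifP => // ne _ _ /= h /eqP e.
  move: ne h; rewrite e; case: ifP => [_|c0]; first by move=> + /eqP ea; rewrite ea eqxx.
  case: ifP => [_|c1]; first by move=> + /eqP ea; rewrite ea eqxx.
  by case: c c0 c1 nc' {nc lt e} => [[|[|[|m]]]].
(* The classes differ, the second is not the reference and they come in increasing order: only first
   copy against second copy remains. *)
move=> vw le; have [e0 e1] : c = @Ordinal 3 0 isT /\ c' = @Ordinal 3 1 isT.
  by case: c c' le nc' c'2 {nc lt vw} => [[|[|[|m]]]] //= ? [[|[|[|m']]]] //= ? _ _ _;
    split; apply: val_inj.
subst c c' => /= /eqP ea /eqP eb; move: vw; rewrite ea eb /=.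
rewrite [g.1 + _]addrC addrK [g.2 + _]addrC addrK => /hs.
by rewrite !eqxx.
Qed.

Lemma gadget_correct : CONSISTENT R gadget <-> exists s, satisfied s.
Proof.
rewrite /gadget.
have eQ : map enc_rat (map gadget_rat (undup gadget_itemsets)) =
    map raw_rat (map gadget_freq (undup gadget_itemsets)).
  by rewrite -!map_comp; apply: eq_map => B; apply: gadget_rat_enc.
have cK : canon gadget_top by rewrite /canon /gadget_top last_cat.
have K0 : (0 < bval gadget_top)%N by rewrite -/k gadget_topE expn_gt0.
have [I [<- vI cI]] := raw_instanceP cK K0 gadget_good (undup_uniq _)
  (@gadget_closed) (size_map _ _) eQ.
rewrite CONSISTENT_enc //; split=> [/cI [q [dq hq]]|[s /gadget_complete [q [dq hq]]]].
  apply: (gadget_sound dq) => B; rewrite -mem_undup => BG.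
  have gB := allP gadget_good B BG.
  move: BG => /(nthP [::]) [j lt eB]; have := hq j lt.
  by rewrite (nth_map [::]) // eB gadget_frequency.
apply/cI; exists q; split=> // j lt; have BG := mem_nth [::] lt.
rewrite (nth_map [::]) // gadget_frequency ?(allP gadget_good) //.
by apply: hq; rewrite -mem_undup.
Qed.
End Gadget.

(** * Tableaux *)

(** Locked, because simplification would unfold [iota 0 T.+1]. *)
Definition upto (n : nat) : seq nat := locked (iota 0 n).

Lemma mem_upto n j : (j \in upto n) = (j < n).
Proof. by rewrite /upto -lock mem_iota. Qed.

Lemma poly_upto : poly upto.
Proof. by apply: (poly_ext _ poly_iota) => n; rewrite /upto -lock. Qed.
#[export] Hint Resolve poly_upto : polydb.

Section Nogoods.
Variable p : nat.
Local Notation W := 'I_p.+1.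

Definition block (b : W -> W -> bool) (l : seq (bits * bits)) (d d' : W) : seq (bits * bits) :=
  if b d d' then l else [::].

Lemma satisfied_block b l s :
  satisfied (block b l) s <-> (forall u v, (u, v) \in l -> ~~ b (s u) (s v)).
Proof.
split=> [h u v uv|h d d' u v]; first apply/negP => bs.
  by have := h (s u) (s v) u v; rewrite /block bs !eqxx => /(_ uv).
rewrite /block; case: ifP => // bd /h; apply: contra => /andP[/eqP -> /eqP ->].
by rewrite bd.
Qed.

Definition join (bs : seq ((W -> W -> bool) * seq (bits * bits))) (d d' : W) : seq (bits * bits) :=
  flatten [seq block b.1 b.2 d d' | b <- bs].

Fixpoint all_blocks (s : bits -> W) (bs : seq ((W -> W -> bool) * seq (bits * bits))) : Prop :=
  if bs is b :: bs' then
    (forall u v, (u, v) \in b.2 -> ~~ b.1 (s u) (s v)) /\ all_blocks s bs'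
  else True.

Lemma satisfied_join bs s : satisfied (join bs) s <-> all_blocks s bs.
Proof.
elim: bs => [|b bs IH] /=; first by split.
rewrite -IH -satisfied_block; split=> [h|[h1 h2] d d' u v].
  by split=> d d' u v uv; apply: h; rewrite /join /= mem_cat uv ?orbT.
by rewrite /join /= mem_cat => /orP[/h1|/h2].
Qed.

Lemma join_sub bs (P : bits * bits -> bool) d d' uv :
  all (fun b => all P b.2) bs -> uv \in join bs d d' -> P uv.
Proof.
elim: bs => //= b bs IH /andP[/allP h /IH {}IH]; rewrite /join /= mem_cat => /orP[|/IH //].
by rewrite /block; case: ifP => // _ /h.
Qed.
End Nogoods.

Section Tableau.
Variable M : TM.
Local Notation tapeI := 'I_(tm_tapes M).+1.
Local Notation sym := (cell (tm_sym M)).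

(** Column j holds, for each tape, the j-th cells to the left and to the right. It also repeats the
    state and all the symbols read, so that every column knows the action of the machine and the
    constraints need to involve only two columns. *)
Definition column : finType :=
  (tm_state M * {ffun tapeI -> option (bool + tm_sym M)} *
   {ffun tapeI -> option (bool + tm_sym M) * option (bool + tm_sym M)})%type.

Definition column_at (c : config M) (j : nat) : column :=
  (c.1, [ffun i => tape_read (c.2 i)],
   [ffun i => (nth None (c.2 i).1 j, nth None (c.2 i).2 j)]).

Definition cstate (v : column) := v.1.1.
Definition cread (v : column) (i : tapeI) : sym := v.1.2 i.
Definition cleft (v : column) (i : tapeI) : sym := (v.2 i).1.
Definition cright (v : column) (i : tapeI) : sym := (v.2 i).2.

Definition transition (q : tm_state M) (rd : {ffun tapeI -> sym}) :
    tm_state M * {ffun tapeI -> sym * move} :=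
  if tm_halt q then (q, [ffun i => (rd i, Stay)]) else tm_trans q rd.

Definition cnext (v : column) := transition (cstate v) v.1.2.

Definition row_ok (v v' : column) : bool := (cstate v == cstate v') && (v.1.2 == v'.1.2).

(** A new column depends on the old one at the same place and on its two neighbours. But the move
    decides from which single one of them each cell comes, so that this dependence splits into three
    binary constraints. *)
Definition from_right_ok (v v' : column) : bool :=
  [forall i, match ((cnext v).2 i).2 with
    | MoveLeft => cleft v' i == cleft v i
    | Stay => true
    | MoveRight => cright v' i == cright v i
    end].

(** [first] stands for the old column being column 0, which contains the cells under the heads;
    there the symbol written replaces the old one. *)
Definition from_same_ok (first : bool) (v v' : column) : bool :=
  (cstate v' == (cnext v).1) && [forall i, match ((cnext v).2 i).2 with
    | MoveLeft => first ==> (cright v' i == cleft v i)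
    | Stay => (cleft v' i == cleft v i) &&
        (cright v' i == if first then ((cnext v).2 i).1 else cright v i)
    | MoveRight => first ==> (cleft v' i == ((cnext v).2 i).1)
    end].

Definition from_left_ok (first : bool) (v v' : column) : bool :=
  [forall i, match ((cnext v).2 i).2 with
    | MoveLeft => cright v' i == if first then ((cnext v).2 i).1 else cright v i
    | Stay => true
    | MoveRight => cleft v' i == cleft v i
    end].

(** Imposed on column 0, it ties the repeated symbols to the cells under the heads; [row_ok] spreads
    them along the row. *)
Definition head_ok (v : column) : bool := [forall i, cread v i == cright v i].

Lemma column_eqP (v v' : column) : cstate v = cstate v' -> cread v =1 cread v' ->
  cleft v =1 cleft v' -> cright v =1 cright v' -> v = v'.
Proof.
case: v => [[q rd] lr]; case: v' => [[q' rd'] lr']; rewrite /cstate /cread /cleft /cright /=.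
move=> -> er el ert; congr (_, _, _); apply/ffunP => i; first exact: er.
by have := el i; have := ert i; case: (lr i) => a b; case: (lr' i) => a' b' /= -> ->.
Qed.

Lemma cnextE c j :
  cnext (column_at c j) = transition c.1 [ffun i => tape_read (c.2 i)].
Proof. by []. Qed.

Lemma step_state c j : (step c).1 = (cnext (column_at c j)).1.
Proof.
rewrite /step /cnext /transition /cstate /=; case: ifP => // _.
by case: (tm_trans _ _).
Qed.

Lemma step_tape c i j k :
  let t := tape_act ((cnext (column_at c k)).2 i) (c.2 i) in
  nth None ((step c).2 i).1 j = nth None t.1 j /\
  nth None ((step c).2 i).2 j = nth None t.2 j.
Proof.
rewrite /step /cnext /transition /cstate /=; case: ifP => _ /=.
  rewrite !ffunE /=; split=> //; rewrite /tape_read.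
  by case: (c.2 i).2 j => [|a r] [|j] //=; rewrite nth_nil.
by case: (tm_trans _ _) => q a /=; rewrite !ffunE.
Qed.

Lemma column_step_ok c j :
  [/\ from_right_ok (column_at c j.+1) (column_at (step c) j),
      from_same_ok (j == 0) (column_at c j) (column_at (step c) j)
    & from_left_ok (j == 0) (column_at c j) (column_at (step c) j.+1)].
Proof.
split.
- apply/forallP => i; rewrite /cleft /cright !ffunE /=.
  have [-> ->] := step_tape c i j j.+1.
  case: (c.2 i) => l r; case: ((cnext _).2 i) => a [] //=; rewrite ?nth_behead //=; by case: r; case: l.
- rewrite /from_same_ok /cstate /= -(step_state c j) eqxx /=.
  apply/forallP => i; rewrite /cleft /cright !ffunE /=.
  have [-> ->] := step_tape c i j j.
  case: (c.2 i) => l r; case: ((cnext _).2 i) => a [] /=; case: j => [|j] //=; rewrite ?nth_behead ?eqxx ?nth0 //=;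
    by case: r; case: l.
- apply/forallP => i; rewrite /cleft /cright !ffunE /=.
  have [-> ->] := step_tape c i j.+1 j.
  by case: (c.2 i) => l r; case: ((cnext _).2 i) => a [] //=; case: j => [|j] //=; rewrite ?nth_behead.
Qed.

Lemma column_step c j (d : column) :
  from_right_ok (column_at c j.+1) d -> from_same_ok (j == 0) (column_at c j) d ->
  (0 < j -> from_left_ok (j.-1 == 0) (column_at c j.-1) d) ->
  [/\ cstate d = (step c).1, cleft d =1 cleft (column_at (step c) j)
    & cright d =1 cright (column_at (step c) j)].
Proof.
move=> hr /andP[/eqP hq hs] hl.
have [gr /andP[_ gs] _] := column_step_ok c j.
have gl : 0 < j -> from_left_ok (j.-1 == 0) (column_at c j.-1) (column_at (step c) j).
  by case: j {hr hq hs hl gr gs} => // j _; have [] := column_step_ok c j.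
split; first by rewrite hq -step_state.
  move=> i; have := forallP hr i; have := forallP hs i; have := forallP gr i; have := forallP gs i.
  have hl' j0 := forallP (hl j0) i; have gl' j0 := forallP (gl j0) i.
  move: hl' gl'; rewrite ?cnextE; case: ((transition _ _).2 i) => a [] /=.
  + by move=> _ _ _ /eqP -> _ /eqP ->.
  + by move=> _ _ /andP[/eqP -> _] _ /andP[/eqP -> _] _.
  case: j {hr hq hs hl gr gs gl} => [|j] /=.
    by move=> _ _ /eqP -> _ /eqP -> _.
  by move=> /(_ isT) /eqP -> /(_ isT) /eqP ->.
move=> i; have := forallP hr i; have := forallP hs i; have := forallP gr i; have := forallP gs i.
have hl' j0 := forallP (hl j0) i; have gl' j0 := forallP (gl j0) i.
move: hl' gl'; rewrite ?cnextE; case: ((transition _ _).2 i) => a [] /=.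
+ case: j {hr hq hs hl gr gs gl} => [|j] /=.
    by move=> _ _ /eqP -> _ /eqP -> _.
  by move=> /(_ isT) /eqP -> /(_ isT) /eqP ->.
+ by move=> _ _ /andP[_ /eqP ->] _ /andP[_ /eqP ->] _.
by move=> _ _ _ /eqP -> _ /eqP ->.
Qed.

(** A verifier with a single tape never sees the witness, which then counts as blank. *)
Definition tape1 (v : column) : sym := if insub 1 is Some i then cright v i else None.

(** On tape 1 only work symbols are excluded: its content is the guess of a witness. The content of
    tape 0 is prescribed cell by cell in [tableau_blocks]. *)
Definition init_ok (v : column) : bool :=
  [&& cstate v == tm_start M, [forall i, cleft v i == None],
      if tape1 v is Some (inr _) then false else true
    & [forall i : tapeI, (1 < i) ==> (cright v i == None)]].

Lemma leading_bits_nth (S : finType) (l : seq (cell S)) :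
  (forall j, if nth None l j is Some (inr _) then false else true) ->
  (forall j, nth None l j = None -> nth None l j.+1 = None) ->
  forall j, nth None [seq Some (inl b) | b <- leading_bits l] j = nth None l j.
Proof.
elim: l => [|a l IH] h1 h2 j; first by rewrite /= !nth_nil.
have {}IH := IH (fun j' => h1 j'.+1) (fun j' => h2 j'.+1).
case: a h1 h2 => [[b|s]|] h1 h2 /=; last first.
- rewrite nth_nil; elim: j => // j IHj.
  by rewrite [RHS](h2 j).
- by have := h1 0.
by case: j => //= j; apply: IH.
Qed.

Lemma size_leading_bits (S : finType) (l : seq (cell S)) : size (leading_bits l) <= size l.
Proof. by elim: l => [|[[b|s]|] l IH]. Qed.

(** Columns are numbered by a type of the form ['I_p.+1], the cyclic group on which the gadget is
    built. *)
Definition column_index (v : column) : 'I_(#|{: column}|.-1).+1 := inord (enum_rank v).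

Definition column0 : column := column_at (init M [::]) 0.

Definition column_of (w : 'I_(#|{: column}|.-1).+1) : column := nth column0 (enum column) w.

Lemma column_indexK : cancel column_index column_of.
Proof.
move=> v; rewrite /column_of /column_index inordK ?nth_enum_rank //.
by rewrite prednK ?ltn_ord //; apply/card_gt0P; exists v.
Qed.

(** Row and column in unary, each padded to length T, so that all names have the same length, as the
    gadget requires. *)
Definition cname (T t j : nat) : bits :=
  (map (fun=> true) (unary t) ++ map (fun=> false) (drop t (unary T))) ++
  (map (fun=> true) (unary j) ++ map (fun=> false) (drop j (unary T))).

Lemma size_cname T t j : t <= T -> j <= T -> size (cname T t j) = T + T.
Proof.
by move=> ht hj; rewrite !size_cat !size_map !size_drop !size_unary !subnKC.
Qed.

Definition crow (T : nat) (b : bits) : nat := count id (take T b).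
Definition ccol (T : nat) (b : bits) : nat := count id (drop T b).

Lemma count_true A (l : seq A) : count id (map (fun=> true) l) = size l.
Proof. by elim: l => //= a l ->. Qed.
Lemma count_false A (l : seq A) : count id (map (fun=> false) l) = 0.
Proof. by elim: l. Qed.

Lemma cnameK T t j : t <= T -> crow T (cname T t j) = t /\ ccol T (cname T t j) = j.
Proof.
move=> ht; pose a := map (fun=> true) (unary t) ++ map (fun=> false) (drop t (unary T)).
have sa : size a = T by rewrite size_cat !size_map size_drop !size_unary subnKC.
rewrite /crow /ccol /cname -/a take_size_cat // drop_size_cat //.
by rewrite /a !count_cat !count_true !count_false !size_unary !addn0.
Qed.

Variables (x : bits) (n T : nat).
Local Notation nm := (cname T).
Local Notation W := 'I_(#|{: column}|.-1).+1.

Let bad (r : column -> column -> bool) (d d' : W) : bool := ~~ r (column_of d) (column_of d').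
(** A constraint on one variable, posed on the pair of this variable with itself. *)
Let bad1 (r : column -> bool) (d d' : W) : bool := (d == d') && ~~ r (column_of d).

Definition cvars : seq bits := [seq nm t j | t <- upto T.+1, j <- upto T.+1].

(** The first block supplies the nogoods that make the copies of a variable agree. Column T has no
    right neighbour, so from row 1 on its content is not fully constrained. *)
Definition tableau_blocks : seq ((W -> W -> bool) * seq (bits * bits)) :=
  [:: (fun d d' => d != d', [seq (nm t j, nm t j) | t <- upto T.+1, j <- upto T.+1]);
      (bad row_ok, [seq (nm t j, nm t j.+1) | t <- upto T.+1, j <- upto T]);
      (bad from_right_ok, [seq (nm t j.+1, nm t.+1 j) | t <- upto T, j <- upto T]);
      (bad (from_same_ok true), [seq (nm t 0, nm t.+1 0) | t <- upto T]);
      (bad (from_same_ok false), [seq (nm t j.+1, nm t.+1 j.+1) | t <- upto T, j <- upto T]);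
      (bad (from_left_ok true), [seq (nm t 0, nm t.+1 1) | t <- upto T]);
      (bad (from_left_ok false), [seq (nm t j.+1, nm t.+1 j.+2) | t <- upto T, j <- upto T.-1]);
      (bad1 head_ok, [seq (nm t 0, nm t 0) | t <- upto T.+1]);
      (bad1 init_ok, [seq (nm 0 j, nm 0 j) | j <- upto T.+1]);
      (bad1 (fun v => cright v ord0 == Some (inl true)), [seq (nm 0 j, nm 0 j) | j <-
         [seq j <- upto T.+1 | nth false x j && (j < size x)]]);
      (bad1 (fun v => cright v ord0 == Some (inl false)), [seq (nm 0 j, nm 0 j) | j <-
         [seq j <- upto T.+1 | ~~ nth false x j && (j < size x)]]);
      (bad1 (fun v => cright v ord0 == None), [seq (nm 0 j, nm 0 j) | j <-
         [seq j <- upto T.+1 | size x <= j]]);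
      (bad1 (fun v => tape1 v == None), [seq (nm 0 j, nm 0 j) | j <-
         [seq j <- upto T.+1 | n <= j]]);
      (bad (fun v v' => (tape1 v == None) ==> (tape1 v' == None)),
         [seq (nm 0 j, nm 0 j.+1) | j <- upto T]);
      (bad1 (fun v => tm_accept (cstate v)), [:: (nm T 0, nm T 0)])].

Definition tableau : W -> W -> seq (bits * bits) := join tableau_blocks.

Lemma cvarsP t j : t <= T -> j <= T -> nm t j \in cvars.
Proof.
move=> ht hj; by apply/allpairsP; exists (t, j); split; rewrite ?mem_upto.
Qed.

Lemma cvars_size v : v \in cvars -> size v = T + T.
Proof.
by case/allpairsP => -[t j] /= []; rewrite !mem_upto !ltnS /= => ht hj ->; apply: size_cname.
Qed.

Lemma tableau_sub d d' u v : (u, v) \in tableau d d' -> u \in cvars /\ v \in cvars.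
Proof.
move=> uv; apply/andP.
have := @join_sub _ tableau_blocks (fun w => (w.1 \in cvars) && (w.2 \in cvars)) d d' (u, v).
apply=> //; rewrite /tableau_blocks /=; repeat (apply/andP; split) => //.
all: try by rewrite !cvarsP.
all: apply/allP => w.
all: try (case/allpairsP => -[t j] []; rewrite !mem_upto /= => h1 h2 ->;
  rewrite /= !cvarsP //; lia).
all: by case/mapP => t; rewrite ?mem_filter !mem_upto /= => h ->;
  rewrite /= !cvarsP //; lia.
Qed.

Lemma tableau_diag d d' v : v \in cvars -> d != d' -> (v, v) \in tableau d d'.
Proof.
move=> vV ne; rewrite /tableau /join /= mem_cat {1}/block /= ne; apply/orP; left.
case/allpairsP: vV => -[t j] /= [ht hj ->].
by apply/allpairsP; exists (t, j).
Qed.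
End Tableau.

(** * Solutions of the tableau and accepting runs *)

Section TableauCorrect.
Variables (M : TM) (x : bits) (n T : nat).
Hypothesis le_nT : n <= T.
Local Notation tapeI := 'I_(tm_tapes M).+1.
Local Notation nm := (cname T).

Lemma input_cell_None (S : finType) (w : seq bool) j :
  (nth (None : cell S) [seq Some (inl b) | b <- w] j == None) = (size w <= j).
Proof.
case: (leqP (size w) j) => h; first by rewrite nth_default ?size_map.
by rewrite (nth_map false).
Qed.

Lemma cright_init w i j : cright (column_at (init M [:: x; w]) j) i =
  nth None [seq Some (inl b) | b <- nth [::] [:: x; w] i] j.
Proof. by rewrite /cright !ffunE. Qed.

Lemma tape1_init w j : tape1 (column_at (init M [:: x; w]) j) =
  if (insub 1 : option tapeI) is Some _ then nth None [seq Some (inl b) | b <- w] j else None.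
Proof.
rewrite /tape1; case: insubP => // i _ e.
by rewrite cright_init e.
Qed.

Lemma tableau_complete w : size w <= n -> accepting (run M [:: x; w] T) ->
  exists s, satisfied (@tableau M x n T) s.
Proof.
move=> sw acc; pose col t j := column_at (run M [:: x; w] t) j.
pose s b := column_index (col (crow T b) (ccol T b)).
have sE t j : t <= T -> column_of (s (nm t j)) = col t j.
  by move=> ht; rewrite /s column_indexK; have [-> ->] := cnameK j ht.
have init0 j : col 0 j = column_at (init M [:: x; w]) j by [].
have stepE t : run M [:: x; w] t.+1 = step (run M [:: x; w] t) by [].
exists s; apply/satisfied_join; rewrite /=; repeat split; move=> u v.
- by case/allpairsP => -[t j] [_ _ [-> ->]] /=; rewrite eqxx.
- case/allpairsP => -[t j] []; rewrite !mem_upto /= => ht hj [-> ->].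
  by rewrite !sE // /row_ok /= !eqxx.
- case/allpairsP => -[t j] []; rewrite !mem_upto /= => ht hj [-> ->].
  rewrite negbK !sE ?(ltnW ht) // /col stepE; by have [] := column_step_ok (run M [:: x; w] t) j.
- case/mapP => t; rewrite mem_upto => ht [-> ->].
  rewrite negbK !sE ?(ltnW ht) // /col stepE; by have [] := column_step_ok (run M [:: x; w] t) 0.
- case/allpairsP => -[t j] []; rewrite !mem_upto /= => ht hj [-> ->].
  rewrite negbK !sE ?(ltnW ht) // /col stepE; by have [] := column_step_ok (run M [:: x; w] t) j.+1.
- case/mapP => t; rewrite mem_upto => ht [-> ->].
  rewrite negbK !sE ?(ltnW ht) // /col stepE; by have [] := column_step_ok (run M [:: x; w] t) 0.
- case/allpairsP => -[t j] []; rewrite !mem_upto /= => ht hj [-> ->].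
  rewrite negbK !sE ?(ltnW ht) // /col stepE; by have [] := column_step_ok (run M [:: x; w] t) j.+1.
- case/mapP => t; rewrite mem_upto => ht [-> ->]; rewrite eqxx negbK sE //.
  by apply/forallP => i; rewrite /cread /cright !ffunE /tape_read nth0.
- case/mapP => j; rewrite mem_upto => hj [-> ->]; rewrite eqxx negbK sE // init0.
  rewrite /init_ok tape1_init /cstate /= eqxx /=; apply/and3P; split.
  + by apply/forallP => i; rewrite /cleft !ffunE /= nth_nil.
  + case: insubP => // i _ _; case: (ltnP j (size w)) => h.
      by rewrite (nth_map false).
    by rewrite nth_default ?size_map.
  apply/forallP => i; apply/implyP => hi; rewrite cright_init.
  by rewrite [nth [::] _ _]nth_default //= nth_nil.
- case/mapP => j; rewrite mem_filter mem_upto => /andP[/andP[xj lt] hj] [-> ->].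
  by rewrite eqxx negbK sE // init0 cright_init /= (nth_map false) // xj.
- case/mapP => j; rewrite mem_filter mem_upto => /andP[/andP[xj lt] hj] [-> ->].
  by rewrite eqxx negbK sE // init0 cright_init /= (nth_map false) // (negPf xj).
- case/mapP => j; rewrite mem_filter mem_upto => /andP[lt hj] [-> ->].
  by rewrite eqxx negbK sE // init0 cright_init /= input_cell_None.
- case/mapP => j; rewrite mem_filter mem_upto => /andP[lt hj] [-> ->].
  rewrite eqxx negbK sE // init0 tape1_init; case: insub => // _.
  by rewrite input_cell_None (leq_trans sw).
- case/mapP => j; rewrite mem_upto => hj [-> ->]; rewrite negbK !sE // !init0 !tape1_init.
  case: insub => // _; rewrite !input_cell_None; apply/implyP => h; exact: leqW.
by rewrite inE => /eqP[-> ->]; rewrite eqxx negbK sE.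
Qed.

Lemma tableau_sound s : satisfied (@tableau M x n T) s ->
  exists w, size w <= n /\ accepting (run M [:: x; w] T).
Proof.
move/satisfied_join => /=.
pose f t j := column_of (s (nm t j)).
case=> _ [hH [hR [hS0 [hS [hL0 [hL [hHd [hI [hx1 [hx0 [hxN [hW [hWH [hacc _]]]]]]]]]]]]]].
have {}hH t j : t <= T -> j < T -> row_ok (f t j) (f t j.+1).
  move=> ht hj; have := hH (nm t j) (nm t j.+1); rewrite negbK; apply.
  by apply/allpairsP; exists (t, j); rewrite !mem_upto.
have {}hR t j : t < T -> j < T -> from_right_ok (f t j.+1) (f t.+1 j).
  move=> ht hj; have := hR (nm t j.+1) (nm t.+1 j); rewrite negbK; apply.
  by apply/allpairsP; exists (t, j); rewrite !mem_upto.
have {hS0}hS t j : t < T -> j <= T -> from_same_ok (j == 0) (f t j) (f t.+1 j).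
  move=> ht; case: j => [_|j hj].
    have := hS0 (nm t 0) (nm t.+1 0); rewrite negbK; apply.
    by apply/mapP; exists t; rewrite ?mem_upto.
  have := hS (nm t j.+1) (nm t.+1 j.+1); rewrite negbK; apply.
  by apply/allpairsP; exists (t, j); rewrite !mem_upto.
have {hL0}hL t j : t < T -> j < T -> from_left_ok (j == 0) (f t j) (f t.+1 j.+1).
  move=> ht; case: j => [_|j hj].
    have := hL0 (nm t 0) (nm t.+1 1); rewrite negbK; apply.
    by apply/mapP; exists t; rewrite ?mem_upto.
  have := hL (nm t j.+1) (nm t.+1 j.+2); rewrite negbK; apply.
  apply/allpairsP; exists (t, j); rewrite !mem_upto; split=> //=; lia.
have {}hHd t : t <= T -> head_ok (f t 0).
  move=> ht; have := hHd (nm t 0) (nm t 0); rewrite eqxx negbK; apply.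
  by apply/mapP; exists t; rewrite ?mem_upto.
have {}hI j : j <= T -> init_ok (f 0 j).
  move=> hj; have := hI (nm 0 j) (nm 0 j); rewrite eqxx negbK; apply.
  by apply/mapP; exists j; rewrite ?mem_upto.
have hx j : j <= T -> cright (f 0 j) ord0 = nth None [seq Some (inl b) | b <- x] j.
  move=> hj; case: (ltnP j (size x)) => lt.
    rewrite (nth_map false) //; apply/eqP; case xj: (nth false x j).
      have := hx1 (nm 0 j) (nm 0 j); rewrite eqxx negbK; apply.
      by apply/mapP; exists j; rewrite // mem_filter mem_upto xj lt.
    have := hx0 (nm 0 j) (nm 0 j); rewrite eqxx negbK; apply.
    by apply/mapP; exists j; rewrite // mem_filter mem_upto xj lt.
  rewrite [RHS]nth_default ?size_map //; apply/eqP.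
  have := hxN (nm 0 j) (nm 0 j); rewrite eqxx negbK; apply.
  by apply/mapP; exists j; rewrite // mem_filter mem_upto lt.
have {}hW j : j <= T -> n <= j -> tape1 (f 0 j) = None.
  move=> hj le; apply/eqP; have := hW (nm 0 j) (nm 0 j); rewrite eqxx negbK; apply.
  by apply/mapP; exists j; rewrite // mem_filter mem_upto le.
have {}hWH j : j < T -> tape1 (f 0 j) = None -> tape1 (f 0 j.+1) = None.
  move=> hj e; apply/eqP; have := hWH (nm 0 j) (nm 0 j.+1).
  rewrite negbK -!/(f _ _) e eqxx /=; apply.
  by apply/mapP; exists j; rewrite ?mem_upto.
have {}hacc : tm_accept (cstate (f T 0)).
  by have := hacc (nm T 0) (nm T 0); rewrite eqxx negbK inE eqxx; apply.
(* The witness is read off tape 1 in row 0. The constraint that a blank is followed by a blank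
   ensures that its leading bits are all that is written there. *)
pose cells := [seq tape1 (f 0 j) | j <- iota 0 n].
have cellsE j : nth None cells j = if j < n then tape1 (f 0 j) else None.
  case: ifP => h; last by rewrite nth_default // size_map size_iota leqNgt h.
  by rewrite (nth_map 0) ?size_iota // nth_iota.
exists (leading_bits cells); split.
  by apply: leq_trans (size_leading_bits _) _; rewrite size_map size_iota.
have wE j : j <= T -> nth None [seq Some (inl b) | b <- leading_bits cells] j = tape1 (f 0 j).
  move=> hj; rewrite leading_bits_nth.
  - by rewrite cellsE; case: ltnP => // le; rewrite hW.
  - move=> i; rewrite cellsE; case: ltnP => // lt.
    by have /and4P[_ _ ] := hI i (leq_trans (ltnW lt) le_nT).
  move=> i; rewrite !cellsE; case: ltnP => [lt|le]; last by rewrite ltnNge leqW.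
  move=> e; case: ltnP => // _; apply: hWH e; exact: leq_trans lt le_nT.
move: (leading_bits cells) wE => w wE.
(* Since nothing enters column T from the right, each row is known to agree with the run on one
   column fewer than the row before. Column 0 of row T, which carries the final state, is just
   within this triangle. *)
suff H : forall t j, j + t <= T -> f t j = column_at (run M [:: x; w] t) j.
  by rewrite /accepting; have := hacc; rewrite H.
have readE : forall t j, t <= T -> j <= T -> cread (f t j) =1 cright (f t 0).
  move=> t j.
  move=> ht; elim: j => [_|j IH hj] i.
    by have /forallP/(_ i)/eqP := hHd t ht.
  rewrite -IH; last exact: ltnW.
  by have /andP[_ /eqP e] := hH t j ht hj; rewrite /cread e.
move=> t; elim: t => [|t IH] j le.
  have hj : j <= T by lia.
  have /and4P[/eqP h1 /forallP h2 h3 /forallP h4] := hI j hj.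
  have crE k : k <= T -> cright (f 0 k) =1 cright (column_at (init M [:: x; w]) k).
    move=> hk i; rewrite cright_init; case: (ltngtP i 1) => [i0|i2|i1].
    - have -> : i = ord0 by apply: val_inj => /=; lia.
      by rewrite hx.
    - have /and4P[_ _ _ /forallP/(_ i)] := hI k hk; rewrite i2 /= => /eqP ->.
      by rewrite [nth [::] _ _]nth_default //= nth_nil.
    rewrite i1 /= wE // /tape1; case: insubP => [i' _ e'|]; last by rewrite -i1 ltn_ord.
    by congr cright; apply: val_inj; rewrite /= e' i1.
  apply: column_eqP.
  - by rewrite h1.
  - move=> i; rewrite readE // crE // /cread /cright !ffunE /= /tape_read nth0.
    done.
  - by move=> i; rewrite (eqP (h2 i)) /cleft !ffunE /= nth_nil.
  exact: crE.
have htT : t < T by lia.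
have stepc k : k + t.+1 <= T ->
    [/\ cstate (f t.+1 k) = (step (run M [:: x; w] t)).1,
        cleft (f t.+1 k) =1 cleft (column_at (step (run M [:: x; w] t)) k)
      & cright (f t.+1 k) =1 cright (column_at (step (run M [:: x; w] t)) k)].
  move=> hk; apply: column_step.
  - by rewrite -IH; [apply: hR => //; lia | lia].
  - by rewrite -IH; [apply: hS => //; lia | lia].
  case: k hk => // k hk _ /=; rewrite -IH; last lia.
  by apply: hL => //; lia.
have [h1 h2 h3] := stepc j le.
have [_ _ h4] := stepc 0 (leq_trans (leq_addl j t.+1) le).
apply: column_eqP => //; move=> i; rewrite readE; try lia.
by rewrite h4 /cread /cright !ffunE /tape_read nth0.
Qed.

Lemma tableau_correct : (exists s, satisfied (@tableau M x n T) s) <->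
  exists w, size w <= n /\ accepting (run M [:: x; w] T).
Proof.
split=> [[s /tableau_sound //]|[w [sw acc]]]; exact: tableau_complete sw acc.
Qed.
End TableauCorrect.

(** * The reduction *)

(** The list [cs] is fixed. It will range over the tags, which depend on the machine but not on the
    input, so one program per element is affordable. *)
Lemma poly_flatten_const X A (eX : Enc X) (eA : Enc A) (T : Type) (cs : seq T)
    (f : T -> X -> seq A) :
  (forall t, poly (f t)) -> poly (fun x => flatten [seq f t x | t <- cs]).
Proof.
move=> hf; elim: cs => [|t cs IH] /=; first exact: poly_const.
exact: (poly_comp2 poly_cat (hf t) IH).
Qed.

Lemma poly_nseq X A (eX : Enc X) (eA : Enc A) (n : X -> nat) (a : A) :
  poly n -> poly (fun x => nseq (n x) a).
Proof.
move=> hn; refine (poly_ext (f := fun x => map (fun=> a) (unary (n x))) _ _).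
  by move=> x; rewrite /unary map_nseq.
by poly_tac.
Qed.

Section PolyGadget.
Variable p : nat.
Local Notation W := 'I_p.+1.
Context {X : Type} {eX : Enc X}.
Variables (L : X -> nat) (Vs : X -> seq bits) (E : X -> W -> W -> seq (bits * bits)).
Hypotheses (polyL : poly L) (polyV : poly Vs) (polyE : forall d d', poly (fun x => E x d d')).

Lemma poly_attribute (t : tag p) : poly (fun v => attribute v t).
Proof. by rewrite /attribute; poly_tac. Qed.

Lemma poly_ref : poly (fun x => ref (L x)).
Proof. exact: poly_nseq. Qed.

Lemma poly_single_names (t : tag p) : poly (fun x => single_names (L x) (Vs x) t).
Proof.
rewrite /single_names; case: (val t.1 == 2) => //.
exact: (poly_cons poly_ref (poly_const _)).
Qed.

Lemma poly_pair_names (t u : tag p) : poly (fun x => pair_names (L x) (Vs x) (E x) t u).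
Proof.
have hs := poly_single_names t; have hr := poly_ref.
rewrite /pair_names; case: (tag_rank u <= tag_rank t); first exact: poly_const.
case: (t.1 == u.1); last case: (val u.1 == 2); last exact: polyE;
  last (case: (if val t.1 == 0 then _ else _); last exact: poly_const).
- by apply: (poly_map (g := fun _ v => (v, v))) => //; poly_tac.
- apply: (poly_map (g := fun x v => (v, ref (L x)))) => //.
  exact: (poly_pair poly_snd0 (poly_comp hr poly_fst0)).
Qed.

Lemma poly_gadget_itemsets : poly (fun x => gadget_itemsets (L x) (Vs x) (E x)).
Proof.
apply: poly_cons; first exact: poly_const.
apply: (poly_comp2 poly_cat).
  apply: poly_flatten_const => t.
  apply: (poly_map (g := fun _ v => [:: attribute v t])); last exact: poly_single_names.
  by have := poly_attribute t => h; apply: poly_cons; [apply: (poly_comp h poly_snd0) | apply: poly_const].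
apply: poly_flatten_const => t; apply: poly_flatten_const => u.
apply: (poly_map (g := fun _ uv => [:: attribute uv.1 t; attribute uv.2 u])); last exact: poly_pair_names.
have h := poly_attribute t; have h' := poly_attribute u.
apply: poly_cons; first by apply: (poly_comp h (poly_comp poly_fst0 poly_snd0)).
by apply: poly_cons; [apply: (poly_comp h' (poly_comp poly_snd0 poly_snd0)) | apply: poly_const].
Qed.

Lemma poly_gadget_freq : poly (gadget_freq p).
Proof. by rewrite /gadget_freq; poly_tac. Qed.

Lemma poly_gadget : poly (fun x => gadget (L x) (Vs x) (E x)).
Proof.
have hi : poly (fun x => undup (gadget_itemsets (L x) (Vs x) (E x))).
  apply: (poly_comp _ poly_gadget_itemsets); apply: poly_undup; apply: poly_eqseq.
  by apply: poly_eqseq; apply: poly_eqbool.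
apply: (poly_comp3 poly_raw_instance) => //.
  apply: (poly_comp2 poly_cat); last exact: poly_const.
  by apply: poly_nseq; apply: (poly_comp2 poly_addn) => //; apply: poly_const.
apply: (poly_map (g := fun _ => gadget_freq p)) => //.
exact: (poly_comp poly_gadget_freq poly_snd0).
Qed.
End PolyGadget.

Lemma poly_cname : poly3 cname.
Proof. by rewrite /cname; poly_tac. Qed.
#[export] Hint Resolve poly_cname : polydb.

Section PolyTableau.
Variable M : TM.
Variables (n T : bits -> nat).
Hypotheses (polyn : poly n) (polyT : poly T).

Lemma poly_cvars : poly (fun x => cvars (T x)).
Proof. by rewrite /cvars; poly_tac. Qed.

Lemma poly_block p (b : 'I_p.+1 -> 'I_p.+1 -> bool) d d' (l : bits -> seq (bits * bits)) :
  poly l -> poly (fun x => block b (l x) d d').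
Proof. by rewrite /block; case: (b d d') => // _; apply: poly_const. Qed.

Lemma poly_tableau d d' : poly (fun x => @tableau M x (n x) (T x) d d').
Proof.
rewrite /tableau /join /tableau_blocks /=.
by repeat (apply: (poly_comp2 poly_cat)); try (apply: poly_block); poly_tac.
Qed.
End PolyTableau.

Lemma poly_poly_bound c k : poly (poly_bound c k).
Proof.
have hexp : poly (fun n => n ^ k).
  elim: k => [|k IH]; first exact: (poly_const 1).
  refine (poly_ext (f := fun n => n * n ^ k) _ _); first by move=> n; rewrite expnS.
  exact: (poly_comp2 poly_muln poly_id IH).
apply: (poly_comp2 poly_addn); last exact: poly_const.
by apply: (poly_comp2 poly_muln) => //; apply: poly_const.
Qed.

Lemma CONSISTENT_NP_hard (R : realType) : NP_hard (CONSISTENT R).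
Proof.
move=> L' [V [c [k [[M [c' [k' hM]]] hL]]]].
pose n (x : bits) := poly_bound c k (size x).
(* The time bound is taken at the longest witness. The summand [n x] makes the tableau wide enough
   to hold every witness, and running beyond the bound is harmless since a halted machine stays
   put. *)
pose T (x : bits) := poly_bound c' k' (size x + n x) + n x.
have hn : poly n by apply: (poly_comp (poly_poly_bound c k)); apply: poly_size_seq.
have hT : poly T.
  apply: (poly_comp2 poly_addn) => //; apply: (poly_comp (poly_poly_bound c' k')).
  by apply: (poly_comp2 poly_addn) => //; apply: poly_size_seq.
exists (fun x => gadget (T x + T x) (cvars (T x)) (@tableau M x (n x) (T x))); split.
  apply: poly_computable; apply: poly_gadget; last exact: poly_tableau.
    exact: (poly_comp2 poly_addn).
  exact: poly_cvars.
move=> x; rewrite hL gadget_correct; first last.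
- by move=> d d' v; apply: tableau_diag.
- by move=> d d' u v; apply: tableau_sub.
- by move=> v; apply: cvars_size.
rewrite tableau_correct; last exact: leq_addl.
have accE w : size w <= n x -> accepting (run M [:: x; w] (T x)) <-> V x w.
  move=> sw; have [h <-] := hM x w; set T0 := poly_bound _ _ _.
  have le : T0 <= T x.
    rewrite (leq_trans _ (leq_addr _ _)) // is_poly_mono ?leq_add2l //.
    exact: is_poly_monomial.
  suff -> : run M [:: x; w] (T x) = run M [:: x; w] T0 by [].
  by rewrite -(subnK le) /run iterD iter_step_halted.
by split=> -[w [sw]] => [/(accE _ sw)|/(accE _ sw)]; exists w.
Qed.

Theorem theorem5 (R : realType) : NP_complete (CONSISTENT R).
Proof. by split; [apply: CONSISTENT_in_NP | apply: CONSISTENT_NP_hard]. Qed.
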